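(* Let $Q(z)=|z|^2$ on $\mathbb{C}$. Then there is a constant $c>0$ such that $$\liminf_{n\to\infty}\left\{n^{-1}\cdot\|R_n^{(\beta=1)}-n\,\delta_n^{(\beta=1)}\|_\infty\right\}\ge c,$$ where $R_n^{(\beta=1)}$ is the one-point function and $\delta_n^{(\beta=1)}$ the thermal equilibrium density in the potential $Q$ at $\beta=1$.
   Context: Write $dA(z)=\frac1\pi\,dx\,dy$ ($z=x+iy$) and $dA_n=(dA)^{\otimes n}$. $\|\cdot\|_\infty$ is the supremum norm over $\mathbb{C}$. For $\beta>0$, the Coulomb gas $\{z_j\}_1^n$ in potential $Q$ is a random sample from the probability measure $d\mathbb{P}_n^\beta=\frac1{Z_n^\beta}e^{-\beta H_n}\,dA_n$ on $\mathbb{C}^n$, where $H_n=\sum_{i\ne j}\log\frac1{|z_i-z_j|}+n\sum_{i=1}^nQ(z_i)$ (sum over ordered pairs). The one-point function is $R_n^\beta(p)=\lim_{\varepsilon\to0}\varepsilon^{-2}\,\mathbb{E}_n^\beta[N(p,\varepsilon)]$, where $N(p,\varepsilon)$ is the number of particles in the disc with center $p$ and radius $\varepsilon$. For smooth densities $\delta\ge0$ on $\mathbb{C}$ with $\int\delta\,dA=1$ define $$F_n[\delta]=\iint_{\mathbb{C}^2}\log\frac1{|z-w|}\,\delta(z)\delta(w)\,dA(z)\,dA(w)+\int_{\mathbb{C}}Q\,\delta\,dA+\frac1{n\beta}\int_{\mathbb{C}}\delta\log\delta\,dA,$$ with $0\log0=0$. The thermal equilibrium density $\delta_n^\beta$ is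 the minimizer of $F_n$ among smooth $\delta\ge0$ with $\int\delta\,dA=1$. *)

(* Defs.v *)
From HB Require Import structures.
From mathcomp Require Import all_boot all_order all_algebra.
From mathcomp Require Import all_classical all_reals all_analysis.
From mathcomp Require Import measurable_realfun.
Set Implicit Arguments.
Unset Strict Implicit.
Unset Printing Implicit Defensive.
Import Order.TTheory GRing.Theory Num.Theory.
Import numFieldNormedType.Exports.
Local Open Scope classical_set_scope.
Local Open Scope ring_scope.

(* The point x + iy of the complex plane is the pair (x, y).  The factors are
   [measurableTypeR R], an alias of [R], because that is the measurable type
   on which [lebesgue_measure] lives.  *)
Definition plane (R : realType) : Type :=
  (measurableTypeR R * measurableTypeR R)%type.

(* The Euclidean modulus; the library norm on a product is the sup norm.  *)
Definition cabs (R : realType) (z : plane R) : R :=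
  Num.sqrt (z.1 ^+ 2 + z.2 ^+ 2).

Lemma measurable_cabs (R : realType) : measurable_fun setT (@cabs R).
Proof.
have msqrt : measurable_fun [set: R] (@Num.sqrt R).
  by apply: continuous_measurable_fun; exact: sqrt_continuous.
apply: (measurableT_comp msqrt).
by apply: measurable_funD; apply: measurable_funX;
  [exact: measurable_fst | exact: measurable_snd].
Qed.

(* The canonical sigma-finite instance that [\x] gets in the library applies to
   subprobabilities only.  *)
Lemma sigma_finite_product d1 d2 (T1 : measurableType d1)
    (T2 : measurableType d2) (R : realType)
    (m1 : {sigma_finite_measure set T1 -> \bar R})
    (m2 : {sigma_finite_measure set T2 -> \bar R}) :
  sigma_finite setT (m1 \x m2)%E.
Proof.
have /sigma_finiteP[F [TF ndF Foo]] := sigma_finiteT m1.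
have /sigma_finiteP[G [TG ndG Goo]] := sigma_finiteT m2.
exists (fun n => F n `*` G n).
  rewrite -setXTT TF TG predeqE => -[x y]; split.
    move=> [/= [n _ Fnx] [k _ Gky]]; exists (maxn n k) => //; split.
    - by move: x Fnx; exact/subsetPset/ndF/leq_maxl.
    - by move: y Gky; exact/subsetPset/ndG/leq_maxr.
  by move=> [n _ []/= ? ?]; split; exists n.
move=> k; have [? ?] := Foo k; have [? ?] := Goo k.
split; first exact: measurableX.
by rewrite product_measure1E// lte_mul_pinfty// ge0_fin_numE.
Qed.

Section area_measure.
Context {R : realType}.

Definition dA : set (plane R) -> \bar R :=
  mscale (NngNum (ltW (divr_gt0 ltr01 (pi_gt0 R))))
    (lebesgue_measure \x lebesgue_measure)%E.
HB.instance Definition _ := Measure.on dA.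

Let dA_sigma_finite : sigma_finite setT dA.
Proof.
have [F FT Foo] : sigma_finite setT (@lebesgue_measure R \x @lebesgue_measure R)%E.
  exact: sigma_finite_product.
exists F => // k; have [mF Fk] := Foo k; split => //.
by rewrite /dA /mscale /= lte_mul_pinfty// lee_fin divr_ge0// pi_ge0.
Qed.
HB.instance Definition _ := Measure_isSigmaFinite.Build _ _ _ dA dA_sigma_finite.

End area_measure.

Section product_area_measure.
Context {R : realType}.

Definition cons_point n (p : plane R * n.-tuple (plane R)) :
  n.+1.-tuple (plane R) := [the n.+1.-tuple _ of p.1 :: p.2].

Lemma measurable_cons_point n : measurable_fun setT (@cons_point n).
Proof. exact: measurable_cons. Qed.

Section cons_measure.
Context n (mu : {sigma_finite_measure set (n.-tuple (plane R)) -> \bar R}).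

Definition cons_measure : set (n.+1.-tuple (plane R)) -> \bar R :=
  pushforward (dA \x mu)%E (@cons_point n).

Let cons_measure0 : cons_measure set0 = 0%E.
Proof. by rewrite /cons_measure /pushforward preimage_set0 measure0. Qed.

Let cons_measure_ge0 A : (0 <= cons_measure A)%E.
Proof.
by rewrite /cons_measure; apply: measure_ge0; exact: measurable_cons_point.
Qed.

Let cons_measure_sigma_additive : semi_sigma_additive cons_measure.
Proof.
by rewrite /cons_measure; apply: measure_semi_sigma_additive;
  exact: measurable_cons_point.
Qed.

HB.instance Definition _ := isMeasure.Build _ _ _ cons_measure
  cons_measure0 cons_measure_ge0 cons_measure_sigma_additive.

Let cons_measure_sigma_finite : sigma_finite setT cons_measure.
Proof.
have [F FT Foo] : sigma_finite setT (dA \x mu)%E by exact: sigma_finite_product.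
pose uncons (t : n.+1.-tuple (plane R)) := (thead t, [tuple of behead t]).
have unconsK : cancel (@cons_point n) uncons.
  by case=> z t; congr pair; apply/val_inj.
have muncons : measurable_fun setT uncons.
  apply/measurable_fun_pair => //=.
    exact: measurable_tnth.
  exact: measurable_behead.
exists (fun k => uncons @^-1` F k); first by rewrite -preimage_bigcup -FT.
move=> k; have [mF Fk] := Foo k; split.
  by rewrite -[X in measurable X]setTI; exact: muncons.
rewrite /cons_measure /pushforward -comp_preimage.
by rewrite (_ : uncons \o _ = idfun)//; apply/funext.
Qed.
HB.instance Definition _ :=
  Measure_isSigmaFinite.Build _ _ _ cons_measure cons_measure_sigma_finite.

End cons_measure.

(* The n-fold product of [dA]: [dA_ n.+1] is the image of [dA \x dA_ n] under
   the identification of C x C^n with C^(n+1).  *)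
Fixpoint dA_ n : {sigma_finite_measure set (n.-tuple (plane R)) -> \bar R} :=
  match n with
  | 0 => \d_([tuple] : 0.-tuple (plane R))
  | n'.+1 => cons_measure (dA_ n')
  end.

End product_area_measure.

Section gibbs_weight.
Context {R : realType} (Q : {mfun plane R >-> R}) (beta : R) (n : nat).

Definition hamiltonian (z : n.-tuple (plane R)) : R :=
  (\sum_(i < n) \sum_(j < n | j != i) ln (cabs (tnth z i - tnth z j))^-1)
  + n%:R * \sum_(i < n) Q (tnth z i).

Lemma measurable_hamiltonian : measurable_fun setT hamiltonian.
Proof.
have mln : measurable_fun [set: R] (fun x : R => ln x^-1).
  rewrite (_ : (fun x : R => _) = (fun x => - ln x)).
    exact: measurableT_comp.
  apply/funext => x; have [x0|x0] := ltP 0 x; first by rewrite lnV.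
  by rewrite !ln0 ?oppr0// invr_le0.
have mt i := @measurable_tnth _ (plane R) n i.
apply: measurable_funD.
  apply: measurable_sum => i.
  under eq_fun do rewrite big_mkcond/=.
  apply: measurable_sum => j; case: (j != i) => /=; last exact: measurable_cst.
  apply: (measurableT_comp mln); apply: (measurableT_comp (@measurable_cabs R)).
  apply/measurable_fun_pairP; split; apply: measurable_funB;
    by [exact: (measurableT_comp measurable_fst (mt _)) |
        exact: (measurableT_comp measurable_snd (mt _))].
apply: measurable_funM; first exact: measurable_cst.
by apply: measurable_sum => i; exact: (measurableT_comp _ (mt i)).
Qed.

(* The unnormalised measure exp (- beta H_n) dA_n.  Where two points coincide,
   the totalised logarithm gives the density a junk value, on a null set.  *)
Definition gibbs_weight (A : set (n.-tuple (plane R))) : \bar R :=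
  (\int[dA_ n]_(z in A) (expR (- beta * hamiltonian z))%:E)%E.

Let gibbs_weight0 : gibbs_weight set0 = 0%E.
Proof. by rewrite /gibbs_weight integral_set0. Qed.

Let gibbs_weight_ge0 A : (0 <= gibbs_weight A)%E.
Proof. by apply: integral_ge0 => z _; rewrite lee_fin expR_ge0. Qed.

Let gibbs_weight_sigma_additive : semi_sigma_additive gibbs_weight.
Proof.
move=> F mF tF mUF; rewrite /gibbs_weight; apply: cvg_toP.
  apply: ereal_nondecreasing_is_cvgn => m k mk.
  apply: lee_sum_nneg_natr => // i _ _; exact: gibbs_weight_ge0.
rewrite ge0_integral_bigcup//=.
apply: measurable_funTS; apply/measurable_EFinP.
apply: (measurableT_comp (@measurable_expR R)).
by apply: measurable_funM => //; exact: measurable_hamiltonian.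
Qed.

HB.instance Definition _ := isMeasure.Build _ _ _ gibbs_weight
  gibbs_weight0 gibbs_weight_ge0 gibbs_weight_sigma_additive.

End gibbs_weight.

Section coulomb_gas.
Context {R : realType} (Q : {mfun plane R >-> R}) (beta : R) (n : nat).

(* The Dirac mass is the value that [mnormalize] returns when the partition
   function [gibbs_weight Q beta setT] is 0 or infinite.  *)
Definition coulomb_gas : probability (n.-tuple (plane R)) R :=
  mnormalize (@gibbs_weight R Q beta n) (\d_(nseq_tuple n (0 : plane R))).

Definition nparticles (p : plane R) (eps : R) (z : n.-tuple (plane R)) : nat :=
  #|[pred i : 'I_n | cabs (tnth z i - p) < eps]|.

Definition one_point (p : plane R) : R :=
  lim (eps ^- 2 * fine ('E_coulomb_gas [fun z => (nparticles p eps z)%:R])%E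
       @[eps --> 0^'+]).

End coulomb_gas.

(* C^oo: all iterated directional derivatives exist and are (Frechet)
   differentiable, hence continuous.  *)
Definition smooth (R : realType) (f : plane R -> R) : Prop :=
  forall (vs : seq (plane R)) (z : plane R),
    differentiable (foldr (fun v g => 'D_v g) f vs) z.

Section thermal_equilibrium.
Context {R : realType} (Q : plane R -> R) (beta : R) (n : nat).
Implicit Type delta : plane R -> R.

Definition log_energy_density delta (p : plane R * plane R) : R :=
  ln (cabs (p.1 - p.2))^-1 * delta p.1 * delta p.2.

(* [ln 0 = 0], so [delta z * ln (delta z)] has the required value where
   [delta] vanishes.  *)
Definition free_energy delta : R :=
  (\int[(dA \x dA)%E]_p log_energy_density delta p)
  + (\int[dA]_z (Q z * delta z))
  + (n%:R * beta)^-1 * \int[dA]_z (delta z * ln (delta z)).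

(* The library totalises the integral of a non-integrable function, so the
   minimisation must be restricted to densities of finite free energy.  When
   [Q z = |z|^2], a density failing this condition has free energy +oo or
   undefined (oo - oo), so no competitor is lost.  *)
Definition finite_free_energy delta : Prop :=
  [/\ (dA \x dA)%E.-integrable setT (EFin \o log_energy_density delta),
      dA.-integrable setT (fun z => (Q z * delta z)%:E) &
      dA.-integrable setT (fun z => (delta z * ln (delta z))%:E)].

Definition admissible_density delta : Prop :=
  [/\ smooth delta, (forall z, 0 <= delta z),
      (\int[dA]_z (delta z)%:E = 1)%E & finite_free_energy delta].

Definition is_thermal_equilibrium delta : Prop :=
  admissible_density delta /\
  forall delta', admissible_density delta' ->
    free_energy delta <= free_energy delta'.

End thermal_equilibrium.

Definition sup_norm (R : realType) (f : plane R -> R) : \bar R :=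
  ereal_sup [set `|f z|%:E | z in [set: plane R]].

Definition normsq (R : realType) (z : plane R) : R := cabs z ^+ 2.

Lemma measurable_normsq (R : realType) : measurable_fun setT (@normsq R).
Proof. by apply: measurable_funX; exact: measurable_cabs. Qed.

HB.instance Definition _ (R : realType) :=
  isMeasurableFun.Build _ _ (plane R) R (@normsq R) (@measurable_normsq R).

(* Main.v *)
(* At beta = 1 the Coulomb gas in the potential |z|^2 is the Ginibre ensemble: the
   squared Vandermonde determinant is orthogonalised by the monomials, so that the
   one-point function is n rho with rho(z) = q(n |z|^2), where q(s) = e^-s sum_(k < n) s^k / k!.

   Varying the free energy in the directions psi = d dbar phi, with phi a bump function,
   and evaluating the logarithmic potential of psi by Green's formula shows that the
   thermal equilibrium density satisfies (1/n) d dbar ln delta = delta - 1 weakly.  On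
   the other hand (1/n) d dbar ln rho = rho - 1 - E, and E is bounded below by an absolute
   constant on the annulus n - 3 sqrt n <= n |z|^2 <= n - 2 sqrt n.  Hence
     (1/n) int psi (ln delta - ln rho) = int phi (delta - rho + E).
   Take phi of width of order 1 / sqrt n supported in that annulus.  If delta and rho were
   everywhere c-close with c small, the left side would be O(c / n), while the right side
   is at least a constant times 1 / n. *)
Require Import Defs.
From mathcomp Require Import all_boot all_order all_algebra.
From mathcomp Require Import all_classical all_reals all_analysis.
From mathcomp Require Import measurable_realfun complex perm ring lra.
Set Implicit Arguments.
Unset Strict Implicit.
Unset Printing Implicit Defensive.
Import Order.TTheory GRing.Theory Num.Theory.
Import numFieldNormedType.Exports.
Local Open Scope classical_set_scope.
Local Open Scope ring_scope.

(** * The tail of the Erlang distribution *)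

(** The test direction is a Laplacian so that its logarithmic potential is local: the potential of
    psi is a multiple of phi, and nothing about delta outside the support of phi enters. The
    perturbation delta + t psi must stay nonnegative, and no a priori lower bound on delta is at
    hand; it is drawn from the assumption to be refuted, since rho >= e^-19 on the annulus and delta
    is c-close to rho. The same bound makes ln Lipschitz on the values that occur. The width 1 /
    sqrt n balances the sides: psi has size of order n on a box of area of order 1 / n, so the
    integral of |psi| stays bounded and the left side is O(c / n), while the integral of phi is
    itself of order 1 / n.

    The annulus answers two competing demands. With s = n |z|^2 and w = e^-s s^(n-1) / (n-1)!, the
    defect E is rho - 1 + (n - s) w / rho + s (w / rho)^2. Distance at least 2 sqrt n from the edge
    makes the middle term at least 2 sqrt n w, which beats 1 - rho <= sqrt n w; distance at most 3
    sqrt n keeps sqrt n w above an absolute constant. *)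

Section pointwise_derivation_rules.
Context {R : realType}.
Implicit Types (f g : R -> R) (x c df dg : R).

Lemma pderive_cst c x : is_derive x 1 (fun=> c) 0.
Proof. exact: is_derive_cst. Qed.

Lemma pderive_id x : is_derive x 1 (fun y : R => y) 1.
Proof. exact: is_derive_id. Qed.

Lemma pderiveD f g x df dg : is_derive x 1 f df -> is_derive x 1 g dg ->
  is_derive x 1 (fun y => f y + g y) (df + dg).
Proof. exact: is_deriveD. Qed.

Lemma pderiveN f x df : is_derive x 1 f df -> is_derive x 1 (fun y => - f y) (- df).
Proof. exact: is_deriveN. Qed.

Lemma pderiveM f g x df dg : is_derive x 1 f df -> is_derive x 1 g dg ->
  is_derive x 1 (fun y => f y * g y) (f x * dg + g x * df).
Proof. exact: is_deriveM. Qed.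

Lemma pderive_comp f g x df dg :
  is_derive x 1 g dg -> is_derive (g x) 1 f df ->
  is_derive x 1 (fun y => f (g y)) (dg * df).
Proof.
by move=> hg hf; rewrite mulrC; exact: (is_derive1_comp hf hg).
Qed.

Lemma pderiveX n f x df : is_derive x 1 f df ->
  is_derive x 1 (fun y => f y ^+ n) (n%:R * f x ^+ n.-1 * df).
Proof.
move=> hf; have -> : (fun y => f y ^+ n) = f ^+ n.
  by apply/funext => y; rewrite exprfctE.
exact: is_deriveX.
Qed.

Lemma pderiveV f x df : is_derive x 1 f df -> f x != 0 ->
  is_derive x 1 (fun y => (f y)^-1) (- (f x) ^- 2 * df).
Proof. by move=> hf fx0; exact: is_deriveV. Qed.

Lemma pderive_expR f x df : is_derive x 1 f df ->
  is_derive x 1 (fun y => expR (f y)) (df * expR (f x)).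
Proof. by move=> hf; apply: pderive_comp hf _; exact: is_derive_expR. Qed.

Lemma pderive_ln f x df : is_derive x 1 f df -> 0 < f x ->
  is_derive x 1 (fun y => ln (f y)) (df * (f x)^-1).
Proof. by move=> hf fx; apply: pderive_comp hf _; exact: is_derive1_ln. Qed.

End pointwise_derivation_rules.

Ltac pderive :=
  repeat first [ exact: pderive_cst | exact: pderive_id | eassumption
    | apply: pderiveD | apply: pderiveN | apply: pderiveM | apply: pderiveX
    | apply: pderive_expR ].

Section erlang_tail.
Context {R : realType}.
Implicit Types (s t : R) (m : nat).

(** [erlang m s] is the Poisson probability of [m] at mean [s], and also the Erlang density of shape
    [m + 1]; [erlang_tail m] is the survival function of that law. The function q of the overview is
    [erlang_tail (n - 1)]. *)
Definition erlang m s : R := s ^+ m / m`!%:R * expR (- s).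
Definition erlang_tail m s : R := \sum_(k < m.+1) erlang k s.

Lemma erlang_ge0 m s : 0 <= s -> 0 <= erlang m s.
Proof.
by move=> s0; rewrite /erlang mulr_ge0 ?expR_ge0// divr_ge0// exprn_ge0.
Qed.

Lemma is_derive_erlang0 s : is_derive s 1 (erlang 0) (- erlang 0 s).
Proof.
rewrite /erlang; apply: is_derive_eq; first by pderive.
by rewrite fact0; ring.
Qed.

Lemma is_derive_erlangS m s :
  is_derive s 1 (erlang m.+1) (erlang m s - erlang m.+1 s).
Proof.
rewrite /erlang; apply: is_derive_eq; first by pderive.
rewrite factS natrM exprS /=.
have ? : m`!%:R != 0 :> R by rewrite pnatr_eq0 -lt0n fact_gt0.
have ? : m.+1%:R != 0 :> R by rewrite pnatr_eq0.
by field; apply/andP.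
Qed.

(** The derivatives of consecutive Poisson weights telescope, and only the top weight survives. *)
Lemma is_derive_erlang_tail m s :
  is_derive s 1 (erlang_tail m) (- erlang m s).
Proof.
elim: m => [|m ih].
  have -> : erlang_tail 0 = erlang 0.
    by apply/funext => x; rewrite /erlang_tail big_ord1.
  exact: is_derive_erlang0.
have -> : erlang_tail m.+1 = erlang_tail m + erlang m.+1.
  by apply/funext => x; rewrite /erlang_tail [LHS]big_ord_recr.
have ? := is_derive_erlangS m s.
by apply: is_derive_eq; rewrite addrA addNr sub0r.
Qed.

Lemma erlang_tail0 m : erlang_tail m 0 = 1.
Proof.
rewrite /erlang_tail big_ord_recl big1 ?addr0.
  by rewrite /erlang expr0 fact0 divr1 mul1r oppr0 expR0.
by move=> i _; rewrite /erlang lift0 expr0n mul0r mul0r.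
Qed.

Lemma erlang_tail_gt0 m s : 0 <= s -> 0 < erlang_tail m s.
Proof.
move=> s0; rewrite /erlang_tail big_ord_recl ltr_pwDl//.
  by rewrite /erlang expr0 fact0 divr1 mul1r expR_gt0.
by apply: sumr_ge0 => i _; exact: erlang_ge0.
Qed.

Lemma erlang_tail_le1 m s : 0 <= s -> erlang_tail m s <= 1.
Proof.
move=> s0; rewrite -(erlang_tail0 m).
have d x : derivable (erlang_tail m) x 1 by have [] := is_derive_erlang_tail m x.
apply: (@ler0_derive1_le_cc _ _ 0 s) => //; rewrite ?in_itv/= ?lexx ?s0//.
  move=> x; rewrite in_itv/= => /andP[x0 _].
  have := is_derive_erlang_tail m x => /@derive_val; rewrite derive1E => ->.
  by rewrite oppr_le0 erlang_ge0// ltW.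
by apply: derivable_within_continuous.
Qed.

Lemma is_derive_erlang m s : s != 0 ->
  is_derive s 1 (erlang m) (erlang m s * ((m%:R - s) / s)).
Proof.
move=> s0; case: m => [|m].
  apply: is_derive_eq; first exact: is_derive_erlang0.
  by rewrite sub0r mulNr divff// mulrN1.
apply: is_derive_eq; first exact: is_derive_erlangS.
rewrite /erlang factS natrM exprS.
have ? : m`!%:R != 0 :> R by rewrite pnatr_eq0 -lt0n fact_gt0.
have ? : m.+1%:R != 0 :> R by rewrite pnatr_eq0.
by field; rewrite ?s0 -?natr1//= addrC natr1; apply/andP.
Qed.


Lemma derivable_erlang m s : derivable (erlang m) s 1.
Proof.
by case: m => [|m]; [have [] := is_derive_erlang0 s|have [] := is_derive_erlangS m s].
Qed.

(** Apply [ln y <= y - 1] at [y = (1 - u)^-1]; there [y - 1 = u + u ^+ 2 / (1 - u)], and [1 - u] is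
    at least one half. *)
Lemma ln1B_ge (u : R) : 0 <= u <= 2^-1 -> - u - 2 * u ^+ 2 <= ln (1 - u).
Proof.
move=> /andP[u0 u1].
have p : 0 < 1 - u by lra.
have : ln ((1 - u)^-1) <= (1 - u)^-1 - 1.
  have -> : (1 - u)^-1 = 1 + ((1 - u)^-1 - 1) by rewrite addrCA subrr addr0.
  rewrite [leRHS](_ : _ = (1 - u)^-1 - 1); last ring.
  by apply: le_ln1Dx; rewrite ltrBrDr addNr invr_gt0.
rewrite lnV// => h.
have : (1 - u)^-1 - 1 <= u + 2 * u ^+ 2; last lra.
by rewrite lerBlDr -[leLHS]mul1r ler_pdivrMr//; nra.
Qed.

(** The left side is the Padé approximant of the logarithm; the difference has the nonnegative
    derivative [y ^+ 2 / ((1 + y) * (2 + y) ^+ 2)]. At [x = 1 / N] it gives [2 / (2 * N + 1)],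
    exactly the precision that Stirling's bound with the factor [sqrt n] requires. *)
Lemma ln1D_ge (x : R) : 0 <= x -> 2 * x / (2 + x) <= ln (1 + x).
Proof.
move=> x0.
pose f (y : R) := ln (1 + y) - 2 * y * (2 + y)^-1.
pose f' (y : R) := (1 + y)^-1 - (2 / (2 + y) - 2 * y / (2 + y) ^+ 2).
have df (y : R) : 0 <= y -> is_derive y 1 f (f' y).
  move=> y0; have y1 : 0 < 1 + y by lra.
  have y2 : 2 + y != 0 by rewrite gt_eqF//; lra.
  have d1 : is_derive y 1 (fun z => 1 + z) (0 + 1) by pderive.
  have d2 : is_derive y 1 (fun z => 2 + z) (0 + 1) by pderive.
  have d3 := pderive_ln d1 y1; have d4 := pderiveV d2 y2.
  rewrite /f /f'; apply: is_derive_eq; rewrite /GRing.scale/=.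
  by field; rewrite !gt_eqF//; lra.
have : f 0 <= f x.
  apply: (@ger0_derive1_le_cc _ f 0 x) => //; rewrite ?in_itv/= ?lexx ?x0//.
  - by move=> y; rewrite in_itv/= => /andP[/ltW/df[]].
  - move=> y; rewrite in_itv/= => /andP[y0 _].
    have /@derive_val := df _ (ltW y0); rewrite derive1E => ->.
    rewrite /f'.
    have -> : (1 + y)^-1 - (2 / (2 + y) - 2 * y / (2 + y) ^+ 2) =
        y ^+ 2 / ((1 + y) * (2 + y) ^+ 2).
      by field; rewrite !gt_eqF//; lra.
    by rewrite divr_ge0 ?mulr_ge0 ?sqr_ge0//; lra.
  - by apply: derivable_within_continuous => y; rewrite in_itv/= => /andP[/df[]].
by rewrite /f addr0 ln1 mulr0 mul0r subrr subr_ge0.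
Qed.

(** By induction: after cancellation the step from [N] to [N + 1] reads e <= (1 + 1/N)^(N + 1/2).
    Squaring removes the half power, and taking logarithms leaves [ln1D_ge] at [1 / N]. *)
Lemma fact_le_stirling n : (0 < n)%N ->
  n`!%:R <= expR 1 * Num.sqrt n%:R * (n%:R ^+ n * expR (- n%:R)) :> R.
Proof.
elim: n => // -[_ _|n ih _]; last move/(_ isT) : ih => ih.
  by rewrite factS fact0 sqrtr1 mulr1 expr1n mul1r -expRD subrr expR0.
set N : R := n.+1%:R in ih *.
have N0 : 0 < N by rewrite ltr0n.
have NE : n.+2%:R = N + 1 :> R by rewrite natr1.
rewrite factS natrM NE.
apply: le_trans (ler_wpM2l _ ih) _; first lra.
have N1 : 0 < 1 + N^-1 by rewrite addr_gt0 ?invr_gt0.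
have key : expR 1 * Num.sqrt N * N ^+ n.+1 <= Num.sqrt (N + 1) * (N + 1) ^+ n.+1.
  have -> : N + 1 = N * (1 + N^-1) by rewrite mulrDr mulr1 divff ?gt_eqF.
  rewrite sqrtrM ?(ltW N0)// exprMn.
  rewrite [leLHS](_ : _ = Num.sqrt N * N ^+ n.+1 * expR 1); last ring.
  rewrite [leRHS](_ : _ = Num.sqrt N * N ^+ n.+1 *
    (Num.sqrt (1 + N^-1) * (1 + N^-1) ^+ n.+1)); last ring.
  have [N0' N1'] := (ltW N0, ltW N1).
  rewrite ler_wpM2l// ?mulr_ge0 ?sqrtr_ge0 ?exprn_ge0//.
  rewrite -ler_sqr ?nnegrE ?expR_ge0 ?mulr_ge0 ?sqrtr_ge0 ?exprn_ge0//.
  rewrite exprMn sqr_sqrtr// -exprM -exprS.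
  rewrite -ler_ln ?posrE ?exprn_gt0 ?expR_gt0// !lnXn ?expR_gt0//.
  rewrite expRK -[leRHS]mulr_natl.
  apply: le_trans (ler_wpM2l _ (@ln1D_ge N^-1 _)); rewrite ?invr_ge0//.
  have -> : (n.+1 * 2).+1%:R = 2 * N + 1 :> R.
    by rewrite -natr1 natrM mulrC.
  rewrite le_eqVlt; apply/orP; left; apply/eqP; field.
  by rewrite !gt_eqF//; lra.
have -> : - (N + 1) = - N + - 1 by lra.
rewrite expRD [(N + 1) ^+ n.+2]exprS.
have e1 : expR 1 * expR (- 1) = 1 :> R by rewrite -expRD subrr expR0.
rewrite [leLHS](_ : _ = (N + 1) * expR (- N) * (expR 1 * Num.sqrt N * N ^+ n.+1));
  last ring.
rewrite [leRHS](_ : _ = (N + 1) * expR (- N) *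
  (Num.sqrt (N + 1) * (N + 1) ^+ n.+1) * (expR 1 * expR (- 1))); last ring.
by rewrite e1 mulr1 ler_wpM2l// mulr_ge0 ?expR_ge0//; lra.
Qed.

Section edge.
Variables (m : nat) (N r s : R).
Hypothesis NE : N = m.+1%:R.
Hypothesis hr8 : 8 <= r.
Hypothesis hrr : r ^+ 2 = N.
Hypothesis hsN : N - 3 * r <= s <= N - 2 * r.

Let hmE : m%:R = N - 1. Proof. by rewrite NE -natr1 addrK. Qed.
Let hs0 : 0 < s.
Proof.
by have r8 := hr8; move: hsN => /andP[h _]; apply: lt_le_trans h; rewrite -hrr; nra.
Qed.

(* Stirling gives [N^m e^-N / m! >= 1 / (e r)], and moving from [N] down to [s] costs
   a factor [e^-18] at most, since [(N - s)^2 <= 9 N]. *)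
Lemma erlang_edge_ge : expR (- 19) <= r * erlang m s.
Proof.
have [r8 rr sN s0 mE] := And5 hr8 hrr hsN hs0 hmE.
have N0 : 0 < N by rewrite NE ltr0n.
have m0 : 0 < m`!%:R :> R by rewrite ltr0n fact_gt0.
have r0 : 0 < r by lra.
have := fact_le_stirling (ltn0Sn m); rewrite -NE -rr sqrtr_sqr (ger0_norm (ltW r0)) rr factS natrM -NE => st.
(* The exponent [m.+1] equals [N], so both sides are exponentials of N ln y - y, and only a lower
   bound on ln (s / N) is needed. The second-order error in [ln1B_ge] contributes 2 (N - s)^2 / N <=
   18. *)
have key : N ^+ m.+1 * expR (- N) * expR (- 18) <= s ^+ m.+1 * expR (- s).
  rewrite -{1}(lnK (x := N)) ?posrE// -{1}(lnK (x := s)) ?posrE//.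
  rewrite -[expR (ln N) ^+ _]expRM_natl -[expR (ln s) ^+ _]expRM_natl.
  rewrite -!expRD ler_expR -NE.
  have u0 : 0 <= (N - s) / N <= 2^-1.
    rewrite divr_ge0 ?(ltW N0)//=.
      by rewrite ler_pdivrMr//; move: sN rr => /andP[]; nra.
    by move: sN => /andP[]; lra.
  have := ln1B_ge u0.
  have -> : 1 - (N - s) / N = s / N by field; rewrite gt_eqF.
  rewrite ln_div ?posrE// => h.
  have : N * (- ((N - s) / N) - 2 * ((N - s) / N) ^+ 2) <= N * (ln s - ln N).
    by rewrite ler_wpM2l// ltW.
  have -> : N * (- ((N - s) / N) - 2 * ((N - s) / N) ^+ 2) =
    s - N - 2 * (N - s) ^+ 2 / N by field; rewrite gt_eqF.
  have : 2 * (N - s) ^+ 2 / N <= 18.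
    by rewrite ler_pdivrMr//; move: sN rr => /andP[]; nra.
  lra.
have -> : - 19 = - 18 - 1 :> R by lra.
rewrite /erlang expRD.
have sN' : s <= N by move: sN => /andP[]; lra.
have e1 : expR 1 * expR (- 1) = 1 :> R by rewrite -expRD subrr expR0.
rewrite -(ler_pM2r (x := m`!%:R))//.
rewrite [leRHS](_ : _ = r * (s ^+ m * expR (- s))); last by field; rewrite gt_eqF.
rewrite -(ler_pM2r (x := N))//.
(* The surplus factor [s <= N] in the power [m.+1] pays for the [N] in (m + 1)! = N m!. *)
apply: (@le_trans _ _ (r * (s ^+ m.+1 * expR (- s)))); last first.
  rewrite exprSr -!mulrA ler_pM2l// ler_pM2l ?exprn_gt0// [leRHS]mulrC.
  by rewrite ler_pM2r ?expR_gt0.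
apply: le_trans (ler_wpM2l (ltW r0) key).
have : (expR (- 18) * expR (-1)) * (N * m`!%:R) <=
   (expR (- 18) * expR (-1)) * (expR 1 * r * (N ^+ m.+1 * expR (- N))).
  by rewrite ler_wpM2l// mulr_ge0// expR_ge0.
rewrite [X in _ <= X -> _](_ : _ =
  r * (N ^+ m.+1 * expR (- N) * expR (- 18)) * (expR 1 * expR (-1))); last ring.
by rewrite e1 mulr1 => h; apply: le_trans h; rewrite -!mulrA [m`!%:R * N]mulrC.
Qed.

Let dq (x : R) : is_derive x 1 (erlang_tail m) (- erlang m x).
Proof. exact: is_derive_erlang_tail. Qed.

(* [K * erlang m + erlang_tail m] increases on [0, s], because the logarithmic
   derivative [(m - y) / y] of [erlang m] is at least [1 / K] there. *)
Lemma erlang_tail_edge_ge1 : 1 - erlang_tail m s <= r * erlang m s.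
Proof.
have [r8 rr sN s0 mE] := And5 hr8 hrr hsN hs0 hmE.
have K0 : 0 < 2 * r - 1 by lra.
(* Positivity of [m] makes [erlang m 0] vanish, so that [g] below starts from the value [1]. *)
have m_gt0 : (0 < m)%N by rewrite lt0n -(pnatr_eq0 R) mE gt_eqF//; nra.
(* On [[0, s]] one has [m - y >= 2 * r - 1] and [y <= N], whence this [K]; and [K <= r] because
   [N = r ^+ 2]. *)
pose K := N / (2 * r - 1).
pose g := fun x => K * erlang m x + erlang_tail m x.
have dg (x : R) : 0 < x ->
    is_derive x 1 g (K * (erlang m x * ((m%:R - x) / x)) - erlang m x).
  move=> x0; rewrite /g; apply: (pderiveD _ (dq x)).
  have dw := is_derive_erlang m (lt0r_neq0 x0).
  apply: (is_derive_eq (pderiveM (pderive_cst K x) dw)).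
  by rewrite mulr0 addr0.
have : g 0 <= g s.
  apply: (@ger0_derive1_le_cc _ g 0 s _ _ _ 0 s); last exact: ltW.
  - by move=> y; rewrite in_itv/= => /andP[/dg[]].
  - move=> y; rewrite in_itv/= => /andP[y0 ys].
    have /@derive_val := dg _ y0; rewrite derive1E => ->.
    rewrite [leRHS](_ : _ = erlang m y * (K * ((m%:R - y) / y) - 1)); last ring.
    rewrite mulr_ge0 ?erlang_ge0 ?(ltW y0)// subr_ge0 /K mE.
    rewrite mulrA ler_pdivlMr// mul1r mulrAC ler_pdivlMr//.
    by move: sN rr => /andP[]; nra.
  - apply: derivable_within_continuous => y _.
    by case: (pderiveD (pderiveM (pderive_cst K y)
      (derivableP (@derivable_erlang m y))) (dq y)).
  - by rewrite in_itv/= lexx ltW.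
  - by rewrite in_itv/= lexx ltW.
rewrite /g erlang_tail0 /erlang expr0n (gtn_eqF m_gt0) mul0r mul0r mulr0 add0r.
rewrite -/(erlang m s) => h.
have : K * erlang m s <= r * erlang m s; last lra.
rewrite ler_wpM2r ?erlang_ge0 ?(ltW s0)// /K ler_pdivrMr// -rr; nra.
Qed.

(** The weight [erlang m] increases up to its mode [m], so between [s] and [m] the tail drops by at
    least [(m - s) * erlang m s], where [m - s >= 2 * r - 1 >= r]; the tail at [m] is still
    positive. *)
Lemma erlang_tail_edge_ge : r * erlang m s <= erlang_tail m s.
Proof.
have [r8 rr sN s0 mE] := And5 hr8 hrr hsN hs0 hmE.
have sm : s <= m%:R by rewrite mE; move: sN => /andP[]; lra.
have incr (x : R) : s <= x <= m%:R -> erlang m s <= erlang m x.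
  move=> /andP[sx xm].
  have d (y : R) : s <= y -> is_derive y 1 (erlang m) (erlang m y * ((m%:R - y) / y)).
    by move=> sy; apply: is_derive_erlang; rewrite gt_eqF// (lt_le_trans s0).
  apply: (@ger0_derive1_le_cc _ (erlang m) s x) => //; rewrite ?in_itv/= ?lexx ?sx//.
  - by move=> y; rewrite in_itv/= => /andP[/ltW/d[]].
  - move=> y; rewrite in_itv/= => /andP[sy yx].
    have /@derive_val := d _ (ltW sy); rewrite derive1E => ->.
    have y0 := lt_trans s0 sy.
    by rewrite mulr_ge0 ?erlang_ge0 ?ltW// divr_gt0//; lra.
  - by apply: derivable_within_continuous => y; rewrite in_itv/= => /andP[/d[]].
have [||c] := @MVT_segment _ (erlang_tail m) (fun x => - erlang m x) s m%:R sm.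
- by move=> x _; exact: dq.
- by apply: derivable_within_continuous => y _; have [] := dq y.
rewrite in_itv/= => /incr h1 h2.
have h3 := erlang_tail_gt0 m (ltW (lt_le_trans s0 sm)).
have h4 := erlang_ge0 m (ltW s0).
move: sN mE => /andP[_ ? ?].
by move: h1 h2 h3 h4; nra.
Qed.

(** The right side is the defect E. Since [N - s >= 2 * r] and the tail is at most [1], the middle
    term is at least [2 * r * erlang m s]; half of it compensates [erlang_tail m s - 1], and the
    other half is bounded below by [erlang_edge_ge]. The square is dropped. *)
Lemma erlang_edge_defect : expR (- 19) <=
  erlang_tail m s - 1 + (N - s) * (erlang m s / erlang_tail m s) +
  s * (erlang m s / erlang_tail m s) ^+ 2.
Proof.
have [r8 rr sN s0 mE] := And5 hr8 hrr hsN hs0 hmE.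
have q0 := erlang_tail_gt0 m (ltW s0).
have q1 := erlang_tail_le1 m (ltW s0).
have h1 := erlang_tail_edge_ge1; have h2 := erlang_edge_ge.
have w0 := erlang_ge0 m (ltW s0).
have wq : erlang m s <= erlang m s / erlang_tail m s.
  by rewrite ler_pdivlMr// -[leRHS]mulr1 ler_wpM2l.
have : 0 <= s * (erlang m s / erlang_tail m s) ^+ 2.
  by rewrite mulr_ge0 ?sqr_ge0// ltW.
have : 2 * r * erlang m s <= (N - s) * (erlang m s / erlang_tail m s).
  by apply: ler_pM => //; [lra|move: sN => /andP[]; lra].
lra.
Qed.

End edge.
End erlang_tail.

(** * A smooth bump function *)

Section flat_functions.
Context {R : realType}.
Implicit Types (P : {poly R}) (x y : R).

(** A single Poisson weight is at most the sum [erlang_tail k y <= 1]. *)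
Lemma exprn_expRN_le k y : 0 <= y -> y ^+ k * expR (- y) <= k`!%:R.
Proof.
move=> y0; rewrite -[leRHS]mul1r -ler_pdivrMr ?ltr0n ?fact_gt0// mulrAC.
apply: le_trans (erlang_tail_le1 k y0).
by rewrite /erlang_tail big_ord_recr/= ler_wpDl// sumr_ge0// => i _; exact: erlang_ge0.
Qed.

Lemma horner_expRN_bounded P :
  exists C, forall y, 0 <= y -> `|P.[y] * expR (- y)| <= C.
Proof.
exists (\sum_(i < size P) `|P`_i| * i`!%:R) => y y0.
rewrite normrM (ger0_norm (expR_ge0 _)) horner_coef.
apply: le_trans (ler_wpM2r (expR_ge0 _) (ler_norm_sum _ _ _)) _.
rewrite mulr_suml; apply: ler_sum => i _.
rewrite normrM -mulrA ler_wpM2l// (ger0_norm (exprn_ge0 _ y0)).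
exact: exprn_expRN_le.
Qed.

(** The functions P(1/x) e^(-1/x), extended by 0 to x <= 0, form a family closed under
    differentiation: the derivative replaces P by X^2 (P - P'). One lemma on the family thus covers
    derivatives of every order, including those at the origin. *)
Definition flat P x : R := if 0 < x then P.[x^-1] * expR (- x^-1) else 0.

Definition flat_deriv P : {poly R} := 'X^2 * (P - P^`())%R.

Lemma flat_bounded P : exists C, forall x, `|flat P x| <= C.
Proof.
have [C HC] := horner_expRN_bounded P; exists C => x; rewrite /flat.
case: ifPn => [x0|_]; first by apply: HC; rewrite invr_ge0 ltW.
by rewrite normr0; apply: le_trans (HC _ (lexx 0)).
Qed.

(** Boundedness of y^2 P(y) e^-y, read at y = 1/x. The quadratic bound makes the difference quotient
    at the origin O(h), so the derivative there is 0. *)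
Lemma flat_le_sqr P : exists2 C, 0 <= C & forall x, `|flat P x| <= C * x ^+ 2.
Proof.
have [C HC] := horner_expRN_bounded (P * 'X^2).
have C0 : 0 <= C by apply: le_trans (HC _ (lexx 0)).
exists C => // x; rewrite /flat.
case: ifPn => [x0|_]; last by rewrite normr0 mulr_ge0 ?sqr_ge0.
have /HC : 0 <= x^-1 by rewrite invr_ge0 ltW.
rewrite hornerM hornerXn => h.
rewrite -ler_pdivrMr ?exprn_gt0//; apply: le_trans h.
rewrite mulrAC [leRHS]normrM (ger0_norm (sqr_ge0 x^-1)) exprVn.
by rewrite le_eqVlt eqxx.
Qed.

Lemma is_derive_horner P x : is_derive x 1 (horner P) P^`().[x].
Proof. by apply: DeriveDef; [exact: derivable_horner|rewrite -derive1E -derivE]. Qed.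

Lemma is_derive_flat P x : is_derive x 1 (flat P) (flat (flat_deriv P) x).
Proof.
have [x0|x0|->] := ltgtP x 0.
- rewrite {2}/flat ltNge (ltW x0)/=.
  apply: (@near_eq_is_derive _ _ _ (fun=> 0)).
  by near=> y; rewrite /flat ltNge ltW//=; near: y; exact: lt_nbhsl.
- rewrite {2}/flat x0.
  apply: (@near_eq_is_derive _ _ _ (fun y => P.[y^-1] * expR (- y^-1))).
    by near=> y; rewrite /flat ifT//; near: y; exact: lt_nbhsr.
  have xn0 : x != 0 by rewrite gt_eqF.
  have dV : is_derive x 1 (fun y => y^-1) (- x ^- 2 * 1).
    exact: (pderiveV (pderive_id x) xn0).
  have dP := pderive_comp dV (is_derive_horner P x^-1).
  apply: (is_derive_eq (pderiveM dP (pderive_expR (pderiveN dV)))).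
  rewrite /flat_deriv hornerM hornerXn hornerD hornerN; field.
  by rewrite xn0.
- have [C C0 HC] := flat_le_sqr P.
  rewrite {2}/flat ltxx.
  have f0 : flat P 0 = 0 by rewrite /flat ltxx.
  suff h : h^-1 *: (flat P (h *: 1 + 0) - flat P 0) @[h --> 0^'] --> (0 : R).
    by apply: DeriveDef; [apply/cvg_ex; exists 0|exact: cvg_lim].
  apply/cvgr0Pnorm_le => e e0; near=> h.
  have hn0 : h != 0 by near: h; exact: nbhs_dnbhs_neq.
  rewrite f0 subr0 addr0 /GRing.scale/= mulr1 normrM normfV.
  rewrite ler_pdivrMl ?normr_gt0//.
  apply: le_trans (HC h) _.
  rewrite -real_normK ?num_real// expr2 mulrA mulrC ler_wpM2l//.
  have : `|h| <= e / (C + 1) by near: h; apply: dnbhs0_le; rewrite divr_gt0//; lra.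
  rewrite ler_pdivlMr; last lra.
  by move=> h1; have := normr_ge0 h; nra.
Unshelve. all: by end_near. Qed.

Lemma is_derive_continuous (f df : R -> R) :
  (forall x, is_derive x 1 f (df x)) -> continuous f.
Proof.
move=> h x; apply: differentiable_continuous; apply/derivable1_diffP.
by case: (h x).
Qed.

Lemma is_derive_cvg (f : R -> R) df x :
  is_derive x 1 f df -> f y @[y --> x] --> f x.
Proof.
by move=> [h _]; apply: differentiable_continuous; apply/derivable1_diffP.
Qed.

(** Two independent polynomials, one for each endpoint of [[-1, 1]], keep all derivatives of
    [bump 1 1] in the linear span of this family. *)
Definition bump P Q x : R := flat P (1 + x) * flat Q (1 - x).

Lemma bump_eq0 P Q x : 1 <= `|x| -> bump P Q x = 0.
Proof.
rewrite /bump /flat ler_normr => /orP[] h.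
  by rewrite mulrC ltNge (_ : 1 - x <= 0) ?mul0r//; lra.
by rewrite ltNge (_ : 1 + x <= 0) ?mul0r//; lra.
Qed.

Lemma bump_bounded P Q : exists C, forall x, `|bump P Q x| <= C.
Proof.
have [C HC] := flat_bounded P; have [D HD] := flat_bounded Q.
by exists (C * D) => x; rewrite /bump normrM ler_pM.
Qed.

Lemma is_derive_bump P Q x :
  is_derive x 1 (bump P Q) (bump (flat_deriv P) Q x - bump P (flat_deriv Q) x).
Proof.
have d1 : is_derive x 1 (fun y : R => 1 + y) (0 + 1).
  exact: (pderiveD (pderive_cst 1 x) (pderive_id x)).
have d2 : is_derive x 1 (fun y : R => 1 - y) (0 - 1).
  exact: (pderiveD (pderive_cst 1 x) (pderiveN (pderive_id x))).
have d := pderiveM (pderive_comp d1 (is_derive_flat P (1 + x)))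
  (pderive_comp d2 (is_derive_flat Q (1 - x))).
by apply: (is_derive_eq d); rewrite /bump; ring.
Qed.

(** On ]-1, 1[ this is exp (-2 / (1 - x^2)). Its first two derivatives are given explicitly, so that
    their supports and bounds are inherited from [bump]. *)
Definition bump0 : R -> R := bump 1 1.
Definition bump1 x : R := bump (flat_deriv 1) 1 x - bump 1 (flat_deriv 1) x.
Definition bump2 x : R := bump (flat_deriv (flat_deriv 1)) 1 x -
  bump (flat_deriv 1) (flat_deriv 1) x *+ 2 + bump 1 (flat_deriv (flat_deriv 1)) x.

Lemma is_derive_bump0 x : is_derive x 1 bump0 (bump1 x).
Proof. exact: is_derive_bump. Qed.

Lemma is_derive_bump1 x : is_derive x 1 bump1 (bump2 x).
Proof.
apply: (is_derive_eq (pderiveD (is_derive_bump (flat_deriv 1) 1 x)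
  (pderiveN (is_derive_bump 1 (flat_deriv 1) x)))).
by rewrite /bump2 mulr2n; ring.
Qed.

Lemma bump0_eq0 x : 1 <= `|x| -> bump0 x = 0.
Proof. exact: bump_eq0. Qed.

Lemma bump1_eq0 x : 1 <= `|x| -> bump1 x = 0.
Proof. by move=> x1; rewrite /bump1 !bump_eq0// subrr. Qed.

Lemma bump2_eq0 x : 1 <= `|x| -> bump2 x = 0.
Proof. by move=> x1; rewrite /bump2 !bump_eq0// mul0rn subrr addr0. Qed.

Lemma continuous_bump0 : continuous bump0.
Proof. exact: is_derive_continuous is_derive_bump0. Qed.

Lemma continuous_bump2 : continuous bump2.
Proof.
apply: is_derive_continuous => x; rewrite /bump2; under eq_fun do rewrite mulr2n.
exact: (pderiveD (pderiveD (is_derive_bump _ _ x) (pderiveN (pderiveD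
  (is_derive_bump _ _ x) (is_derive_bump _ _ x)))) (is_derive_bump _ _ x)).
Qed.

Lemma bump2_bounded : exists C, forall x, `|bump2 x| <= C.
Proof.
have [C HC] := bump_bounded (flat_deriv (flat_deriv 1)) 1.
have [D HD] := bump_bounded (flat_deriv 1) (flat_deriv 1).
have [E HE] := bump_bounded 1 (flat_deriv (flat_deriv 1)).
exists (C + D *+ 2 + E) => x; rewrite /bump2.
apply: le_trans (ler_normD _ _) (lerD _ (HE x)).
by apply: le_trans (ler_normB _ _) (lerD (HC x) _); rewrite normrMn lerMn2r HD orbT.
Qed.

Lemma bump0_ge0 x : 0 <= bump0 x.
Proof.
by rewrite /bump0 /bump /flat !hornerC !mul1r mulr_ge0//; case: ifP => // _;
  exact: expR_ge0.
Qed.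

Lemma bump0_le1 x : bump0 x <= 1.
Proof.
have f1 y : 0 <= flat 1 y <= 1.
  rewrite /flat hornerC mul1r; case: ifPn => y0; last by rewrite lexx ler01.
  by rewrite expR_ge0/= -expR0 ler_expR oppr_le0 invr_ge0 ltW.
by rewrite /bump0 /bump mulr_ile1//; have /andP[] := f1 (1 + x);
  have /andP[] := f1 (1 - x).
Qed.

Lemma bump0_half x : `|x| <= 2^-1 -> expR (- 4) <= bump0 x.
Proof.
rewrite ler_norml => /andP[x1 x2].
rewrite /bump0 /bump /flat !hornerC !mul1r.
have a1 : 0 < 1 + x by lra.
have a2 : 0 < 1 - x by lra.
rewrite a1 a2 -expRD ler_expR.
have b1 : (1 + x)^-1 <= 2 by rewrite -[leLHS]mul1r ler_pdivrMr//; lra.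
have b2 : (1 - x)^-1 <= 2 by rewrite -[leLHS]mul1r ler_pdivrMr//; lra.
lra.
Qed.

End flat_functions.

(** * Integration over the line and the plane *)

Section one_dimensional_integrals.
Context {R : realType}.
Local Notation mu := (@lebesgue_measure R).
Implicit Types (a b c x y : R).

Lemma integral_affine (g : R -> R) x0 c : 0 < c -> continuous g ->
    (forall x, 0 <= g x) ->
  (\int[mu]_x (g x)%:E = \int[mu]_x (c * g (x0 + c * x))%:E)%E.
Proof.
move=> c0 cg g0.
pose F x := x0 + c * x.
have dF x : is_derive x 1 F c.
  apply: (is_derive_eq (pderiveD (pderive_cst x0 x)
    (pderiveM (pderive_cst c x) (pderive_id x)))).
  by rewrite mulr0 addr0 mulr1 add0r.
have F' : F^`()%classic = cst c.
  by apply/funext => x; rewrite derive1E; exact: derive_val.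
rewrite (@increasing_ge0_integration_by_substitutionT R F g)//.
- apply: eq_integral => x _; rewrite F'/=.
  by rewrite [in RHS]mulrC.
- by move=> x y xy; rewrite /F ltrD2l ltr_pM2l.
- by rewrite F'; exact: cst_continuous.
- by rewrite F'; exact: is_cvg_cst.
- by rewrite F'; exact: is_cvg_cst.
- apply/cvgrNyPle => A.
  have := @nbhs_ninfty_le R ((A - x0) / c) (num_real _); apply: filterS => x.
  by rewrite ler_pdivlMr// mulrC lerBrDl.
- apply/cvgryPge => A.
  have := @nbhs_pinfty_ge R ((A - x0) / c) (num_real _); apply: filterS => x.
  by rewrite ler_pdivrMr// mulrC lerBlDl.
Qed.

Lemma integral_even_FTC (f F : R -> R) (l : R) : (forall x, 0 <= f x) ->
    continuous f -> (forall x, f (- x) = f x) ->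
    (forall x, is_derive x 1 F (f x)) -> F 0 = 0 ->
    F x @[x --> +oo%R] --> l ->
  (\int[mu]_x (f x)%:E = (2 * l)%:E)%E.
Proof.
move=> f0 cf fN dF F0 Fl.
rewrite ge0_symfun_integralT//; last by move=> x /=; rewrite fN.
rewrite -set_itvcy (@ge0_continuous_FTC2y R f F 0 l)//.
- by rewrite F0 sube0 EFinM.
- exact: continuous_subspaceT.
- apply: cvg_at_right_filter; exact: (is_derive_continuous dF).
- by move=> x _; rewrite derive1E; exact: derive_val.
Qed.

Let is_derive_atan x : is_derive x 1 (@atan R) (1 + x ^+ 2)^-1.
Proof.
by apply: DeriveDef; [exact: derivable_atan|rewrite -derive1E derive1_atan].
Qed.

Let p1 x : 0 < 1 + x ^+ 2. Proof. by rewrite ltr_pwDl ?sqr_ge0. Qed.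

Lemma is_derive_1Dsqr x : is_derive x 1 (fun x => 1 + x ^+ 2) (2 * x).
Proof.
apply: (is_derive_eq (pderiveD (pderive_cst 1 x) (pderiveX 2 (pderive_id x)))).
by rewrite add0r mulr1 expr1.
Qed.

(** This integral and the next are the inner and the outer one in the Cartesian computation of the
    mass of the kernel e / (|z - w|^2 + e)^2. *)
Lemma integral_inv_1Dsqr_sqr :
  (\int[mu]_x ((1 + x ^+ 2) ^- 2)%:E = (pi / 2)%:E)%E.
Proof.
have n1 x : 1 + x ^+ 2 != 0 by rewrite gt_eqF.
pose F x : R := 2^-1 * (x * (1 + x ^+ 2)^-1 + atan x).
have f0 x : 0 <= (1 + x ^+ 2) ^- 2 by rewrite invr_ge0 exprn_ge0// ltW.
have cf : continuous (fun x => (1 + x ^+ 2) ^- 2).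
  exact: is_derive_continuous (fun x => pderiveV
    (pderiveX 2 (is_derive_1Dsqr x)) (expf_neq0 2 (n1 x))).
have fN x : (1 + (- x) ^+ 2) ^- 2 = (1 + x ^+ 2) ^- 2 by rewrite sqrrN.
have dF x : is_derive x 1 F ((1 + x ^+ 2) ^- 2).
  have d := pderiveM (pderive_cst 2^-1 x) (pderiveD
     (pderiveM (pderive_id x) (pderiveV (is_derive_1Dsqr x) (n1 x))) (is_derive_atan x)).
  by apply: (is_derive_eq d); field; exact: n1.
have F0 : F 0 = 0 by rewrite /F mul0r atan0 addr0 mulr0.
have Fl : F x @[x --> +oo%R] --> 2^-1 * (0 + pi / 2).
  apply: cvgMr; apply: cvgD; last exact: cvgy_atan.
  apply/cvgr0Pnorm_le => e e0; near=> x.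
  have x0 : 0 < x by near: x; exact: nbhs_pinfty_gt.
  rewrite ger0_norm; last by rewrite divr_ge0// ltW.
  have : e^-1 <= x by near: x; apply: nbhs_pinfty_ge; rewrite num_real.
  rewrite ler_pdivrMr// -(ler_pM2l e0) divff ?gt_eqF// => h.
  by have := sqr_ge0 x; nra.
by rewrite (integral_even_FTC f0 cf fN dF F0 Fl) add0r mulrA divff// mul1r.
Unshelve. all: by end_near. Qed.

(** Writing the inverse square root as [cos (atan x)] exhibits [sin (atan x)] as an antiderivative,
    with limit [1] at infinity. *)
Lemma integral_inv_sqrt_cubed :
  (\int[mu]_x ((Num.sqrt (1 + x ^+ 2))^-1 * (1 + x ^+ 2)^-1)%:E = 2%:E)%E.
Proof.
under eq_integral do rewrite -cos_atan.
have f0 x : 0 <= cos (atan x) * (1 + x ^+ 2)^-1.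
  by rewrite cos_atan mulr_ge0// invr_ge0 ?sqrtr_ge0// ltW.
have cf : continuous (fun x : R => cos (atan x) * (1 + x ^+ 2)^-1).
  exact: is_derive_continuous (fun x => pderiveM
    (pderive_comp (is_derive_atan x) (is_derive_cos (atan x)))
    (pderiveV (is_derive_1Dsqr x) (lt0r_neq0 (p1 x)))).
have fN x : cos (atan (- x)) * (1 + (- x) ^+ 2)^-1 = cos (atan x) * (1 + x ^+ 2)^-1.
  by rewrite atanN cosN sqrrN.
have dF x : is_derive x 1 (fun x => sin (atan x)) (cos (atan x) * (1 + x ^+ 2)^-1).
  rewrite mulrC; exact: (pderive_comp (is_derive_atan x) (is_derive_sin (atan x))).
have F0 : sin (atan 0) = 0 :> R by rewrite atan0 sin0.
have Fl : sin (atan x) @[x --> +oo%R] --> (1 : R).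
  rewrite -(sin_pihalf R); apply: (cvg_comp _ _ (@cvgy_atan R)); exact: continuous_sin.
by rewrite (integral_even_FTC f0 cf fN dF F0 Fl) mulr1.
Qed.

Lemma measurable_invr : measurable_fun [set: R] (fun x : R => x^-1).
Proof.
(* The sign factor is [0] at the origin, in agreement with [0^-1 = 0]; elsewhere [expR (- ln |x|)]
   is the inverse of the modulus. *)
have -> : (fun x : R => x^-1) = fun x => (if 0 < x then 1 else if x < 0 then -1 else 0)
    * expR (- ln `|x|).
  apply/funext => x; have [x0|x0|<-] := ltgtP 0 x.
  - by rewrite ger0_norm ?ltW// mul1r expRN lnK.
  - by rewrite ltr0_norm// expRN lnK ?posrE ?oppr_gt0// mulN1r invrN opprK.
  - by rewrite invr0 mul0r.
apply: measurable_funM.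
  apply: measurable_fun_ifT => //=; first exact: measurable_fun_ltr.
  by apply: measurable_fun_ifT => //=; exact: measurable_fun_ltr.
apply: measurableT_comp => //; apply: measurableT_comp => //.
by apply: (measurableT_comp (@measurable_ln R)); exact: (@normr_measurable R setT).
Qed.

(** An integrable majorant of a logarithmic singularity in one real variable. Majorants that depend
    on one coordinate at a time are integrated over the plane as products. *)
Definition inv_sqrt_pos x : R := if 0 < x <= 1 then expR (- (ln x / 2)) else 0.

Lemma inv_sqrt_pos_ge0 x : 0 <= inv_sqrt_pos x.
Proof. by rewrite /inv_sqrt_pos; case: ifP; rewrite // expR_ge0. Qed.

Lemma measurable_inv_sqrt_pos : measurable_fun setT inv_sqrt_pos.
Proof.
apply: measurable_fun_ifT => //=.
  by apply: measurable_and; [exact: measurable_fun_ltr|exact: measurable_fun_ler].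
by apply: measurableT_comp => //; apply: measurableT_comp => //; exact: measurable_funM.
Qed.

Let is_derive_two_sqrt x : 0 < x ->
  is_derive x 1 (fun y => 2 * expR (ln y / 2)) (expR (- (ln x / 2))).
Proof.
move=> x0.
have d := pderiveM (pderive_cst 2 x) (pderive_expR
  (pderiveM (pderive_ln (pderive_id x) x0) (pderive_cst 2^-1 x))).
apply: (is_derive_eq d); rewrite !mulr0 addr0 add0r mul1r.
have -> : - (ln x / 2) = ln x / 2 - ln x by rewrite {3}(splitr (ln x)) opprD addrA subrr sub0r.
by rewrite expRD expRN lnK//; field; rewrite gt_eqF.
Qed.

Lemma integrable_inv_sqrt_pos : mu.-integrable setT (EFin \o inv_sqrt_pos).
Proof.
apply/integrableP; split; first by apply/measurable_EFinP; apply: measurable_inv_sqrt_pos.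
under eq_integral do rewrite gee0_abs ?lee_fin ?inv_sqrt_pos_ge0//.
(* The antiderivative [2 * expR (ln x / 2)] is discontinuous at [0], where [ln 0 = 0]; the
   fundamental theorem is therefore applied on segments away from [0]. *)
pose I k := `[(k.+1%:R^-1 : R), 1]%classic.
have UI : \bigcup_k I k = `]0, 1]%classic.
  apply/seteqP; split=> x /=.
    move=> [k _]; rewrite /I/= !in_itv/= => /andP[kx ->]; rewrite andbT.
    by apply: lt_le_trans kx; rewrite invr_gt0.
  rewrite in_itv/= => /andP[x0 x1]; exists (Num.truncn x^-1) => //=.
  rewrite /I/= in_itv/= x1 andbT -[leRHS]invrK lef_pV2 ?posrE ?invr_gt0//.
  by rewrite ltW// truncnS_gt.
have -> : (\int[mu]_x (inv_sqrt_pos x)%:E =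
    \int[mu]_(x in \bigcup_k I k) (inv_sqrt_pos x)%:E)%E.
  rewrite [RHS]integral_mkcond UI; apply: eq_integral => x _.
  rewrite patchE mem_setE in_itv/= /inv_sqrt_pos; by case: ifP.
have h : (\int[mu]_(x in I k) (inv_sqrt_pos x)%:E @[k --> \oo] -->
    \int[mu]_(x in \bigcup_k I k) (inv_sqrt_pos x)%:E)%E.
  apply: ge0_nondecreasing_set_cvg_integral => //.
  - move=> m n mn; apply/subsetPset => x; rewrite /I/= !in_itv/= => /andP[mx ->].
    rewrite andbT; apply: le_trans mx; rewrite lef_pV2 ?posrE ?ltr0n//.
    by rewrite ler_nat.
  - by move=> n; exact: measurable_itv.
  - move=> n; apply: measurable_funTS; apply/measurable_EFinP.
    exact: measurable_inv_sqrt_pos.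
  - by move=> n x _; rewrite lee_fin inv_sqrt_pos_ge0.
suff : (\int[mu]_(x in \bigcup_k I k) (inv_sqrt_pos x)%:E <= 2%:E)%E.
  by move/le_lt_trans; apply; exact: ltry.
rewrite -(cvg_lim _ h)//; apply: lime_le; first by apply/cvg_ex; eexists; exact: h.
near=> k.
have k1 : k.+1%:R^-1 < 1 :> R.
  rewrite invf_lt1 ?ltr0n// ltr1n ltnS; near: k; exact: nbhs_infty_gt.
have kp : 0 < k.+1%:R^-1 :> R by rewrite invr_gt0.
have dd x : k.+1%:R^-1 <= x ->
    is_derive x 1 (fun y => 2 * expR (ln y / 2)) (expR (- (ln x / 2))).
  by move=> kx; apply: is_derive_two_sqrt; exact: lt_le_trans kx.
have -> : (\int[mu]_(x in I k) (inv_sqrt_pos x)%:E =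
    \int[mu]_(x in I k) (expR (- (ln x / 2)))%:E)%E.
  apply: eq_integral => x; rewrite inE /I/= in_itv/= /inv_sqrt_pos => /andP[x0 ->].
  by rewrite (lt_le_trans kp x0).
rewrite (@continuous_FTC2 R (fun x => expR (- (ln x / 2))) (fun y => 2 * expR (ln y / 2)))//.
- rewrite ln1 mul0r expR0 mulr1 -EFinB lee_fin lerBlDr lerDl.
  by rewrite mulr_ge0// expR_ge0.
- apply: derivable_within_continuous => x; rewrite in_itv/= => /andP[kx _].
  have x0 := lt_le_trans kp kx.
  by case: (pderive_expR (pderiveN (pderiveM (pderive_ln (pderive_id x) x0)
    (pderive_cst 2^-1 x)))).
- split.
  + by move=> x; rewrite in_itv/= => /andP[/ltW/dd[]].
  + apply: cvg_at_right_filter; exact: is_derive_cvg (dd _ (lexx _)).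
  + apply: cvg_at_left_filter; exact: is_derive_cvg (dd _ (ltW k1)).
- move=> x; rewrite in_itv/= => /andP[/ltW/dd ? _]; rewrite derive1E.
  exact: derive_val.
Unshelve. all: by end_near. Qed.

Lemma lebesgue_measure_shift c (A : set R) : measurable A ->
  pushforward mu (fun x : measurableTypeR R => x - c : measurableTypeR R) A = mu A.
Proof.
move=> mA; apply/esym/lebesgue_measure_unique => //=.
  by apply: measurable_funB.
move=> ms _ [[a b]] _ <-; rewrite /pushforward.
have -> : (fun x => x - c) @^-1` `]a, b]%classic = `]a + c, b + c]%classic.
  by apply/seteqP; split=> x /=; rewrite !in_itv/= ltrBrDr lerBlDr.
rewrite !lebesgue_measure_itv/= !lte_fin ltrD2r.
by case: ifP => // _; congr EFin; ring.
Qed.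

Lemma ge0_integral_shift (f : R -> \bar R) c : measurable_fun [set: R] f ->
  (forall x, 0 <= f x)%E -> (\int[mu]_x f (x - c)%R = \int[mu]_x f x)%E.
Proof.
move=> mf f0.
have ms : measurable_fun [set: measurableTypeR R]
    (fun x : measurableTypeR R => x - c : measurableTypeR R).
  by apply: measurable_funB.
rewrite -(@ge0_integral_pushforward _ _ _ _ _ _ ms mu setT f)//=.
by apply: eq_measure_integral => //= A mA _; exact: lebesgue_measure_shift.
Qed.

Lemma ge0_integral_opp (f : R -> \bar R) : measurable_fun [set: R] f ->
  (forall x, 0 <= f x)%E -> (\int[mu]_x f (- x)%R = \int[mu]_x f x)%E.
Proof.
move=> mf f0.
have ms : measurable_fun [set: measurableTypeR R]
    (fun x : measurableTypeR R => - x : measurableTypeR R).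
  exact: oppr_measurable.
rewrite -(@ge0_integral_pushforward _ _ _ _ _ _ ms mu setT f)//=.
by apply: eq_measure_integral => //= A mA _; exact: lebesgue_measureN.
Qed.

Definition inv_sqrt_abs x : R := inv_sqrt_pos x + inv_sqrt_pos (- x).

Lemma measurable_inv_sqrt_abs : measurable_fun setT inv_sqrt_abs.
Proof.
apply: measurable_funD; first exact: measurable_inv_sqrt_pos.
by apply: measurableT_comp; [exact: measurable_inv_sqrt_pos|exact: oppr_measurable].
Qed.

Lemma inv_sqrt_abs_ge0 x : 0 <= inv_sqrt_abs x.
Proof. by rewrite addr_ge0 ?inv_sqrt_pos_ge0. Qed.

Lemma integrable_inv_sqrt_abs c :
  mu.-integrable setT (EFin \o (fun x => inv_sqrt_abs (x - c))).
Proof.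
apply/integrableP; split.
  apply/measurable_EFinP; apply: measurableT_comp; first exact: measurable_inv_sqrt_abs.
  by apply: measurable_funB.
under eq_integral do rewrite gee0_abs ?lee_fin ?inv_sqrt_abs_ge0//.
rewrite (ge0_integral_shift (f := EFin \o inv_sqrt_abs)); last 2 first.
- by apply/measurable_EFinP; exact: measurable_inv_sqrt_abs.
- by move=> x; rewrite lee_fin inv_sqrt_abs_ge0.
rewrite (_ : (fun x => _) = (fun x => (inv_sqrt_pos x)%:E + (inv_sqrt_pos (- x))%:E)%E)//.
have m1 : measurable_fun [set: R] (EFin \o inv_sqrt_pos).
  by apply/measurable_EFinP; exact: measurable_inv_sqrt_pos.
have m2 : measurable_fun [set: R] (EFin \o (fun x => inv_sqrt_pos (- x))).
  by apply: (measurableT_comp m1); exact: oppr_measurable.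
have p x : (0 <= (inv_sqrt_pos x)%:E)%E by rewrite lee_fin inv_sqrt_pos_ge0.
rewrite (@ge0_integralD _ _ _ mu setT measurableT _ (EFin \o (fun x => inv_sqrt_pos (- x)))
  (fun x _ => p x) m1 (fun x _ => p (- x)) m2)/=.
rewrite (ge0_integral_opp (f := EFin \o inv_sqrt_pos) m1 p).
have /integrableP[_] := integrable_inv_sqrt_pos.
under eq_integral do rewrite gee0_abs ?lee_fin ?inv_sqrt_pos_ge0//.
by move=> h; rewrite lte_add_pinfty.
Qed.

(** The inequality 1 + t <= e^t at t = - (ln |x|) / 2, multiplied by 4. *)
Lemma neg_ln_sqr_le x : x != 0 -> `|x| <= 1 -> - ln (x ^+ 2) <= 4 * inv_sqrt_abs x.
Proof.
have key y : 0 < y <= 1 -> - ln (y ^+ 2) <= 4 * inv_sqrt_pos y.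
  move=> /andP[y0 y1]; rewrite /inv_sqrt_pos y0 y1/= lnXn//.
  have := expR_ge1Dx (- (ln y / 2)).
  lra.
move=> x0 x1; have [xp|xn|x0'] := ltgtP 0 x.
- rewrite gtr0_norm// in x1; apply: le_trans (key _ _) _; first by rewrite xp.
  by rewrite ler_wpM2l// lerDl inv_sqrt_pos_ge0.
- rewrite ltr0_norm// in x1.
  rewrite -sqrrN; apply: le_trans (key _ _) _; first by rewrite oppr_gt0 xn.
  by rewrite ler_wpM2l// lerDr inv_sqrt_pos_ge0.
- by rewrite -x0' eqxx in x0.
Qed.

End one_dimensional_integrals.

(** * The area measure: iterated integrals and the regularised point mass *)

Section area_measure_theory.
Context {R : realType}.
Local Notation mu := (@lebesgue_measure R).
Local Notation mu2 := ((@lebesgue_measure R) \x (@lebesgue_measure R))%E.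
Implicit Types (f g : plane R -> R) (z w : plane R).

Lemma ge0_integral_dA (D : set (plane R)) (f : plane R -> \bar R) : measurable D ->
    measurable_fun D f -> (forall z, D z -> 0 <= f z)%E ->
  (\int[dA]_(z in D) f z = (pi^-1)%:E * \int[mu2]_(z in D) f z)%E.
Proof.
move=> mD mf f0; rewrite /dA ge0_integral_mscale//=.
by rewrite mul1r.
Qed.

Lemma ge0_integral_dA12 (f : plane R -> \bar R) :
    measurable_fun setT f -> (forall z, 0 <= f z)%E ->
  (\int[dA]_z f z = (pi^-1)%:E * \int[mu]_x \int[mu]_y f (x, y))%E.
Proof.
by move=> mf f0; rewrite ge0_integral_dA// fubini_tonelli1.
Qed.

Lemma ge0_integral_dA21 (f : plane R -> \bar R) :
    measurable_fun setT f -> (forall z, 0 <= f z)%E ->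
  (\int[dA]_z f z = (pi^-1)%:E * \int[mu]_y \int[mu]_x f (x, y))%E.
Proof.
move=> mf f0; rewrite (ge0_integral_dA12 mf f0); congr (_ * _)%E.
exact: (@fubini_tonelli _ _ _ _ _ mu mu f mf f0).
Qed.

Let pi_inv_gt0 : 0 < pi^-1 :> R. Proof. by rewrite invr_gt0 pi_gt0. Qed.

Lemma integrable_dA (D : set (plane R)) (f : plane R -> \bar R) : measurable D ->
  dA.-integrable D f <-> mu2.-integrable D f.
Proof.
move=> mD; split=> /integrableP[mf fi]; apply/integrableP; split=> //.
  rewrite ge0_integral_dA// in fi; last exact: measurableT_comp.
  rewrite ltey; apply/eqP => h; rewrite h gt0_muley ?lte_fin// in fi.
rewrite ge0_integral_dA//; last exact: measurableT_comp.
by rewrite lte_mul_pinfty// lee_fin ltW.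
Qed.

Lemma integral_dA (D : set (plane R)) (f : plane R -> \bar R) : measurable D ->
  dA.-integrable D f ->
  (\int[dA]_(z in D) f z = (pi^-1)%:E * \int[mu2]_(z in D) f z)%E.
Proof.
move=> mD fi; have [mf _] := integrableP _ _ _ fi.
have fi2 := (integrable_dA f mD).1 fi.
rewrite [LHS]integralE [in RHS]integralE muleBr//; last first.
  exact: integrable_add_def fi2.
by rewrite !ge0_integral_dA//; [exact: measurable_funeneg|exact: measurable_funepos].
Qed.

Lemma Rintegral_dA12 f : dA.-integrable setT (EFin \o f) ->
    (forall x, mu.-integrable setT (fun y => (f (x, y))%:E)) ->
  \int[dA]_z f z = pi^-1 * \int[mu]_x \int[mu]_y f (x, y).
Proof.
move=> fi fx; have fi2 := (integrable_dA _ measurableT).1 fi.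
rewrite /Rintegral integral_dA// fineM//; last exact: integrable_fin_num fi2.
congr (_ * fine _); rewrite -integral12_prod_meas1//.
by apply: eq_integral => x _; rewrite fineK//; exact: integrable_fin_num (fx x).
Qed.

Lemma Rintegral_dA21 f : dA.-integrable setT (EFin \o f) ->
    (forall y, mu.-integrable setT (fun x => (f (x, y))%:E)) ->
  \int[dA]_z f z = pi^-1 * \int[mu]_y \int[mu]_x f (x, y).
Proof.
move=> fi fx; have fi2 := (integrable_dA _ measurableT).1 fi.
rewrite /Rintegral integral_dA// fineM//; last exact: integrable_fin_num fi2.
congr (_ * fine _); rewrite -integral21_prod_meas1//.
by apply: eq_integral => x _; rewrite fineK//; exact: integrable_fin_num (fx x).
Qed.

Definition sqdist z w : R := (z.1 - w.1) ^+ 2 + (z.2 - w.2) ^+ 2.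

Lemma sqdist_ge0 z w : 0 <= sqdist z w.
Proof. by rewrite addr_ge0 ?sqr_ge0. Qed.

Lemma sqdistC z w : sqdist z w = sqdist w z.
Proof. by rewrite /sqdist -sqrrN opprB -[(z.2 - w.2) ^+ 2]sqrrN opprB. Qed.

Lemma measurable_sqdist w : measurable_fun setT (fun z => sqdist z w).
Proof.
by apply: measurable_funD; apply: measurable_funX; apply: measurable_funB.
Qed.

(** The kernel is d dbar of ln (|z - w|^2 + e), which tends to a point mass as e tends to 0. Scaling
    x by sqrt ((y - w.2)^2 + e) evaluates the inner integral and leaves the inverse cube of that
    root, whose integral is found by scaling y by sqrt e. *)
Lemma integral_poisson_kernel w e : 0 < e ->
  (\int[dA]_z (e / (sqdist z w + e) ^+ 2)%:E = 1)%E.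
Proof.
move=> e0.
have pos z : 0 < sqdist z w + e by rewrite ltr_wpDl ?sqdist_ge0.
rewrite ge0_integral_dA21; last 2 first.
- apply/measurable_EFinP; apply: measurable_funM => //.
  apply: (measurableT_comp measurable_invr); apply: measurable_funX.
  by apply: measurable_funD => //; exact: measurable_sqdist.
- by move=> z; rewrite lee_fin divr_ge0// ?exprn_ge0// ltW.
pose C (y : R) := Num.sqrt ((y - w.2) ^+ 2 + e).
have C2 y : C y ^+ 2 = (y - w.2) ^+ 2 + e by rewrite sqr_sqrtr// addr_ge0 ?sqr_ge0 ?ltW.
have C0 y : 0 < C y by rewrite sqrtr_gt0 ltr_wpDl ?sqr_ge0.
have inner y : (\int[mu]_x (e / (sqdist (x, y) w + e) ^+ 2)%:E =
    (e * (pi / 2) * (C y) ^- 3)%:E)%E.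
  have cn0 : C y != 0 by rewrite gt_eqF.
  rewrite (@integral_affine R (fun x => e / (sqdist (x, y) w + e) ^+ 2) w.1 (C y))//.
  - transitivity (\int[mu]_x ((e * (C y) ^- 3)%:E * ((1 + x ^+ 2) ^- 2)%:E))%E.
      apply: eq_integral => x _; rewrite -EFinM; congr EFin.
      rewrite /sqdist/= -addrA -C2 addrAC subrr add0r exprMn.
      have ? : 1 + x ^+ 2 != 0 by rewrite gt_eqF// ltr_pwDl ?sqr_ge0.
      field; apply/and3P; split=> //.
      by rewrite gt_eqF// ltr_wpDl ?sqr_ge0 ?exprn_gt0.
    rewrite ge0_integralZl//=; last 3 first.
    + apply/measurable_EFinP; apply: (measurableT_comp measurable_invr).
      by apply: measurable_funX; apply: measurable_funD => //; exact: measurable_funX.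
    + by move=> x _; rewrite lee_fin invr_ge0 sqr_ge0.
    + by rewrite lee_fin mulr_ge0 ?invr_ge0 ?exprn_ge0// ltW.
    by rewrite integral_inv_1Dsqr_sqr -EFinM; congr EFin; ring.
  - have p x : (sqdist (x, y) w + e) ^+ 2 != 0.
      by rewrite expf_neq0// gt_eqF.
    exact: (is_derive_continuous (fun x => pderiveM (pderive_cst e x)
      (pderiveV (pderiveX 2 (pderiveD (pderiveD (pderiveX 2
        (pderiveD (pderive_id x) (pderive_cst (- w.1) x)))
      (pderive_cst ((y - w.2) ^+ 2) x)) (pderive_cst e x))) (p x)))).
  - by move=> x; rewrite divr_ge0// ?exprn_ge0// ltW.
under eq_integral do rewrite inner.
have se0 : 0 < Num.sqrt e by rewrite sqrtr_gt0.
have se2 : Num.sqrt e ^+ 2 = e by rewrite sqr_sqrtr// ltW.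
rewrite (@integral_affine R (fun y => e * (pi / 2) * (C y) ^- 3) w.2 (Num.sqrt e))//.
- transitivity (pi^-1%:E * \int[mu]_y ((pi / 2)%:E *
     ((Num.sqrt (1 + y ^+ 2))^-1 * (1 + y ^+ 2)^-1)%:E))%E.
    congr (_ * _)%E; apply: eq_integral => y _; rewrite -EFinM; congr EFin.
    have -> : C (w.2 + Num.sqrt e * y) = Num.sqrt e * Num.sqrt (1 + y ^+ 2).
      rewrite -sqrtrM ?ltW//; congr Num.sqrt.
      by rewrite addrAC subrr add0r exprMn se2; ring.
    have h2 : Num.sqrt (1 + y ^+ 2) ^+ 2 = 1 + y ^+ 2.
      by rewrite sqr_sqrtr// addr_ge0 ?sqr_ge0.
    have h0 : Num.sqrt (1 + y ^+ 2) != 0.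
      by rewrite gt_eqF// sqrtr_gt0 ltr_pwDl ?sqr_ge0.
    move: h2 h0 se2 se0; set q := Num.sqrt (1 + _); set p := Num.sqrt e => h2 h0 se2 se0.
    rewrite -h2 -se2; field.
    by rewrite h0 gt_eqF.
  rewrite ge0_integralZl//=; last 3 first.
  + under eq_fun do rewrite -cos_atan.
    apply/measurable_EFinP; apply: measurable_funM.
      apply: continuous_measurable_fun => y.
      by apply: (cvg_comp _ _ (@continuous_atan R y)); exact: continuous_cos.
    apply: (measurableT_comp measurable_invr).
    by apply: measurable_funD => //; exact: measurable_funX.
  + by move=> y _; rewrite lee_fin mulr_ge0// invr_ge0 ?sqrtr_ge0 ?addr_ge0 ?sqr_ge0.
  + by rewrite lee_fin divr_ge0// pi_ge0.
  by rewrite integral_inv_sqrt_cubed -!EFinM divfK// mulVf// gt_eqF// pi_gt0.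
- have cC : continuous C.
    move=> y; apply: continuous_comp; last exact: sqrt_continuous.
    have d1 : is_derive y 1 (fun x => x - w.2) (1 + 0).
      exact: (pderiveD (pderive_id y) (pderive_cst (- w.2) y)).
    exact: is_derive_cvg (pderiveD (pderiveX 2 d1) (pderive_cst e y)).
  move=> y; apply: cvgMr; apply: cvgV; first by rewrite expf_neq0// gt_eqF.
  have d := pderiveX 3 (pderive_id (C y)).
  exact: (cvg_comp _ _ (cC y) (is_derive_cvg d)).
- move=> y; rewrite mulr_ge0 ?mulr_ge0 ?invr_ge0 ?exprn_ge0 ?pi_ge0 ?(ltW e0)//.
  exact: ltW.
Qed.

End area_measure_theory.

Lemma integrable_prod d1 d2 (T1 : measurableType d1) (T2 : measurableType d2)
    (R : realType) (m1 : {sigma_finite_measure set T1 -> \bar R})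
    (m2 : {sigma_finite_measure set T2 -> \bar R}) (f : T1 -> R) (g : T2 -> R) :
  m1.-integrable setT (EFin \o f) -> m2.-integrable setT (EFin \o g) ->
  (m1 \x m2)%E.-integrable setT (EFin \o (fun z => f z.1 * g z.2)).
Proof.
move=> fi gi.
have /measurable_EFinP mf := measurable_int _ fi.
have /measurable_EFinP mg := measurable_int _ gi.
apply/integrable12ltyP.
  apply/measurable_EFinP; apply: measurable_funM.
    exact: (measurableT_comp mf).
  exact: (measurableT_comp mg).
have /integrableP[_ foo] := fi; have /integrableP[_ goo] := gi.
pose G := (\int[m2]_y `|(g y)%:E|)%E.
have G0 : (0 <= G)%E by apply: integral_ge0.
rewrite (_ : (\int[m1]_x _)%E = (\int[m1]_x (`|(f x)%:E| * G))%E); last first.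
  apply: eq_integral => x _ /=.
  rewrite -ge0_integralZl//=; last by do 2 apply: measurableT_comp.
  by apply: eq_integral => y _; rewrite -EFinM normrM.
rewrite ge0_integralZr//=; last by do 2 apply: measurableT_comp.
by rewrite lte_mul_pinfty//; [apply: integral_ge0|rewrite ge0_fin_numE// integral_ge0].
Qed.

Section real_valued_integrable.
Context d (T : measurableType d) (R : realType) (m : {measure set T -> \bar R}).
Implicit Types f g : T -> R.

Lemma RintegrableD f g : m.-integrable setT (fun x => (f x)%:E) ->
  m.-integrable setT (fun x => (g x)%:E) -> m.-integrable setT (fun x => (f x + g x)%:E).
Proof. by move=> fi gi; exact: integrableD fi gi. Qed.

Lemma RintegrableB f g : m.-integrable setT (fun x => (f x)%:E) ->
  m.-integrable setT (fun x => (g x)%:E) -> m.-integrable setT (fun x => (f x - g x)%:E).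
Proof. by move=> fi gi; exact: integrableB fi gi. Qed.

Lemma RintegrableZl c f : m.-integrable setT (fun x => (f x)%:E) ->
  m.-integrable setT (fun x => (c * f x)%:E).
Proof. by move=> fi; exact: integrableZl fi. Qed.

Lemma RintegrableZr c f : m.-integrable setT (fun x => (f x)%:E) ->
  m.-integrable setT (fun x => (f x * c)%:E).
Proof. by move=> fi; exact: integrableZr fi. Qed.

Lemma Rintegrable_measurable f : m.-integrable setT (fun x => (f x)%:E) ->
  measurable_fun setT f.
Proof. by move=> /measurable_int/measurable_EFinP. Qed.

Lemma Rintegrable_le f g : measurable_fun setT f -> (forall x, `|f x| <= g x) ->
  m.-integrable setT (fun x => (g x)%:E) -> m.-integrable setT (fun x => (f x)%:E).
Proof.
move=> mf fg gi; apply: le_integrable gi => //; first exact/measurable_EFinP.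
by move=> x _; rewrite lee_fin (le_trans (fg x))// ler_norm.
Qed.

Lemma Rintegrable_norm f : m.-integrable setT (fun x => (f x)%:E) ->
  m.-integrable setT (fun x => `|f x|%:E).
Proof. by move=> fi; exact: integrable_norm fi. Qed.

Lemma Rintegrable_indicM f A : measurable A ->
  m.-integrable setT (fun x => (f x)%:E) ->
  m.-integrable setT (fun x => (f x * \1_A x)%:E).
Proof.
move=> mA fi; apply: (Rintegrable_le _ _ (Rintegrable_norm fi)).
  apply: measurable_funM; first exact: Rintegrable_measurable fi.
  exact: measurable_indic.
move=> x; rewrite normrM -[leRHS]mulr1 ler_wpM2l//.
by rewrite indicE; case: (_ \in _); rewrite ?normr0 ?normr1.
Qed.

Lemma Rintegral_indic A (v : R) : measurable A -> m A = v%:E ->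
  m.-integrable setT (fun x => (\1_A x : R)%:E) /\ \int[m]_x (\1_A x : R) = v.
Proof.
move=> mA Av; have E : (\int[m]_x (\1_A x)%:E = v%:E)%E.
  by rewrite integral_indic// setIT.
split; last by rewrite /Rintegral E.
apply/integrableP; split; first by apply/measurable_EFinP; exact: measurable_indic.
by under eq_integral do rewrite gee0_abs ?lee_fin//; rewrite E ltry.
Qed.

End real_valued_integrable.

Lemma lebesgue_measure_itvcc (R : realType) (c d : R) : c <= d ->
  lebesgue_measure `[c, d]%classic = (d - c)%:E.
Proof.
move=> cd; rewrite lebesgue_measure_itv/= lte_fin -EFinB.
case: ltP => // dc; by rewrite (_ : c = d) ?subrr//; apply/eqP; rewrite eq_le cd dc.
Qed.

(** * Test functions on a small square and integration by parts against them *)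

Section bump_functions.
Context {R : realType}.
Local Notation mu := (@lebesgue_measure R).
Variables (a k : R).
Hypothesis k_gt0 : 0 < k.
Implicit Types (f g : plane R -> R) (z w : plane R).

Let k0 : k != 0. Proof. by rewrite gt_eqF. Qed.

Definition inbox z := (`|k * (z.1 - a)| <= 1) && (`|k * z.2| <= 1).

Definition phi z : R := bump0 (k * (z.1 - a)) * bump0 (k * z.2).

(* [psi] is the Wirtinger Laplacian d dbar = Laplacian/4 of [phi]. *)
Definition psi z : R := k ^+ 2 / 4 * (bump2 (k * (z.1 - a)) * bump0 (k * z.2) +
  bump0 (k * (z.1 - a)) * bump2 (k * z.2)).

Lemma phi_ge0 z : 0 <= phi z.
Proof. by rewrite mulr_ge0 ?bump0_ge0. Qed.

Lemma phi_le1 z : phi z <= 1.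
Proof. by rewrite mulr_ile1 ?bump0_ge0 ?bump0_le1. Qed.

Lemma phi_eq0 z : ~~ inbox z -> phi z = 0.
Proof.
rewrite negb_and -!ltNge => /orP[] h; first by rewrite /phi bump0_eq0 ?mul0r// ltW.
by rewrite /phi mulrC bump0_eq0 ?mul0r// ltW.
Qed.

Lemma psi_eq0 z : ~~ inbox z -> psi z = 0.
Proof.
rewrite negb_and -!ltNge => /orP[] /ltW h.
  by rewrite /psi (bump0_eq0 h) (bump2_eq0 h) !mul0r addr0 mulr0.
by rewrite /psi (bump0_eq0 h) (bump2_eq0 h) !mulr0 addr0 mulr0.
Qed.

Let measurable_x (b : R -> R) : continuous b ->
  measurable_fun [set: plane R] (fun z => b (k * (z.1 - a))).
Proof.
move=> cb; apply: (measurableT_comp (f := b)); first exact: continuous_measurable_fun.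
by apply: measurable_funM => //; apply: measurable_funB.
Qed.

Let measurable_y (b : R -> R) : continuous b ->
  measurable_fun [set: plane R] (fun z => b (k * z.2)).
Proof.
move=> cb; apply: (measurableT_comp (f := b)); first exact: continuous_measurable_fun.
by apply: measurable_funM.
Qed.

Lemma measurable_phi : measurable_fun setT phi.
Proof.
by apply: measurable_funM; [apply: measurable_x|apply: measurable_y];
  exact: continuous_bump0.
Qed.

Lemma measurable_psi : measurable_fun setT psi.
Proof.
apply: measurable_funM => //; apply: measurable_funD; apply: measurable_funM;
  by [apply: measurable_x; exact: continuous_bump0|
      apply: measurable_y; exact: continuous_bump0|
      apply: measurable_x; exact: continuous_bump2|
      apply: measurable_y; exact: continuous_bump2].
Qed.

Let inboxE : [set z | inbox z] =
  `[a - k^-1, a + k^-1]%classic `*` `[- k^-1, k^-1]%classic.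
Proof.
apply/seteqP; split=> -[x y] /=; rewrite /inbox/= !in_itv/= !normrM (gtr0_norm k_gt0).
  by move=> /andP[]; rewrite -!ler_pdivlMl// !mulr1 ler_distl ler_norml.
by move=> [h1 h2]; rewrite -!ler_pdivlMl// !mulr1 ler_distl ler_norml h1 h2.
Qed.

Lemma measurable_inbox : measurable [set z | inbox z].
Proof. by rewrite inboxE; apply: measurableX; exact: measurable_itv. Qed.

Lemma dA_inbox : dA [set z | inbox z] = (4 / (pi * k ^+ 2))%:E.
Proof.
rewrite inboxE /dA /mscale/= product_measure1E; [|exact: measurable_itv..].
have ki : 0 < k^-1 by rewrite invr_gt0.
transitivity ((1 / pi)%:E * ((a + k^-1 - (a - k^-1))%:E * (k^-1 - - k^-1)%:E))%E.
  by congr (_ * (_ * _))%E; apply: lebesgue_measure_itvcc; lra.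
rewrite -!EFinM; congr EFin; move: (pi_gt0 R); move: pi => p p0; field.
by rewrite k0 gt_eqF.
Qed.

(** A class of integrable functions suited to products: in [boxedM] the other factor, for instance
    the logarithm of a density, needs to be bounded only on the box. *)
Definition boxed f := [/\ measurable_fun setT f, (forall z, ~~ inbox z -> f z = 0) &
  exists C, forall z, `|f z| <= C].

Definition bounded_on_box f := exists C, forall z, inbox z -> `|f z| <= C.

Lemma bounded_on_box_ln f c C : 0 < c -> (forall z, inbox z -> c <= f z <= C) ->
  bounded_on_box (fun z => ln (f z)).
Proof.
move=> c0 hf; exists (`|ln c| + `|ln C|) => z /hf /andP[h1 h2].
have d0 := lt_le_trans c0 h1; have C0 := lt_le_trans d0 h2.
have l1 : ln c <= ln (f z) by rewrite ler_ln.
have l2 : ln (f z) <= ln C by rewrite ler_ln.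
rewrite ler_norml; have := ler_norm (ln C); have := ler_norm (- ln c).
by rewrite normrN; have := normr_ge0 (ln C); have := normr_ge0 (ln c); lra.
Qed.

Lemma boxedM f g : measurable_fun setT f -> bounded_on_box f -> boxed g ->
  boxed (fun z => f z * g z).
Proof.
move=> mf [C HC] [mg g0 [D HD]]; split.
- exact: measurable_funM.
- by move=> z /g0 ->; rewrite mulr0.
- exists (`|C| * `|D|) => z; have [zb|/g0 ->] := boolP (inbox z).
    rewrite normrM ler_pM//; first exact: le_trans (HC _ zb) (ler_norm _).
    exact: le_trans (HD _) (ler_norm _).
  by rewrite mulr0 normr0 mulr_ge0.
Qed.

Lemma boxed_integrable f : boxed f -> dA.-integrable setT (EFin \o f).
Proof.
move=> [mf f0 [C HC]].
have h := @measurable_bounded_integrable _ _ R dA f _ measurable_inbox.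
have {}h : dA.-integrable [set z | inbox z] (EFin \o f).
  apply: h; [by rewrite [X in (X < _)%E]dA_inbox ltry|exact: measurable_funTS|].
  exists C; split; first exact: num_real.
  by move=> M CM z _; exact: le_trans (HC z) (ltW CM).
move/(integrable_mkcond _ measurable_inbox) : h; apply: eq_integrable => // z _.
rewrite patchE; case: ifPn => //.
by rewrite notin_setE/= => /negP /f0 /= ->.
Qed.

Lemma boxed_phi : boxed phi.
Proof.
split; [exact: measurable_phi|exact: phi_eq0|exists 1 => z].
by rewrite ger0_norm ?phi_ge0// phi_le1.
Qed.

Lemma psi_le C : (forall x : R, `|bump2 x| <= C) -> forall z, `|psi z| <= k ^+ 2 / 2 * C.
Proof.
move=> HC z; have C0 : 0 <= C := le_trans (normr_ge0 _) (HC 0).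
have h x y : `|bump2 x * bump0 y| <= C.
  rewrite normrM -[leRHS]mulr1 ler_pM// ger0_norm ?bump0_ge0// bump0_le1//.
rewrite /psi normrM ger0_norm ?divr_ge0 ?sqr_ge0//.
have : `|bump2 (k * (z.1 - a)) * bump0 (k * z.2) +
  bump0 (k * (z.1 - a)) * bump2 (k * z.2)| <= 2 * C.
  rewrite mulr_natl mulr2n (le_trans (ler_normD _ _))// lerD//.
  by rewrite mulrC.
move=> /(ler_wpM2l _) h2; apply: le_trans (h2 _ _) _; first by rewrite divr_ge0 ?sqr_ge0.
by lra.
Qed.

Lemma boxed_psi : boxed psi.
Proof.
split; [exact: measurable_psi|exact: psi_eq0|].
by have [C HC] := @bump2_bounded R; exists (k ^+ 2 / 2 * C) => z; exact: psi_le.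
Qed.

Let integrable_supp (f : R -> R) (c : R) : measurable_fun setT f ->
  (forall x, 1 < `|k * (x - c)| -> f x = 0) -> (exists C, forall x, `|f x| <= C) ->
  mu.-integrable setT (EFin \o f).
Proof.
move=> mf f0 [C HC].
have mI : measurable (`[c - k^-1, c + k^-1]%classic : set (measurableTypeR R)).
  exact: measurable_itv.
have h : mu.-integrable `[c - k^-1, c + k^-1]%classic (EFin \o f).
  apply: measurable_bounded_integrable => //.
  - have ki : 0 < k^-1 by rewrite invr_gt0.
    have h : c - k^-1 <= c + k^-1 by lra.
    by have := ltry (c + k^-1 - (c - k^-1)); rewrite -(lebesgue_measure_itvcc h).
  - exact: measurable_funTS.
  exists C; split; first exact: num_real.
  by move=> M CM z _; exact: le_trans (HC z) (ltW CM).
move/(integrable_mkcond _ mI) : h; apply: eq_integrable => // x _.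
rewrite patchE; case: ifPn => //.
rewrite notin_setE/= in_itv/= => /negP; rewrite -ler_distl -ltNge => h.
by rewrite f0// normrM (gtr0_norm k_gt0) -ltr_pdivrMl// mulr1.
Qed.

Lemma boxed_section1 f x : boxed f -> mu.-integrable setT (fun y => (f (x, y))%:E).
Proof.
move=> [mf f0 [C HC]]; apply: (@integrable_supp (fun y => f (x, y)) 0).
- exact: (measurableT_comp mf (pair1_measurable _)).
- by move=> y; rewrite subr0 => h; rewrite f0//= negb_and -!ltNge h orbT.
- by exists C.
Qed.

Lemma boxed_section2 f y : boxed f -> mu.-integrable setT (fun x => (f (x, y))%:E).
Proof.
move=> [mf f0 [C HC]]; apply: (@integrable_supp (fun x => f (x, y)) a).
- exact: (measurableT_comp mf (pair2_measurable _)).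
- by move=> x h; rewrite f0//= negb_and -!ltNge h.
- by exists C.
Qed.

Lemma is_derive_bump_affine (b b' : R -> R) (c x : R) :
  (forall x : R, is_derive x 1 b (b' x)) ->
  is_derive x 1 (fun x => b (k * (x - c))) (k * b' (k * (x - c))).
Proof.
move=> db.
have d := pderive_comp (pderiveM (pderive_cst k x)
  (pderiveD (pderive_id x) (pderive_cst (- c) x))) (db (k * (x - c))).
by apply: (is_derive_eq d); ring.
Qed.

Let is_derive_LR (f f' : R -> R) (l r : R) : (forall x : R, is_derive x 1 f (f' x)) ->
  derivable_oo_LRcontinuous f l r.
Proof.
move=> df; split.
- by move=> x _; case: (df x).
- by apply: cvg_at_right_filter; exact: is_derive_cvg (df l).
- by apply: cvg_at_left_filter; exact: is_derive_cvg (df r).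
Qed.

(** Two integrations by parts on [[c - k^-1, c + k^-1]]. The boundary terms vanish because [bump0]
    and [bump1] are [0] at both endpoints, so [f] may grow arbitrarily at infinity. *)
Lemma bump_by_parts (f f1 f2 : R -> R) c :
    (forall x : R, is_derive x 1 f (f1 x)) -> (forall x : R, is_derive x 1 f1 (f2 x)) ->
    continuous f2 ->
  \int[mu]_x (f x * (k ^+ 2 * bump2 (k * (x - c)))) =
  \int[mu]_x (f2 x * bump0 (k * (x - c))).
Proof.
move=> df df1 cf2.
pose l := c - k^-1; pose r := c + k^-1.
have ki : 0 < k^-1 by rewrite invr_gt0.
have lr : l < r by rewrite /l /r; lra.
have out x : ~~ (x \in `[l, r]) -> 1 <= `|k * (x - c)|.
  rewrite in_itv/= -ler_distl -ltNge => h.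
  by rewrite ltW// normrM (gtr0_norm k_gt0) -ltr_pdivrMl// mulr1.
have kl : k * (l - c) = -1 by rewrite /l addrAC subrr sub0r mulrN divff.
have kr : k * (r - c) = 1 by rewrite /r addrAC subrr add0r divff.
pose b x := bump0 (k * (x - c)); pose b1 x := k * bump1 (k * (x - c)).
pose b2 x := k ^+ 2 * bump2 (k * (x - c)).
have db (x : R) : is_derive x 1 b (b1 x) by exact: is_derive_bump_affine (@is_derive_bump0 R).
have db1 (x : R) : is_derive x 1 b1 (b2 x).
  have d := pderiveM (pderive_cst k x) (is_derive_bump_affine c x (@is_derive_bump1 R)).
  by apply: (is_derive_eq d); rewrite /b2; ring.
have cb2 : continuous b2.
  move=> x; apply: cvgMr; apply: (@cvg_comp _ _ _ (fun x => k * (x - c)) bump2).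
    exact: is_derive_cvg (pderiveM (pderive_cst k x)
      (pderiveD (pderive_id x) (pderive_cst (- c) x))).
  exact: continuous_bump2.
have restr (g h : R -> R) : (forall x, 1 <= `|k * (x - c)| -> h x = 0) ->
    \int[mu]_x (g x * h x) = \int[mu]_(x in `[l, r]) (g x * h x).
  move=> h0; rewrite [RHS]Rintegral_mkcond; apply: eq_Rintegral => x _.
  rewrite patchE; case: ifPn => //; rewrite notin_setE/= => /negP/out/h0 ->.
  by rewrite mulr0.
rewrite (restr f b2); last by move=> x /bump2_eq0 h; rewrite /b2 h mulr0.
rewrite (restr f2 b); last by move=> x; exact: bump0_eq0.
have c1 : continuous f1 := is_derive_continuous df1.
have cb1 : continuous b1 := is_derive_continuous db1.
have D (g g' : R -> R) : (forall x : R, is_derive x 1 g (g' x)) ->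
    {in `]l, r[, g^`()%classic =1 g'}.
  by move=> dg x _; rewrite derive1E; exact: (@derive_val _ _ _ _ _ _ _ (dg x)).
rewrite (@Rintegration_by_parts R f b1 f1 b2 l r lr) ?(D _ _ df) ?(D _ _ db1)//;
  [|exact: continuous_subspaceT|exact: is_derive_LR df|exact: D
   |exact: continuous_subspaceT|exact: is_derive_LR db1|exact: D].
rewrite (@Rintegration_by_parts R f1 b f2 b1 l r lr)//;
  [|exact: continuous_subspaceT|exact: is_derive_LR df1|exact: D
   |exact: continuous_subspaceT|exact: is_derive_LR db|exact: D].
rewrite /b1 /b kl kr !bump0_eq0 ?bump1_eq0 ?normrN ?normr1//.
by rewrite !mulr0 !subr0 !sub0r opprK.
Qed.

Lemma le_sqdist_box w : exists S, forall z, inbox z -> sqdist z w <= S.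
Proof.
exists ((k^-1 + `|a - w.1|) ^+ 2 + (k^-1 + `|w.2|) ^+ 2) => z.
have ki : 0 <= k^-1 by rewrite invr_ge0 ltW.
rewrite /inbox !normrM (gtr0_norm k_gt0) -!ler_pdivlMl// !mulr1 => /andP[h1 h2].
rewrite /sqdist lerD//.
  rewrite -[leLHS]real_normK ?num_real// ler_sqr ?nnegrE ?addr_ge0//.
  by rewrite (_ : z.1 - w.1 = (z.1 - a) + (a - w.1)) ?(le_trans (ler_normD _ _)) ?lerD//; ring.
rewrite -[leLHS]real_normK ?num_real// ler_sqr ?nnegrE ?addr_ge0//.
by rewrite (le_trans (ler_normB _ _))// lerD.
Qed.

Lemma bounded_on_segment (F : R -> R) S :
  (forall s, 0 <= s -> {for s, continuous F}) ->
  exists C, forall s, 0 <= s <= S -> `|F s| <= C.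
Proof.
move=> cF; have [S0|S0] := ltP S 0.
  by exists 0 => s /andP[s0 sS]; have := lt_le_trans S0 s0; rewrite ltNge sS.
have [|c _ hc] := @EVT_max R (fun s => `|F s|) 0 S S0.
  apply: continuous_in_subspaceT => s; rewrite inE/= in_itv/= => /andP[s0 _].
  exact: (cvg_norm (cF s s0)).
by exists `|F c| => s sS; apply: hc; rewrite in_itv.
Qed.

Section laplacian_by_parts.
Variables (F F1 F2 : R -> R) (w : plane R).
Hypotheses (mF : measurable_fun setT F) (mF1 : measurable_fun setT F1)
  (mF2 : measurable_fun setT F2).
Hypothesis dF : forall s : R, 0 <= s -> is_derive s 1 F (F1 s).
Hypothesis dF1 : forall s : R, 0 <= s -> is_derive s 1 F1 (F2 s).
Hypothesis cF2 : forall s : R, 0 <= s -> {for s, continuous F2}.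

Let bounded_radial (G : R -> R) : (forall s, 0 <= s -> {for s, continuous G}) ->
  bounded_on_box (fun z => G (sqdist z w)).
Proof.
move=> cG; have [S HS] := le_sqdist_box w.
have [C HC] := bounded_on_segment S cG.
by exists C => z /HS zS; apply: HC; rewrite sqdist_ge0.
Qed.

Let measurable_radial (G : R -> R) : measurable_fun setT G ->
  measurable_fun setT (fun z => G (sqdist z w)).
Proof. by move=> mG; apply: (measurableT_comp mG); exact: measurable_sqdist. Qed.

Let cF : forall s, 0 <= s -> {for s, continuous F}.
Proof. by move=> s /dF; exact: is_derive_cvg. Qed.

Let cF1 : forall s, 0 <= s -> {for s, continuous F1}.
Proof. by move=> s /dF1; exact: is_derive_cvg. Qed.

Let boxed_bumps (b c : R -> R) : continuous b -> continuous c ->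
    (forall x, 1 <= `|x| -> b x = 0) -> (forall x, 1 <= `|x| -> c x = 0) ->
    (exists C, forall x, `|b x| <= C) -> (exists C, forall x, `|c x| <= C) ->
  boxed (fun z => b (k * (z.1 - a)) * c (k * z.2)).
Proof.
move=> cb cc b0 c0 [C HC] [D HD]; split.
- by apply: measurable_funM; [exact: measurable_x|exact: measurable_y].
- move=> z; rewrite negb_and -!ltNge => /orP[] /ltW h; first by rewrite b0// mul0r.
  by rewrite c0// mulr0.
- by exists (C * D) => z; rewrite normrM ler_pM.
Qed.

Let k2bump2 : continuous (fun x : R => k ^+ 2 * bump2 x).
Proof. by move=> x; apply: cvgMr; exact: continuous_bump2. Qed.

Let b0bound : exists C, forall x : R, `|bump0 x| <= C.
Proof. by exists 1 => x; rewrite ger0_norm ?bump0_ge0 ?bump0_le1. Qed.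

Let k2bound : exists C, forall x : R, `|k ^+ 2 * bump2 x| <= C.
Proof.
have [C HC] := @bump2_bounded R; exists (k ^+ 2 * C) => x.
by rewrite normrM ger0_norm ?sqr_ge0// ler_wpM2l ?sqr_ge0.
Qed.

Let k2zero (x : R) : 1 <= `|x| -> k ^+ 2 * bump2 x = 0.
Proof. by move=> /bump2_eq0 ->; rewrite mulr0. Qed.

Let dsq (c x y0 : R) : is_derive x 1 (fun x => (x - c) ^+ 2 + y0) (2 * (x - c)).
Proof.
apply: (is_derive_eq (pderiveD (pderiveX 2 (pderiveD (pderive_id x)
  (pderive_cst (- c) x))) (pderive_cst y0 x))).
by rewrite expr1; ring.
Qed.

(* One variable at a time: [c] and [y0] are the frozen data of [sqdist]. *)
Let radial_by_parts (c y0 e : R) : 0 <= y0 ->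
  \int[mu]_x (F ((x - c) ^+ 2 + y0) * (k ^+ 2 * bump2 (k * (x - e)))) =
  \int[mu]_x ((2 * F1 ((x - c) ^+ 2 + y0) +
    4 * (x - c) ^+ 2 * F2 ((x - c) ^+ 2 + y0)) * bump0 (k * (x - e))).
Proof.
move=> y00.
have s0 (x : R) : 0 <= (x - c) ^+ 2 + y0 by rewrite addr_ge0 ?sqr_ge0.
apply: (@bump_by_parts (fun x => F ((x - c) ^+ 2 + y0))
  (fun x => 2 * (x - c) * F1 ((x - c) ^+ 2 + y0))).
- by move=> x; exact: (pderive_comp (dsq c x y0) (dF (s0 x))).
- move=> x.
  have d := pderiveM (pderiveM (pderive_cst 2 x) (pderiveD (pderive_id x)
    (pderive_cst (- c) x))) (pderive_comp (dsq c x y0) (dF1 (s0 x))).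
  by apply: (is_derive_eq d); ring.
- move=> x; apply: cvgD.
    apply: cvgMr; exact: is_derive_cvg (pderive_comp (dsq c x y0) (dF1 (s0 x))).
  apply: cvgM.
    exact: is_derive_cvg (pderiveM (pderive_cst 4 x) (pderiveX 2
      (pderiveD (pderive_id x) (pderive_cst (- c) x)))).
  apply: (cvg_comp _ _ (is_derive_cvg (dsq c x y0))); exact: cF2.
Qed.

(** Second partial derivatives, in each coordinate, of [F (sqdist z w)]; their sum is four times the
    integrand in [laplacian_by_parts]. *)
Let F2x z := 2 * F1 (sqdist z w) + 4 * (z.1 - w.1) ^+ 2 * F2 (sqdist z w).
Let F2y z := 2 * F1 (sqdist z w) + 4 * (z.2 - w.2) ^+ 2 * F2 (sqdist z w).

Let bounded_F2 (p : plane R -> R) : (forall z, 0 <= p z <= sqdist z w) ->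
  bounded_on_box (fun z => 2 * F1 (sqdist z w) + 4 * p z * F2 (sqdist z w)).
Proof.
move=> hp; have [C1 H1] := bounded_radial cF1; have [C2 H2] := bounded_radial cF2.
have [S HS] := le_sqdist_box w.
exists (2 * C1 + 4 * S * C2) => z zb; have /andP[p0 ps] := hp z.
rewrite (le_trans (ler_normD _ _))// lerD//.
  by rewrite normrM ger0_norm// ler_wpM2l// H1.
rewrite normrM ler_pM ?H2// normrM !ger0_norm// ler_wpM2l//.
exact: le_trans ps (HS _ zb).
Qed.

Let measurable_F2 (p : plane R -> R) : measurable_fun setT p ->
  measurable_fun setT (fun z => 2 * F1 (sqdist z w) + 4 * p z * F2 (sqdist z w)).
Proof.
move=> mp; apply: measurable_funD.
  by apply: measurable_funM => //; exact: measurable_radial.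
by apply: measurable_funM; [exact: measurable_funM|exact: measurable_radial].
Qed.

Let boxed_F2x : boxed (fun z => F2x z * phi z).
Proof.
apply: boxedM boxed_phi; first by apply: measurable_F2; apply: measurable_funX;
  exact: measurable_funB.
by apply: bounded_F2 => z; rewrite sqr_ge0/= lerDl sqr_ge0.
Qed.

Let boxed_F2y : boxed (fun z => F2y z * phi z).
Proof.
apply: boxedM boxed_phi; first by apply: measurable_F2; apply: measurable_funX;
  exact: measurable_funB.
by apply: bounded_F2 => z; rewrite sqr_ge0/= lerDr sqr_ge0.
Qed.

Let Bx z := k ^+ 2 * bump2 (k * (z.1 - a)) * bump0 (k * z.2).
Let By z := bump0 (k * (z.1 - a)) * (k ^+ 2 * bump2 (k * z.2)).

Let boxed_FBx : boxed (fun z => F (sqdist z w) * Bx z).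
Proof.
apply: boxedM; [exact: measurable_radial|exact: bounded_radial|].
apply: (boxed_bumps (b := fun x => k ^+ 2 * bump2 x) (c := bump0)) => //.
- exact: continuous_bump0.
- exact: bump0_eq0.
Qed.

Let boxed_FBy : boxed (fun z => F (sqdist z w) * By z).
Proof.
apply: boxedM; [exact: measurable_radial|exact: bounded_radial|].
apply: (boxed_bumps (b := bump0) (c := fun x => k ^+ 2 * bump2 x)) => //.
- exact: continuous_bump0.
- exact: bump0_eq0.
Qed.

Let integral_FBx :
  \int[dA]_z (F (sqdist z w) * Bx z) = \int[dA]_z (F2x z * phi z).
Proof.
rewrite (Rintegral_dA21 (boxed_integrable boxed_FBx)); last first.
  by move=> y; exact: boxed_section2 boxed_FBx.
rewrite (Rintegral_dA21 (boxed_integrable boxed_F2x)); last first.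
  by move=> y; exact: boxed_section2 boxed_F2x.
congr (_ * _); apply: eq_Rintegral => y _.
have y0 : 0 <= (y - w.2) ^+ 2 by exact: sqr_ge0.
have h := radial_by_parts w.1 a y0.
(* On a horizontal line the factor [bump0 (k * y)] is constant. Where it is nonzero it can be
   divided out, leaving the one-variable formula; where it vanishes, both integrands are [0]. *)
have c0 : bump0 (k * y) != 0 \/ bump0 (k * y) = 0.
  by case: eqP; [right|left; exact/eqP].
case: c0 => [c0|c0]; last first.
  transitivity (\int[mu]_x (0 : R)).
    by apply: eq_Rintegral => x _; rewrite /Bx/= c0 !mulr0.
  by apply: eq_Rintegral => x _; rewrite /phi/= c0 !mulr0.
apply: (mulIf (invr_neq0 c0)).
rewrite -(RintegralZr _ measurableT (boxed_section2 y boxed_FBx)).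
rewrite -(RintegralZr _ measurableT (boxed_section2 y boxed_F2x)).
transitivity (\int[mu]_x (F ((x - w.1) ^+ 2 + (y - w.2) ^+ 2) *
    (k ^+ 2 * bump2 (k * (x - a))))).
  by apply: eq_Rintegral => x _; rewrite /Bx/= mulrA mulfK.
rewrite h; apply: eq_Rintegral => x _.
by rewrite /phi/= mulrA mulfK.
Qed.

Let integral_FBy :
  \int[dA]_z (F (sqdist z w) * By z) = \int[dA]_z (F2y z * phi z).
Proof.
rewrite (Rintegral_dA12 (boxed_integrable boxed_FBy)); last first.
  by move=> x; exact: boxed_section1 boxed_FBy.
rewrite (Rintegral_dA12 (boxed_integrable boxed_F2y)); last first.
  by move=> x; exact: boxed_section1 boxed_F2y.
congr (_ * _); apply: eq_Rintegral => x _.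
have h := radial_by_parts w.2 0 (sqr_ge0 (x - w.1)).
have c0 : bump0 (k * (x - a)) != 0 \/ bump0 (k * (x - a)) = 0.
  by case: eqP; [right|left; exact/eqP].
case: c0 => [c0|c0]; last first.
  transitivity (\int[mu]_y (0 : R)).
    by apply: eq_Rintegral => y _; rewrite /By/= c0 mul0r mulr0.
  by apply: eq_Rintegral => y _; rewrite /phi/= c0 mul0r mulr0.
apply: (mulIf (invr_neq0 c0)).
rewrite -(RintegralZr _ measurableT (boxed_section1 x boxed_FBy)).
rewrite -(RintegralZr _ measurableT (boxed_section1 x boxed_F2y)).
transitivity (\int[mu]_y (F ((y - w.2) ^+ 2 + (x - w.1) ^+ 2) *
    (k ^+ 2 * bump2 (k * (y - 0))))).
  apply: eq_Rintegral => y _.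
  by rewrite /By/= subr0 /sqdist [_ + (y - w.2) ^+ 2]addrC mulrCA mulrAC mulfV// mul1r.
rewrite h; apply: eq_Rintegral => y _.
rewrite [RHS](_ : _ = F2y (x, y) * bump0 (k * y)); last by rewrite /phi/=; field.
by rewrite subr0 /F2y /sqdist/= [(x - w.1) ^+ 2 + _]addrC.
Qed.

(** For a radial function, d dbar F(|z - w|^2) = s F''(s) + F'(s) with s = |z - w|^2. Regularity of
    [F] is assumed on s >= 0 only, which admits ln (s + e). *)
Lemma laplacian_by_parts :
  \int[dA]_z (F (sqdist z w) * psi z) =
  \int[dA]_z ((sqdist z w * F2 (sqdist z w) + F1 (sqdist z w)) * phi z).
Proof.
transitivity (4^-1 * (\int[dA]_z (F (sqdist z w) * Bx z) +
    \int[dA]_z (F (sqdist z w) * By z))).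
  rewrite -RintegralD//; [|exact: boxed_integrable boxed_FBx|exact: boxed_integrable boxed_FBy].
  rewrite -RintegralZl//; last first.
    exact: integrableD (boxed_integrable boxed_FBx) (boxed_integrable boxed_FBy).
  by apply: eq_Rintegral => z _; rewrite /psi /Bx /By; field.
rewrite integral_FBx integral_FBy.
rewrite -RintegralD//; [|exact: boxed_integrable boxed_F2x|exact: boxed_integrable boxed_F2y].
rewrite -RintegralZl//; last first.
  exact: integrableD (boxed_integrable boxed_F2x) (boxed_integrable boxed_F2y).
by apply: eq_Rintegral => z _; rewrite /F2x /F2y {5 7}/sqdist; field.
Qed.

End laplacian_by_parts.

End bump_functions.

(** * Green's formula *)

Section green.
Context {R : realType}.
Local Notation mu := (@lebesgue_measure R).
Variables (a k : R).
Hypothesis k_gt0 : 0 < k.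
Implicit Types (f g : plane R -> R) (z w : plane R).

Local Notation inbox := (inbox a k).
Local Notation phi := (phi a k).
Local Notation psi := (psi a k).

Let set1E z : [set z] = [set z.1] `*` [set z.2].
Proof. by apply/seteqP; split=> -[x y]/=; case: z => u v/= [-> ->]. Qed.

Lemma dA_set1 z : dA [set z] = 0%E.
Proof.
by rewrite set1E /dA /mscale/= product_measure1E//= lebesgue_measure_set1 mul0e mule0.
Qed.

Lemma measurable_plane_set1 z : measurable [set z].
Proof. by rewrite set1E; apply: measurableX; exact: measurable_set1. Qed.

Lemma normsqE z : normsq z = z.1 ^+ 2 + z.2 ^+ 2.
Proof. by rewrite /normsq /cabs sqr_sqrtr// addr_ge0 ?sqr_ge0. Qed.

Lemma normsq_ge0 z : 0 <= normsq z.
Proof. exact: sqr_ge0. Qed.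

Lemma sqdist_eq0 w z : sqdist w z = 0 -> w = z.
Proof.
move=> /eqP; rewrite paddr_eq0 ?sqr_ge0// !sqrf_eq0 !subr_eq0.
by case: w z => [x y] [u v] /= /andP[/eqP -> /eqP ->].
Qed.

(** If the argument is at least 1, use ln x <= x - 1. Otherwise one of [u], [v] is nonzero, and its
    square bounds the argument from below. The bound is uniform in [e], as dominated convergence
    demands, and separates the variables. *)
Lemma norm_ln_sqr_le (e u v : R) : 0 <= e <= 1 -> u ^+ 2 + v ^+ 2 != 0 ->
  `|ln (u ^+ 2 + v ^+ 2 + e)| <=
  4 * inv_sqrt_abs u + 4 * inv_sqrt_abs v + (u ^+ 2 + v ^+ 2 + 1).
Proof.
move=> /andP[e0 e1] s0.
have hu := inv_sqrt_abs_ge0 u; have hv := inv_sqrt_abs_ge0 v.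
have u2 := sqr_ge0 u; have v2 := sqr_ge0 v.
have sp : 0 < u ^+ 2 + v ^+ 2 by rewrite lt_neqAle eq_sym s0 addr_ge0.
have [h|h] := leP 1 (u ^+ 2 + v ^+ 2 + e).
  rewrite ger0_norm ?ln_ge0//.
  have h1 : -1 < u ^+ 2 + v ^+ 2 + e - 1 by lra.
  have := le_ln1Dx h1; rewrite (_ : 1 + _ = u ^+ 2 + v ^+ 2 + e); last ring.
  by lra.
rewrite ler0_norm; last by rewrite ln_le0// ltW.
have key (x : R) : x ^+ 2 <= u ^+ 2 + v ^+ 2 -> x != 0 ->
    - ln (u ^+ 2 + v ^+ 2 + e) <= 4 * inv_sqrt_abs x.
  move=> xs x0; have x2 : 0 < x ^+ 2 by rewrite lt_neqAle eq_sym sqrf_eq0 x0 sqr_ge0.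
  apply: le_trans (neg_ln_sqr_le x0 _).
    by rewrite lerN2 ler_ln ?posrE//; lra.
  by rewrite -(ler_sqr (x := `|x|)) ?nnegrE// real_normK ?num_real// expr1n; lra.
have [u0|u0] := eqVneq u 0; last by have := key u; rewrite u0 lerDl => /(_ v2 isT); lra.
have [v0|v0] := eqVneq v 0; last by have := key v; rewrite v0 lerDr => /(_ u2 isT); lra.
by move: s0; rewrite u0 v0 expr0n addr0 eqxx.
Qed.

Let strip (c x : R) : R := if `|k * (x - c)| <= 1 then 1 else 0.

Let strip_ge0 c x : 0 <= strip c x. Proof. by rewrite /strip; case: ifP. Qed.

Let integrable_strip c : mu.-integrable setT (EFin \o strip c).
Proof.
have ki : 0 < k^-1 by rewrite invr_gt0.
have := @integrable_indic_itv R (c - k^-1) (c + k^-1) true false.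
apply: eq_integrable => // x _ /=; rewrite indicE /strip.
rewrite mem_setE in_itv/= -ler_distl normrM (gtr0_norm k_gt0) -ler_pdivlMl// mulr1.
by case: ifP.
Qed.

(** Each majorant is a product of functions of one coordinate. The singular factor can be translated
    along its own line, so the integrals of [h1 z] and [h2 z] do not depend on [z]. *)
Let h1 (z w : plane R) := inv_sqrt_abs (w.1 - z.1) * strip 0 w.2.
Let h2 (z w : plane R) := strip a w.1 * inv_sqrt_abs (w.2 - z.2).
Let h3 (w : plane R) := strip a w.1 * strip 0 w.2.

Let integrable_h1 z : dA.-integrable setT (EFin \o h1 z).
Proof.
apply/integrable_dA => //.
exact: (integrable_prod (integrable_inv_sqrt_abs z.1) (integrable_strip 0)).
Qed.

Let integrable_h2 z : dA.-integrable setT (EFin \o h2 z).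
Proof.
apply/integrable_dA => //.
exact: (integrable_prod (integrable_strip a) (integrable_inv_sqrt_abs z.2)).
Qed.

Let integrable_h3 : dA.-integrable setT (EFin \o h3).
Proof.
apply/integrable_dA => //.
exact: (integrable_prod (integrable_strip a) (integrable_strip 0)).
Qed.

Let measurable_inv_sqrt_abs_shift (c : R) :
  measurable_fun [set: R] (fun x => (inv_sqrt_abs (x - c))%:E).
Proof.
apply/measurable_EFinP; apply: measurableT_comp; first exact: measurable_inv_sqrt_abs.
exact: measurable_funB.
Qed.

Let integral_h1 z : \int[dA]_w h1 z w = \int[dA]_w h1 0 w.
Proof.
suff e : (\int[dA]_w (h1 z w)%:E = \int[dA]_w (h1 0 w)%:E)%E by rewrite /Rintegral e.
have mh z' : measurable_fun setT (EFin \o h1 z').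
  exact: measurable_int (integrable_h1 z').
have h0 z' w : (0 <= (h1 z' w)%:E)%E by rewrite lee_fin mulr_ge0 ?inv_sqrt_abs_ge0.
rewrite (ge0_integral_dA21 (mh z) (h0 z)) (ge0_integral_dA21 (mh 0) (h0 0)).
apply: (congr1 (mule (pi^-1)%:E)); apply: eq_integral => y _.
have ms : measurable_fun [set: R] (EFin \o @inv_sqrt_abs R).
  by apply/measurable_EFinP; exact: measurable_inv_sqrt_abs.
have q x : (0 <= (@inv_sqrt_abs R x)%:E)%E by rewrite lee_fin inv_sqrt_abs_ge0.
have key c : (\int[mu]_x (inv_sqrt_abs (x - c) * strip 0 y)%:E =
    (\int[mu]_x (inv_sqrt_abs x)%:E) * (strip 0 y)%:E)%E.
  rewrite -(ge0_integral_shift c ms q) -ge0_integralZr//= ?lee_fin//.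
  exact: measurable_inv_sqrt_abs_shift.
by rewrite /h1/= !key.
Qed.

Let integral_h2 z : \int[dA]_w h2 z w = \int[dA]_w h2 0 w.
Proof.
suff e : (\int[dA]_w (h2 z w)%:E = \int[dA]_w (h2 0 w)%:E)%E by rewrite /Rintegral e.
have mh z' : measurable_fun setT (EFin \o h2 z').
  exact: measurable_int (integrable_h2 z').
have h0 z' w : (0 <= (h2 z' w)%:E)%E by rewrite lee_fin mulr_ge0 ?inv_sqrt_abs_ge0.
rewrite (ge0_integral_dA12 (mh z) (h0 z)) (ge0_integral_dA12 (mh 0) (h0 0)).
apply: (congr1 (mule (pi^-1)%:E)); apply: eq_integral => x _.
have ms : measurable_fun [set: R] (EFin \o @inv_sqrt_abs R).
  by apply/measurable_EFinP; exact: measurable_inv_sqrt_abs.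
have q y : (0 <= (@inv_sqrt_abs R y)%:E)%E by rewrite lee_fin inv_sqrt_abs_ge0.
have key c : (\int[mu]_y (strip a x * inv_sqrt_abs (y - c))%:E =
    (strip a x)%:E * (\int[mu]_y (inv_sqrt_abs y)%:E))%E.
  rewrite -(ge0_integral_shift c ms q) -ge0_integralZl//= ?lee_fin//.
  exact: measurable_inv_sqrt_abs_shift.
by rewrite /h2/= !key.
Qed.

Let h3E w : h3 w = if inbox w then 1 else 0.
Proof.
rewrite /h3 /strip /inbox subr0.
by case: ifP => _ /=; rewrite ?mul0r// mul1r.
Qed.

Let inbox_strip w : inbox w -> strip a w.1 = 1 /\ strip 0 w.2 = 1.
Proof. by rewrite /inbox /strip subr0 => /andP[-> ->]. Qed.

Let M : R := sval (cid (@bump2_bounded R)).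
Let psiM z : `|psi z| <= k ^+ 2 / 2 * M.
Proof. by apply: psi_le => x; rewrite /M; case: cid => C /= HC; exact: HC. Qed.

Let P := k ^+ 2 / 2 * M.
Let P0 : 0 <= P. Proof. exact: le_trans (normr_ge0 _) (psiM 0). Qed.

Let W := sval (cid (@le_sqdist_box R a k k_gt0 0)).
Let sqdist_le w z : inbox w -> sqdist w z <= 2 * W + 2 * normsq z.
Proof.
rewrite /W; case: cid => S /= HS /HS; rewrite /sqdist !subr0 normsqE.
have h (x u : R) : (x - u) ^+ 2 <= 2 * x ^+ 2 + 2 * u ^+ 2.
  by have := sqr_ge0 (x + u); nra.
by have := h w.1 z.1; have := h w.2 z.2; lra.
Qed.

(** A common majorant of [ln (sqdist w z + e) * psi w] for all [e] in [[0, 1]]; its integral depends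
    on [z] only through the explicit term in [normsq z]. *)
Let dom z w := P * (4 * h1 z w + 4 * h2 z w + (2 * W + 2 * normsq z + 1) * h3 w).

Let integrable_dom z : dA.-integrable setT (EFin \o dom z).
Proof.
apply: RintegrableZl; apply: RintegrableD; last exact: RintegrableZl integrable_h3.
by apply: RintegrableD; apply: RintegrableZl; [exact: integrable_h1|exact: integrable_h2].
Qed.

Let integral_dom z : \int[dA]_w dom z w = P * (4 * \int[dA]_w h1 0 w +
  4 * \int[dA]_w h2 0 w + (2 * W + 2 * normsq z + 1) * \int[dA]_w h3 w).
Proof.
have i1 := RintegrableZl 4 (integrable_h1 z).
have i2 := RintegrableZl 4 (integrable_h2 z).
have i3 := RintegrableZl (2 * W + 2 * normsq z + 1) integrable_h3.
have i12 := RintegrableD i1 i2; have i := RintegrableD i12 i3.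
rewrite (RintegralZl _ measurableT i) (RintegralD measurableT i12 i3).
rewrite (RintegralD measurableT i1 i2) (RintegralZl _ measurableT (integrable_h1 z)).
rewrite (RintegralZl _ measurableT (integrable_h2 z)) (RintegralZl _ measurableT integrable_h3).
apply: (congr1 ( *%R P)); apply: (congr2 +%R _ erefl); apply: (congr2 +%R).
  by apply: (congr1 ( *%R 4)); exact: integral_h1.
by apply: (congr1 ( *%R 4)); exact: integral_h2.
Qed.

Let ln_psi_le (e : R) z w : 0 <= e <= 1 -> w != z ->
  `|ln (sqdist w z + e) * psi w| <= dom z w.
Proof.
move=> e01 wz; have [wb|wb] := boolP (inbox w); last first.
  rewrite psi_eq0// mulr0 normr0 /dom mulr_ge0 ?P0// h3E (negbTE wb) mulr0 addr0.
  by rewrite addr_ge0// mulr_ge0// mulr_ge0 ?inv_sqrt_abs_ge0.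
have s0 : (w.1 - z.1) ^+ 2 + (w.2 - z.2) ^+ 2 != 0.
  by apply: contra wz => /eqP /sqdist_eq0 ->.
rewrite normrM mulrC /dom ler_pM//.
apply: le_trans (norm_ln_sqr_le e01 s0) _.
rewrite /h1 /h2 h3E wb; have [-> ->] := inbox_strip wb.
rewrite !mulr1 mul1r lerD2l lerD2r; exact: sqdist_le.
Qed.

Lemma measurable_ln_psi e z : measurable_fun setT (fun w => ln (sqdist w z + e) * psi w).
Proof.
apply: measurable_funM; last exact: measurable_psi.
apply: (measurableT_comp (@measurable_ln R)).
by apply: measurable_funD => //; exact: measurable_sqdist.
Qed.

Let ln_psi_le0 z w : `|ln (sqdist w z) * psi w| <= dom z w.
Proof.
have [->|wz] := eqVneq w z.
  rewrite /sqdist !subrr expr0n addr0 ln0// mul0r normr0 mulr_ge0 ?P0//.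
  rewrite !addr_ge0// ?mulr_ge0 ?inv_sqrt_abs_ge0//.
  have W0 : 0 <= W.
    rewrite /W; case: cid => S /= HS; apply: le_trans (HS (a, 0) _).
      exact: sqdist_ge0.
    by rewrite /inbox/= subrr mulr0 normr0 ler01.
  by have := normsq_ge0 z; lra.
by have := @ln_psi_le 0 z w; rewrite addr0; apply; rewrite ?lexx ?ler01.
Qed.

Lemma integrable_ln_psi z : dA.-integrable setT (fun w => (ln (sqdist w z) * psi w)%:E).
Proof.
apply: (Rintegrable_le _ (ln_psi_le0 z) (integrable_dom z)).
by have := @measurable_ln_psi 0 z; under eq_fun do rewrite addr0.
Qed.

(** The growth in [z] is at most that of |z|^2, so the mutual energy of [psi] with a density of
    finite second moment converges absolutely. *)
Lemma integral_abs_ln_psi_le : exists2 C, 0 <= C & forall z,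
  (\int[dA]_w `|(ln (sqdist w z) * psi w)%:E| <= (C * (1 + normsq z))%:E)%E.
Proof.
pose c1 := \int[dA]_w h1 0 w; pose c2 := \int[dA]_w h2 0 w; pose c3 := \int[dA]_w h3 w.
exists (P * (4 * `|c1| + 4 * `|c2| + (2 * `|W| + 2) * `|c3|)).
  by rewrite mulr_ge0 ?P0// !addr_ge0// ?mulr_ge0 ?addr_ge0// mulr_ge0.
move=> z; apply: (@le_trans _ _ (\int[dA]_w (dom z w)%:E)%E).
  apply: ge0_le_integral => //.
  - apply: (measurableT_comp (@abse_measurable R setT)).
    exact: measurable_int (integrable_ln_psi z).
  - exact: measurable_int (integrable_dom z).
  - by move=> w _; rewrite lee_fin; exact: ln_psi_le0.
rewrite -[leLHS]fineK; last exact: integrable_fin_num (integrable_dom z).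
rewrite lee_fin; have -> : fine (\int[dA]_w (dom z w)%:E) = _ := integral_dom z.
rewrite -[leRHS]mulrA ler_wpM2l//.
have n0 := normsq_ge0 z; rewrite -/c1 -/c2 -/c3.
have hA : (2 * W + 2 * normsq z + 1) * c3 <= (2 * `|W| + 2 * normsq z + 1) * `|c3|.
  apply: le_trans (ler_norm _) _; rewrite normrM ler_wpM2r//.
  have := ler_norm W; have := ler_norm (- W); rewrite normrN => ? ?.
  by rewrite ler_norml; lra.
have := ler_norm c1; have := ler_norm c2.
have := normr_ge0 c1; have := normr_ge0 c2; have := normr_ge0 c3; have := normr_ge0 W.
move: `|c1| `|c2| `|c3| `|W| (normsq z) n0 hA => d1 d2 d3 D n n0 hA D0 d30 d20 d10 h2' h1'.
have : (2 * D + 2 * n + 1) * d3 <= (2 * D + 2) * d3 * (1 + n).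
  have : 0 <= D * d3 * n by rewrite !mulr_ge0.
  have : 0 <= d3 * n by rewrite mulr_ge0.
  nra.
have : c1 <= d1 * (1 + n) by have : 0 <= d1 * n; [rewrite mulr_ge0|lra].
have : c2 <= d2 * (1 + n) by have : 0 <= d2 * n; [rewrite mulr_ge0|lra].
lra.
Qed.

Let kernel (e : R) w z := e / (sqdist w z + e) ^+ 2.

Let den_gt0 (e : R) w z : 0 < e -> 0 < sqdist w z + e.
Proof. by move=> e0; rewrite ltr_wpDl ?sqdist_ge0. Qed.

Let kernel_ge0 (e : R) w z : 0 < e -> 0 <= kernel e w z.
Proof. by move=> e0; rewrite divr_ge0 ?exprn_ge0 ?(ltW (den_gt0 _ _ e0)) ?ltW. Qed.

Let integrable_kernel (e : R) z : 0 < e ->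
  dA.-integrable setT (fun w => (kernel e w z)%:E).
Proof.
move=> e0; apply/integrableP; split.
  apply/measurable_EFinP; apply: measurable_funM => //.
  apply: (measurableT_comp measurable_invr); apply: measurable_funX.
  by apply: measurable_funD => //; exact: measurable_sqdist.
under eq_integral do rewrite gee0_abs ?lee_fin ?kernel_ge0//.
by rewrite integral_poisson_kernel// ltry.
Qed.

Let integral_kernel (e : R) z : 0 < e -> \int[dA]_w kernel e w z = 1.
Proof. by move=> e0; rewrite /Rintegral integral_poisson_kernel. Qed.

(** Take F(s) = ln (s + e) in [laplacian_by_parts]: then s F'' + F' = e / (s + e)^2. *)
Lemma ln_psi_regularized (e : R) z : 0 < e ->
  \int[dA]_w (ln (sqdist w z + e) * psi w) = \int[dA]_w (kernel e w z * phi w).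
Proof.
move=> e0.
have p (s : R) : 0 <= s -> 0 < s + e by move=> s0; rewrite ltr_wpDl.
have d (s : R) : is_derive s 1 (fun s => s + e) (1 + 0).
  exact: (pderiveD (pderive_id s) (pderive_cst e s)).
have mD : measurable_fun [set: R] (fun s : R => s + e) by exact: measurable_funD.
have mV : measurable_fun [set: R] (fun s : R => (s + e)^-1).
  exact: (measurableT_comp measurable_invr).
have mL : measurable_fun [set: R] (fun s : R => ln (s + e)).
  exact: (measurableT_comp (@measurable_ln R)).
have mV2 : measurable_fun [set: R] (fun s : R => - (s + e) ^- 2).
  apply: (measurableT_comp (@oppr_measurable R setT)).
  by apply: (measurableT_comp measurable_invr); exact: measurable_funX.
have d1 (s : R) : 0 <= s -> is_derive s 1 (fun s : R => ln (s + e)) (s + e)^-1.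
  by move=> s0; have := pderive_ln (d s) (p _ s0); rewrite addr0 mul1r.
have d2 (s : R) : 0 <= s -> is_derive s 1 (fun s : R => (s + e)^-1) (- (s + e) ^- 2).
  by move=> s0; have := pderiveV (d s) (lt0r_neq0 (p _ s0)); rewrite addr0 mulr1.
have c2 (s : R) : 0 <= s -> {for s, continuous (fun s : R => - (s + e) ^- 2)}.
  move=> s0; apply: cvgN.
  exact: is_derive_cvg (pderiveV (pderiveX 2 (d s)) (expf_neq0 2 (lt0r_neq0 (p _ s0)))).
have -> := @laplacian_by_parts R a k k_gt0 _ _ _ z mL mV mV2 d1 d2 c2.
apply: eq_Rintegral => w _; congr (_ * _); rewrite /kernel; field.
by rewrite gt_eqF// p ?sqdist_ge0.
Qed.

Let bump0_near (x0 e : R) : 0 < e -> exists2 r, 0 < r &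
  forall x, `|x0 - x| < r -> `|bump0 (k * x0) - bump0 (k * x)| <= e.
Proof.
move=> e0; have c : continuous (fun x : R => bump0 (k * x)).
  move=> x; apply: (@cvg_comp _ _ _ (fun x => k * x) bump0).
    exact: is_derive_cvg (pderiveM (pderive_cst k x) (pderive_id x)).
  exact: continuous_bump0.
have /cvgrPdist_le/(_ e e0) := c x0.
by move=> /nbhs_ballP[r r0 h]; exists r => // x xr; exact: h.
Qed.

Let phi_near z (e : R) : 0 < e -> exists2 r, 0 < r &
  forall w, sqdist w z < r -> `|phi w - phi z| <= e.
Proof.
move=> e0; have e2 : 0 < e / 2 by rewrite divr_gt0.
have [r1 r10 H1] := bump0_near (z.1 - a) e2; have [r2 r20 H2] := bump0_near z.2 e2.
exists (Num.min (r1 ^+ 2) (r2 ^+ 2)).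
  by rewrite lt_min !exprn_gt0.
move=> w; rewrite lt_min => /andP[h1' h2'].
have g1 : `|(z.1 - a) - (w.1 - a)| < r1.
  rewrite -ltr_sqr ?nnegrE ?(ltW r10)// real_normK ?num_real//.
  apply: le_lt_trans h1'; rewrite /sqdist opprB addrA subrK -sqrrN opprB lerDl.
  exact: sqr_ge0.
have g2 : `|z.2 - w.2| < r2.
  rewrite -ltr_sqr ?nnegrE ?(ltW r20)// real_normK ?num_real//.
  by apply: le_lt_trans h2'; rewrite /sqdist -sqrrN opprB lerDr sqr_ge0.
have {g1 H1} := H1 _ g1; have {g2 H2} := H2 _ g2; rewrite /phi.
have := bump0_ge0 (k * z.2); have := bump0_le1 (k * z.2).
have := bump0_ge0 (k * (w.1 - a)); have := bump0_le1 (k * (w.1 - a)).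
move: (bump0 _) (bump0 _) (bump0 _) (bump0 _) => x1 y0 x0 y1 p1 p2 p3 p4.
rewrite !ler_norml => /andP[? ?] /andP[? ?]; apply/andP; split; nra.
Qed.

(** The kernels are an approximate identity. Where [sqdist w z >= r], the kernel with parameter [t]
    is at most [t * c] times the kernel with parameter [1], [c = ((1 + r) / r) ^+ 2]; as the latter
    has mass [1], the mass away from [z] is at most [t * c]. *)
Let kernel_phi_cvg z :
  \int[dA]_w (kernel n.+1%:R^-1 w z * phi w) @[n --> \oo] --> phi z.
Proof.
apply/cvgrPdistC_le => e e0.
have e2 : 0 < e / 2 by rewrite divr_gt0.
have [r r0 Hr] := phi_near z e2.
pose c := ((1 + r) / r) ^+ 2.
have c0 : 0 < c by rewrite exprn_gt0// divr_gt0//; lra.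
near=> n.
have n0 : 0 < n.+1%:R^-1 :> R by rewrite invr_gt0.
set t := n.+1%:R^-1 in n0 *.
have ti := integrable_kernel z n0.
have t1 : t * c <= e / 2.
  rewrite /t mulrC ler_pdivrMr ?ltr0n//.
  rewrite -ler_pdivrMl//; near: n.
  have := @nbhs_infty_ger R ((e / 2)^-1 * c); apply: filterS => n h.
  by apply: le_trans h _; rewrite ler_nat.
have kphi : dA.-integrable setT (fun w => (kernel t w z * phi w)%:E).
  apply: (Rintegrable_le _ _ ti).
    by apply: measurable_funM; [exact: Rintegrable_measurable ti|exact: measurable_phi].
  move=> w; rewrite normrM (ger0_norm (kernel_ge0 _ _ n0)) ler_piMr ?kernel_ge0//.
  by rewrite ger0_norm ?phi_ge0// phi_le1.
have kphiz := RintegrableZr (phi z) ti.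
rewrite -[X in _ - X]mul1r -(integral_kernel z n0) -RintegralZr//.
rewrite -(RintegralB measurableT kphi kphiz).
have kB := RintegrableB kphi kphiz.
apply: (le_trans (le_normr_Rintegral measurableT kB)).
have i1 := integrable_kernel z (@ltr01 R).
have b1 := RintegrableZl (e / 2) ti; have b2 := RintegrableZl (t * c) i1.
apply: (@le_trans _ _ (\int[dA]_w (e / 2 * kernel t w z + t * c * kernel 1 w z))).
  apply: (le_Rintegral measurableT (Rintegrable_norm kB) (RintegrableD b1 b2)).
  move=> w _; rewrite -mulrBr normrM (ger0_norm (kernel_ge0 _ _ n0)).
  have k1 := kernel_ge0 w z (@ltr01 R); have kt := kernel_ge0 w z n0.
  have [sr|sr] := ltP (sqdist w z) r.
    have := ler_wpM2l kt (Hr _ sr).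
    have : 0 <= t * c * kernel 1 w z by apply: mulr_ge0 => //; apply: mulr_ge0; exact: ltW.
    lra.
  have : 0 <= e / 2 * kernel t w z by apply: mulr_ge0 => //; exact: ltW.
  suff : kernel t w z * `|phi w - phi z| <= t * c * kernel 1 w z by lra.
  apply: (@le_trans _ _ (kernel t w z)).
    rewrite ler_piMr//.
    have := phi_ge0 a k z; have := phi_ge0 a k w; have := phi_le1 a k z.
    by have := phi_le1 a k w; rewrite ler_norml; lra.
  have st := den_gt0 w z n0; have s1 := den_gt0 w z (@ltr01 R).
  have q : sqdist w z + 1 <= (1 + r) / r * (sqdist w z + t).
    by rewrite mulrAC ler_pdivlMr//; nra.
  rewrite /kernel mul1r -[leRHS]mulrA ler_wpM2l ?(ltW n0)//.
  rewrite ler_pdivlMr ?exprn_gt0// mulrC ler_pdivrMr ?exprn_gt0// /c -exprMn.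
  by rewrite ler_sqr ?nnegrE ?(ltW s1)// (le_trans (ltW s1) q).
rewrite (RintegralD measurableT b1 b2) (RintegralZl _ measurableT ti).
rewrite (RintegralZl _ measurableT i1) !integral_kernel// !mulr1.
lra.
Unshelve. all: by end_near. Qed.

(* Green's formula: [ln |w - z|^2] is a fundamental solution of d dbar. *)
Lemma integral_ln_psi z : \int[dA]_w (ln (sqdist w z) * psi w) = phi z.
Proof.
pose f_ n w := (ln (sqdist w z + n.+1%:R^-1) * psi w)%:E.
pose f w := (ln (sqdist w z) * psi w)%:E.
have mf : measurable_fun setT f by exact: measurable_int (integrable_ln_psi z).
have mf_ n : measurable_fun setT (f_ n).
  by apply/measurable_EFinP; exact: measurable_ln_psi.
(* At [w = z] the convergence can fail, since [ln 0 = 0] while the regularised logarithms tend to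
   minus infinity; this one point is negligible. *)
have az (P' : plane R -> Prop) : (forall w, w != z -> P' w) -> {ae dA, forall w, P' w}.
  move=> h; exists [set z]; split; [exact: measurable_plane_set1|exact: dA_set1|].
  by move=> w /= Pw; apply: contrapT => /eqP /h.
have n1 n : 0 < n.+1%:R^-1 :> R by rewrite invr_gt0.
have f_f : {ae dA, forall w, setT w -> f_ ^~ w @ \oo --> f w}.
  apply: az => w wz _; apply: cvg_EFin; first by near=> n.
  apply: cvgMl.
  have s0 : 0 < sqdist w z.
    by rewrite lt_neqAle sqdist_ge0 andbT eq_sym; apply: contra wz => /eqP/sqdist_eq0 ->.
  have c : sqdist w z + n.+1%:R^-1 @[n --> \oo] --> sqdist w z.
    by rewrite -[X in _ --> X]addr0; apply: cvgD; [exact: cvg_cst|exact: cvg_harmonic].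
  apply: (cvg_comp _ _ c).
  exact: continuous_ln.
have f_g : {ae dA, forall w n, setT w -> `|f_ n w| <= (dom z w)%:E}%E.
  apply: az => w wz n _; rewrite lee_fin; apply: ln_psi_le => //.
  by rewrite (ltW (n1 n)) invf_le1 ?ltr0n// ler1n.
have [_ _ h] := @dominated_convergence _ _ R dA setT measurableT f_ f _ mf_ mf f_f
  (integrable_dom z) f_g.
have {}h : \int[dA]_w (ln (sqdist w z + n.+1%:R^-1) * psi w) @[n --> \oo] -->
    \int[dA]_w (ln (sqdist w z) * psi w).
  by apply: fine_cvg; rewrite fineK//; exact: integrable_fin_num (integrable_ln_psi z).
have hk := @kernel_phi_cvg z.
have e : (fun n => \int[dA]_w (ln (sqdist w z + n.+1%:R^-1) * psi w)) =
    (fun n => \int[dA]_w (kernel n.+1%:R^-1 w z * phi w)).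
  by apply/funext => n; rewrite ln_psi_regularized.
rewrite e in h.
by rewrite -(cvg_lim (@Rhausdorff R) h) (cvg_lim (@Rhausdorff R) hk).
Unshelve. all: by end_near. Qed.

End green.

(** * First variation of the free energy *)

Section smoothness.
Context {R : realType}.
Implicit Types (f g : plane R -> R) (v z : plane R).

(* An explicit algebra of functions closed under all directional derivatives. *)
Inductive flat_algebra : (plane R -> R) -> Prop :=
| flat_algebra_cst c : flat_algebra (fun=> c)
| flat_algebra_x P c d : flat_algebra (fun z => flat P (c + d * z.1))
| flat_algebra_y P c d : flat_algebra (fun z => flat P (c + d * z.2))
| flat_algebraD f g : flat_algebra f -> flat_algebra g ->
    flat_algebra (fun z => f z + g z)
| flat_algebraM f g : flat_algebra f -> flat_algebra g ->
    flat_algebra (fun z => f z * g z).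

Let differentiable_flat_comp P c d (l : {linear plane R -> R}) z : continuous l ->
  differentiable (fun z => flat P (c + d * l z)) z.
Proof.
move=> cl.
apply: (@differentiable_comp R (plane R) R R (fun z => c + d * l z) (flat P)).
  apply: differentiableD; first exact: differentiable_cst.
  by apply: (@differentiableZ _ _ _ l); exact: linear_differentiable.
by apply/derivable1_diffP; case: (is_derive_flat P (c + d * l z)).
Qed.

Let derive_flat_comp P c d (l : {linear plane R -> R}) z v : continuous l ->
  'D_v (fun z => flat P (c + d * l z)) z = d * l v * flat (flat_deriv P) (c + d * l z).
Proof.
move=> cl; have df := differentiable_flat_comp P c d z cl.
have dl (h : R) : is_derive h 1 (fun h => c + d * (h * l v + l z)) (d * l v).
  apply: (is_derive_eq (pderiveD (pderive_cst c h) (pderiveM (pderive_cst d h)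
   (pderiveD (pderiveM (pderive_id h) (pderive_cst (l v) h)) (pderive_cst (l z) h))))).
  by ring.
have D := pderive_comp (dl 0) (is_derive_flat P (c + d * (0 * l v + l z))).
have := @derive_val _ _ _ _ _ _ _ D.
rewrite mul0r add0r => <-.
rewrite /derive; set g1 := fun h => h^-1 *: _; set g2 := fun h => h^-1 *: _.
suff -> : g1 = g2 by [].
apply/funext => h; rewrite /g1 /g2 /=.
by rewrite (linearP l) mul0r add0r addr0 /GRing.scale/= mulr1.
Qed.

Lemma flat_algebra_derive f : flat_algebra f ->
  (forall z, differentiable f z) /\ forall v, flat_algebra ('D_v f).
Proof.
have cfst : continuous (@fst (measurableTypeR R) (measurableTypeR R) : plane R -> R).
  by move=> z; exact: cvg_fst.
have csnd : continuous (@snd (measurableTypeR R) (measurableTypeR R) : plane R -> R).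
  by move=> z; exact: cvg_snd.
elim=> [c|P c d|P c d|{}f g fa [df Df] ga [dg Dg]|{}f g fa [df Df] ga [dg Dg]].
- split=> [z|v]; first exact: differentiable_cst.
  have -> : 'D_v (fun=> c) = (fun=> 0) :> (plane R -> R).
    by apply/funext => z; exact: derive_cst.
  exact: flat_algebra_cst.
- split=> [z|v]; first exact: (differentiable_flat_comp P c d z cfst).
  have -> : 'D_v (fun z : plane R => flat P (c + d * z.1)) =
      fun z => d * v.1 * flat (flat_deriv P) (c + d * z.1).
    by apply/funext => z; exact: (derive_flat_comp P c d z v cfst).
  by apply: flat_algebraM; constructor.
- split=> [z|v]; first exact: (differentiable_flat_comp P c d z csnd).
  have -> : 'D_v (fun z : plane R => flat P (c + d * z.2)) =
      fun z => d * v.2 * flat (flat_deriv P) (c + d * z.2).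
    by apply/funext => z; exact: (derive_flat_comp P c d z v csnd).
  by apply: flat_algebraM; constructor.
- split=> [z|v]; first exact: differentiableD.
  have -> : 'D_v (fun z => f z + g z) = (fun z => 'D_v f z + 'D_v g z).
    by apply/funext => z; apply: deriveD; exact: diff_derivable.
  exact: flat_algebraD.
- split=> [z|v]; first exact: differentiableM.
  have -> : 'D_v (fun z => f z * g z) = (fun z => f z * 'D_v g z + g z * 'D_v f z).
    by apply/funext => z; apply: deriveM; exact: diff_derivable.
  by apply: flat_algebraD; apply: flat_algebraM.
Qed.

Lemma smooth_flat_algebra f : flat_algebra f -> smooth f.
Proof.
move=> fa vs z; suff /flat_algebra_derive[] :
  flat_algebra (foldr (fun v g => 'D_v g) f vs) by [].
by elim: vs => //= v vs /flat_algebra_derive[].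
Qed.

Lemma smoothDZ f g t : smooth f -> smooth g -> smooth (fun z => f z + t * g z).
Proof.
move=> sf sg vs.
set F := foldr (fun v h => 'D_v h) f vs; set G := foldr (fun v h => 'D_v h) g vs.
have -> : foldr (fun v h => 'D_v h) (fun z => f z + t * g z) vs =
    (fun z => F z + t * G z).
  rewrite {}/F {}/G; elim: vs => [//|v vs /= ->]; apply/funext => z.
  set F := foldr _ f vs; set G := foldr _ g vs.
  have dF : derivable F z v by exact: diff_derivable (sf vs z).
  have dG : derivable G z v by exact: diff_derivable (sg vs z).
  have dtG : derivable (t \*: G) z v by exact: derivableZ.
  by rewrite (deriveD dF dtG) (deriveZ t dG).
move=> z; apply: (@differentiableD _ _ _ F (fun z => t * G z)); first exact: (sf vs z).
exact: (@differentiableZ _ _ _ G t z (sg vs z)).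
Qed.

Lemma smooth_psi a k : smooth (psi a k : plane R -> R).
Proof.
apply: smooth_flat_algebra.
have bx P Q : flat_algebra (fun z => bump P Q (k * (z.1 - a))).
  apply: flat_algebraM.
  - have := flat_algebra_x P (1 - k * a) k; congr flat_algebra; apply/funext => z.
    by congr (flat P _); ring.
  - have := flat_algebra_x Q (1 + k * a) (- k); congr flat_algebra; apply/funext => z.
    by congr (flat Q _); ring.
have by_ P Q : flat_algebra (fun z => bump P Q (k * z.2)).
  apply: flat_algebraM; first exact: flat_algebra_y.
  have := flat_algebra_y Q 1 (- k); congr flat_algebra; apply/funext => z.
  by congr (flat Q _); ring.
have neg f : flat_algebra f -> flat_algebra (fun z => - f z).
  move=> fa; have := flat_algebraM (flat_algebra_cst (-1)) fa; congr flat_algebra.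
  by apply/funext => z; rewrite mulN1r.
have bump2x : flat_algebra (fun z => bump2 (k * (z.1 - a))).
  apply: flat_algebraD (bx _ _); apply: flat_algebraD (bx _ _) (neg _ _).
  by have := flat_algebraD (bx (flat_deriv 1) (flat_deriv 1)) (bx (flat_deriv 1) (flat_deriv 1)).
have bump2y : flat_algebra (fun z => bump2 (k * z.2)).
  apply: flat_algebraD (by_ _ _); apply: flat_algebraD (by_ _ _) (neg _ _).
  by have := flat_algebraD (by_ (flat_deriv 1) (flat_deriv 1)) (by_ (flat_deriv 1) (flat_deriv 1)).
apply: flat_algebraM; first exact: flat_algebra_cst.
by apply: flat_algebraD; apply: flat_algebraM => //; [exact: by_|exact: bx].
Qed.

End smoothness.

(** * Mutual logarithmic energy of a density and the test direction *)

Section logarithmic_energy.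
Context {R : realType}.
Variables (a k : R).
Hypothesis k_gt0 : 0 < k.
Implicit Types (f g : plane R -> R) (z w : plane R).
Local Notation phi := (phi a k).
Local Notation psi := (psi a k).

(** On the diagonal both sides are [0] by the conventions for [0^-1] and [ln 0], so no point has to
    be excluded. *)
Lemma ln_inv_cabsE z w : ln (cabs (z - w))^-1 = - (2^-1 * ln (sqdist w z)).
Proof.
have -> : cabs (z - w) = Num.sqrt (sqdist w z) by rewrite sqdistC.
have [s0|s0] := eqVneq (sqdist w z) 0; first by rewrite s0 sqrtr0 invr0 ln0// mulr0 oppr0.
have sp : 0 < sqdist w z by rewrite lt_neqAle eq_sym s0 sqdist_ge0.
have qp : 0 < Num.sqrt (sqdist w z) by rewrite sqrtr_gt0.
rewrite lnV ?posrE//; congr (- _).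
have -> : ln (sqdist w z) = 2 * ln (Num.sqrt (sqdist w z)).
  by rewrite mulr_natl -lnXn// sqr_sqrtr// ltW.
by rewrite mulKf.
Qed.

Lemma measurable_pair_sqdist :
  measurable_fun setT (fun p : plane R * plane R => sqdist p.2 p.1).
Proof.
apply: measurable_funD; apply: measurable_funX; apply: measurable_funB.
- exact: (measurableT_comp measurable_fst measurable_snd).
- exact: (measurableT_comp measurable_fst measurable_fst).
- exact: (measurableT_comp measurable_snd measurable_snd).
- exact: (measurableT_comp measurable_snd measurable_fst).
Qed.

(** The polarisation of [log_energy_density], which is recovered for [f = g]. *)
Definition cross_energy f g (p : plane R * plane R) : R :=
  ln (cabs (p.1 - p.2))^-1 * f p.1 * g p.2.

Lemma measurable_cross_energy f g : measurable_fun setT f -> measurable_fun setT g ->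
  measurable_fun setT (cross_energy f g).
Proof.
move=> mf mg; apply: measurable_funM; last exact: (measurableT_comp mg measurable_snd).
apply: measurable_funM; last exact: (measurableT_comp mf measurable_fst).
under eq_fun do rewrite ln_inv_cabsE.
apply: (measurableT_comp (@oppr_measurable R setT)); apply: measurable_funM => //.
exact: (measurableT_comp (@measurable_ln R) measurable_pair_sqdist).
Qed.

Lemma cross_energyC f g z w : cross_energy f g (z, w) = cross_energy g f (w, z).
Proof. by rewrite /cross_energy/= !ln_inv_cabsE sqdistC mulrAC. Qed.

Let finite_iterated g : dA.-integrable setT (fun z => (g z)%:E) ->
    dA.-integrable setT (fun z => (normsq z * g z)%:E) ->
  (\int[dA]_z \int[dA]_w `|(cross_energy g psi (z, w))%:E| < +oo)%E.
Proof.
move=> gi qgi; have mg := Rintegrable_measurable gi.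
have [C C0 HC] := integral_abs_ln_psi_le a k_gt0.
have bi : dA.-integrable setT (fun z => (C * (`|g z| + `|normsq z * g z|))%:E).
  by apply: RintegrableZl; apply: RintegrableD; exact: Rintegrable_norm.
apply: (@le_lt_trans _ _ (\int[dA]_z (C * (`|g z| + `|normsq z * g z|))%:E)%E);
  last exact: integrable_lty bi.
have mc := measurable_cross_energy mg (measurable_psi a k).
apply: ge0_le_integral => //.
- by move=> z _; exact: integral_ge0.
- apply: (@measurable_fun_fubini_tonelli_F _ _ _ _ R dA
     (fun p => `|(cross_energy g psi p)%:E|%E)) => //.
  apply: (measurableT_comp (@abse_measurable R setT)).
  exact/measurable_EFinP.
- exact: measurable_int bi.
- move=> z _.
  have -> : (\int[dA]_w `|(cross_energy g psi (z, w))%:E| =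
      (2^-1 * `|g z|)%:E * \int[dA]_w `|(ln (sqdist w z) * psi w)%:E|)%E.
    rewrite -ge0_integralZl//=.
    + apply: eq_integral => w _; rewrite -EFinM; congr EFin.
      rewrite /cross_energy/= ln_inv_cabsE !normrM normrN normrM (ger0_norm (x := 2^-1))//.
      ring.
    + apply/measurable_EFinP; apply: (measurableT_comp (@normr_measurable R setT)).
      exact: (Rintegrable_measurable (integrable_ln_psi a k_gt0 z)).
  apply: (@le_trans _ _ ((2^-1 * `|g z|)%:E * (C * (1 + normsq z))%:E)%E).
    by rewrite lee_wpmul2l// lee_fin mulr_ge0.
  rewrite -EFinM lee_fin normrM (ger0_norm (normsq_ge0 z)).
  have n0 := normsq_ge0 z; have g0 := normr_ge0 (g z).
  have h1 : 0 <= C * `|g z| by rewrite mulr_ge0.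
  have h2 : 0 <= C * `|g z| * normsq z by rewrite mulr_ge0.
  lra.
Qed.

Section cross.
Variable g : plane R -> R.
Hypothesis gi : dA.-integrable setT (fun z => (g z)%:E).
Hypothesis qgi : dA.-integrable setT (fun z => (normsq z * g z)%:E).

Let mg := Rintegrable_measurable gi.

Lemma integrable_cross_energyl :
  (dA \x dA)%E.-integrable setT (fun p => (cross_energy g psi p)%:E).
Proof.
apply/integrable12ltyP; last exact: finite_iterated.
by apply/measurable_EFinP; apply: measurable_cross_energy => //; exact: measurable_psi.
Qed.

Lemma integrable_cross_energyr :
  (dA \x dA)%E.-integrable setT (fun p => (cross_energy psi g p)%:E).
Proof.
apply/integrable21ltyP.
  by apply/measurable_EFinP; apply: measurable_cross_energy => //; exact: measurable_psi.
apply: le_lt_trans (finite_iterated gi qgi); rewrite le_eqVlt; apply/orP; left.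
apply/eqP; apply: eq_integral => w _; apply: eq_integral => z _.
by rewrite cross_energyC.
Qed.

Let inner z :
  (\int[dA]_w (cross_energy g psi (z, w))%:E = (- 2^-1 * (g z * phi z))%:E)%E.
Proof.
have i := integrable_ln_psi a k_gt0 z.
transitivity (\int[dA]_w ((- 2^-1 * g z) * (ln (sqdist w z) * psi w))%:E)%E.
  apply: eq_integral => w _; congr EFin; rewrite /cross_energy/= ln_inv_cabsE; ring.
have j := RintegrableZl (- 2^-1 * g z) i.
rewrite -[LHS](fineK (integrable_fin_num measurableT j)); congr EFin.
have -> : fine (\int[dA]_w ((- 2^-1 * g z) * (ln (sqdist w z) * psi w))%:E)%E =
  _ := RintegralZl _ measurableT i.
rewrite [RHS]mulrA; apply: (congr1 ( *%R _)); exact: integral_ln_psi.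
Qed.

(** Integrating first in the variable of [psi], Green's formula gives the potential: the kernel is
    minus one half of ln |z - w|^2, so the potential of [psi] is [- phi / 2]. *)
Lemma integral_cross_energyl :
  \int[(dA \x dA)%E]_p cross_energy g psi p = - 2^-1 * \int[dA]_z (g z * phi z).
Proof.
have gphi : dA.-integrable setT (fun z => (g z * phi z)%:E).
  apply: (Rintegrable_le _ _ (Rintegrable_norm gi)).
    by apply: measurable_funM => //; exact: measurable_phi.
  by move=> z; rewrite normrM ler_piMr// ger0_norm ?phi_ge0// phi_le1.
rewrite -(RintegralZl _ measurableT gphi) /Rintegral; apply: (congr1 fine).
rewrite -(integral12_prod_meas1 integrable_cross_energyl).
by apply: eq_integral => z _; exact: inner.
Qed.

Lemma integral_cross_energyr :
  \int[(dA \x dA)%E]_p cross_energy psi g p = - 2^-1 * \int[dA]_z (g z * phi z).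
Proof.
rewrite -integral_cross_energyl /Rintegral; apply: (congr1 fine).
rewrite -(integral12_prod_meas1 integrable_cross_energyl).
rewrite -(integral21_prod_meas1 integrable_cross_energyr).
apply: eq_integral => w _; apply: eq_integral => z _; congr EFin.
exact: cross_energyC.
Qed.

End cross.
End logarithmic_energy.

(** For the chosen [t] the quadratic term is at most half of [t * |L|], so a nonzero [L] would make
    the expression negative at [t] or at [- t]. *)
Lemma linear_coef_eq0 (R : realType) (t0 L M : R) : 0 < t0 ->
  (forall t, `|t| <= t0 -> 0 <= t * L + t ^+ 2 * M) -> L = 0.
Proof.
move=> t00 h; apply/eqP; rewrite -normr_le0 leNgt; apply/negP => L0.
have N0 : 0 < `|M| + 1 by rewrite ltr_wpDl.
pose t := Num.min t0 (`|L| / (2 * (`|M| + 1))).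
have tp : 0 < t by rewrite lt_min t00 divr_gt0// mulr_gt0.
have tt : t <= t0 by rewrite ge_min lexx.
have tM : t * (`|M| + 1) <= `|L| / 2.
  apply: (@le_trans _ _ (`|L| / (2 * (`|M| + 1)) * (`|M| + 1))).
    by rewrite ler_wpM2r ?(ltW N0)// ge_min lexx orbT.
  by rewrite le_eqVlt; apply/orP; left; apply/eqP; field; rewrite gt_eqF.
have hM := ler_norm M.
have h1 := h t; rewrite (ger0_norm (ltW tp)) in h1; have {h1} := h1 tt.
have h2 := h (- t); rewrite normrN (ger0_norm (ltW tp)) in h2; have {h2} := h2 tt.
have : t ^+ 2 * M <= t * (`|L| / 2).
  rewrite expr2 -mulrA ler_wpM2l ?(ltW tp)//; apply: le_trans tM.
  by rewrite ler_wpM2l ?(ltW tp)//; lra.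
have : 0 < t * `|L| by rewrite mulr_gt0.
rewrite sqrrN; have [L1|L1] := ger0P L; lra.
Qed.

Section first_variation.
Context {R : realType}.
Variables (a k : R).
Hypothesis k_gt0 : 0 < k.
Local Notation phi := (phi a k).
Local Notation psi := (psi a k).
Local Notation inbox := (inbox a k).
Implicit Types (z w : plane R).

Let sqdist0 z : sqdist z 0 = normsq z.
Proof. by rewrite normsqE /sqdist !subr0. Qed.

Let measurable_cst_fun (c : R) : measurable_fun [set: R] (fun=> c).
Proof. exact: measurable_cst. Qed.

(** The case F = 1 of [laplacian_by_parts]; it makes the perturbation preserve total mass. *)
Lemma integral_psi : \int[dA]_z psi z = 0.
Proof.
have h := @laplacian_by_parts R a k k_gt0 (fun=> 1) (fun=> 0) (fun=> 0) 0
  (measurable_cst_fun 1) (measurable_cst_fun 0) (measurable_cst_fun 0)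
  (fun s _ => pderive_cst 1 s) (fun s _ => pderive_cst 0 s) (fun s _ => @cvg_cst _ _ _ _ _).
transitivity (\int[dA]_z (1 * psi z)); first by apply: eq_Rintegral => z _; rewrite mul1r.
rewrite h; transitivity (\int[dA]_(z in [set: plane R]) (0 : R)).
  by apply: eq_Rintegral => z _; rewrite mulr0 addr0 mul0r.
by rewrite Rintegral_cst// mul0r.
Qed.

(** The case F(s) = s: the potential satisfies d dbar |z|^2 = 1, which produces the background
    density 1. *)
Lemma integral_normsq_psi : \int[dA]_z (normsq z * psi z) = \int[dA]_z phi z.
Proof.
have h := @laplacian_by_parts R a k k_gt0 (fun s => s) (fun=> 1) (fun=> 0) 0
  (@measurable_id _ _ _) (measurable_cst_fun 1) (measurable_cst_fun 0)
  (fun s _ => pderive_id s) (fun s _ => pderive_cst 1 s) (fun s _ => @cvg_cst _ _ _ _ _).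
transitivity (\int[dA]_z (sqdist z 0 * psi z)).
  by apply: eq_Rintegral => z _; rewrite sqdist0.
by rewrite h; apply: eq_Rintegral => z _; rewrite mulr0 add0r mul1r.
Qed.

Variables (n : nat) (delta : plane R -> R) (m C : R).
Hypothesis delta_min : is_thermal_equilibrium (@normsq R) 1 n delta.
Hypothesis m_gt0 : 0 < m.
Hypothesis delta_box : forall z, inbox z -> m <= delta z <= C.

Let d_ge0 z : 0 <= delta z.
Proof. by have [[_ h _ _] _] := delta_min. Qed.

Let qd_int : dA.-integrable setT (fun z => (normsq z * delta z)%:E).
Proof. by have [[_ _ _ [_ h _]] _] := delta_min. Qed.

(* Finiteness of the second moment makes [delta] measurable away from 0. *)
Lemma thermal_measurable : measurable_fun setT delta.
Proof.
have mi : measurable_fun [set: plane R] (fun z => (normsq z * delta z) * (normsq z)^-1).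
  apply: measurable_funM; first exact: Rintegrable_measurable qd_int.
  exact: (measurableT_comp measurable_invr (@measurable_normsq R)).
have -> : delta = fun z => (normsq z * delta z) * (normsq z)^-1 +
    delta 0 * \1_[set (0 : plane R)] z.
  apply/funext => z; rewrite indicE.
  have [->|z0] := eqVneq z 0.
    by rewrite mem_set//= /normsq /cabs /= expr0n/= addr0 sqrtr0 expr0n invr0 mulr0 add0r mulr1.
  rewrite memNset; last by move=> /= /eqP; rewrite (negbTE z0).
  rewrite mulr0 addr0 mulrAC divff ?mul1r//.
  by apply: contra z0; rewrite -sqdist0 => /eqP/sqdist_eq0 ->.
apply: measurable_funD => //; apply: measurable_funM => //.
by apply: measurable_indic; exact: measurable_plane_set1.
Qed.

Let md : measurable_fun setT delta.
Proof. exact: thermal_measurable. Qed.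

Let d_int : dA.-integrable setT (fun z => (delta z)%:E).
Proof.
have [[_ _ d1 _] _] := delta_min.
apply/integrableP; split; first exact/measurable_EFinP.
under eq_integral do rewrite gee0_abs ?lee_fin ?d_ge0//.
by rewrite d1 ltry.
Qed.

Let ent_int : dA.-integrable setT (fun z => (delta z * ln (delta z))%:E).
Proof. by have [[_ _ _ [_ _ h]] _] := delta_min. Qed.

Let en_int : (dA \x dA)%E.-integrable setT (fun p => (cross_energy delta delta p)%:E).
Proof. by have [[_ _ _ [h _ _]] _] := delta_min. Qed.

Let psi_int : dA.-integrable setT (fun z => (psi z)%:E).
Proof. exact: boxed_integrable (boxed_psi a k). Qed.

Let normsq_bounded : bounded_on_box a k (@normsq R).
Proof.
have [S HS] := le_sqdist_box a k_gt0 0; exists S => z /HS.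
by rewrite sqdist0 ger0_norm ?normsq_ge0.
Qed.

Let qpsi_int : dA.-integrable setT (fun z => (normsq z * psi z)%:E).
Proof.
exact: (boxed_integrable k_gt0 (boxedM (@measurable_normsq R) normsq_bounded (boxed_psi a k))).
Qed.

Let d_bounded : bounded_on_box a k delta.
Proof.
by exists C => z /delta_box /andP[h1 h2]; rewrite ger0_norm// (le_trans (ltW m_gt0)).
Qed.

Let lnd_bounded : bounded_on_box a k (fun z => ln (delta z)).
Proof. exact: bounded_on_box_ln m_gt0 delta_box. Qed.

Let mlnd : measurable_fun setT (fun z => ln (delta z)).
Proof. exact: (measurableT_comp (@measurable_ln R)). Qed.

Let lnpsi_int : dA.-integrable setT (fun z => (ln (delta z) * psi z)%:E).
Proof. exact: (boxed_integrable k_gt0 (boxedM mlnd lnd_bounded (boxed_psi a k))). Qed.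

Let psi2_int : dA.-integrable setT (fun z => (psi z * psi z)%:E).
Proof.
apply: (boxed_integrable k_gt0 (boxedM (measurable_psi a k) _ (boxed_psi a k))).
by have [_ _ [D HD]] := boxed_psi a k; exists D => z _.
Qed.

Let dt t z := delta z + t * psi z.

Section perturbation.
Variables (B t : R).
Hypothesis psiB : forall z, `|psi z| <= B.
Hypothesis tB : `|t| * B <= m / 2.

Let dt_box z : inbox z -> m / 2 <= dt t z <= C + m / 2.
Proof.
move=> /delta_box /andP[h1 h2]; rewrite /dt.
have : `|t * psi z| <= m / 2 by rewrite normrM (le_trans _ tB)// ler_wpM2l.
by rewrite ler_norml => /andP[? ?]; lra.
Qed.

Let dt_out z : ~~ inbox z -> dt t z = delta z.
Proof. by move=> /psi_eq0 h; rewrite /dt h mulr0 addr0. Qed.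

Let mdt : measurable_fun setT (dt t).
Proof.
by apply: measurable_funD => //; apply: measurable_funM => //; exact: measurable_psi.
Qed.

Let ent_diff z := dt t z * ln (dt t z) - delta z * ln (delta z).

Let ent_diff_int : dA.-integrable setT (fun z => (ent_diff z)%:E).
Proof.
apply: (@boxed_integrable R a k k_gt0); split.
- apply: measurable_funB; apply: measurable_funM => //.
  exact: (measurableT_comp (@measurable_ln R)).
- by move=> z zb; rewrite /ent_diff (dt_out zb) subrr.
have [D1 H1] := d_bounded; have [D2 H2] := lnd_bounded.
have m2 : 0 < m / 2 by rewrite divr_gt0.
have [E HE] := bounded_on_box_ln m2 dt_box.
exists (`|C + m / 2| * `|E| + `|D1| * `|D2|) => z; have [zb|zb] := boolP (inbox z); last first.
  rewrite /ent_diff (dt_out zb) subrr normr0; apply: addr_ge0; apply: mulr_ge0 => //.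
have /andP[h1 h2] := dt_box zb; have d0 := lt_le_trans m2 h1.
apply: (@le_trans _ _ (`|dt t z| * `|ln (dt t z)| + `|delta z| * `|ln (delta z)|)).
  by rewrite -!normrM; exact: ler_normB.
apply: lerD; apply: ler_pM => //.
- by rewrite (ger0_norm (ltW d0)) (le_trans h2)// ler_norm.
- exact: le_trans (HE z zb) (ler_norm _).
- exact: le_trans (H1 z zb) (ler_norm _).
- exact: le_trans (H2 z zb) (ler_norm _).
Qed.

(** Concavity gives ln (1 + u) <= u for u = t psi / delta, and (delta + t psi) u = t psi + t^2 psi^2
    / delta, where [delta >= m] on the box. An upper bound is enough, because minimality bounds the
    change of free energy from below. *)
Let ent_diff_le z : ent_diff z <= t * (psi z + ln (delta z) * psi z) +
  t ^+ 2 * (m^-1 * (psi z * psi z)).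
Proof.
have [zb|zb] := boolP (inbox z); last first.
  by rewrite /ent_diff (dt_out zb) (psi_eq0 zb) subrr !mulr0 !addr0 mulr0.
have /andP[h1 _] := dt_box zb; have /andP[h2 _] := delta_box zb.
have m2 : 0 < m / 2 by rewrite divr_gt0.
have d0 := lt_le_trans m2 h1; have e0 := lt_le_trans m_gt0 h2.
have en0 : delta z != 0 by rewrite gt_eqF.
have lE : ln (dt t z) = ln (delta z) + ln (dt t z / delta z).
  by rewrite ln_div ?posrE// addrC subrK.
have h3 : ln (dt t z / delta z) <= t * psi z / delta z.
  have e : dt t z / delta z = 1 + t * psi z / delta z by rewrite /dt; field.
  have p : 0 < 1 + t * psi z / delta z by rewrite -e divr_gt0.
  by rewrite e; apply: le_ln1Dx; lra.
have h4 := ler_wpM2l (ltW d0) h3.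
have h5 : dt t z * (t * psi z / delta z) = t * psi z + (t * psi z) ^+ 2 / delta z.
  by rewrite /dt; field.
have h6 : (t * psi z) ^+ 2 / delta z <= (t * psi z) ^+ 2 / m.
  by rewrite ler_wpM2l ?sqr_ge0// lef_pV2 ?posrE.
have h7 : (t * psi z) ^+ 2 / m = t ^+ 2 * (m^-1 * (psi z * psi z)) by ring.
rewrite /ent_diff lE mulrDr; rewrite h5 in h4.
have h8 : dt t z * ln (delta z) = delta z * ln (delta z) + t * (ln (delta z) * psi z).
  by rewrite /dt; ring.
lra.
Qed.

Let qdt_int : dA.-integrable setT (fun z => (normsq z * dt t z)%:E).
Proof.
apply: eq_integrable (RintegrableD qd_int (RintegrableZl t qpsi_int)) => // z _.
by rewrite /dt /=; congr EFin; ring.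
Qed.

Let entdt_int : dA.-integrable setT (fun z => (dt t z * ln (dt t z))%:E).
Proof.
apply: eq_integrable (RintegrableD ent_int ent_diff_int) => // z _.
by rewrite /ent_diff /=; congr EFin; ring.
Qed.

Let delta_psi_int := @integrable_cross_energyl R a k k_gt0 delta d_int qd_int.
Let psi_delta_int := @integrable_cross_energyr R a k k_gt0 delta d_int qd_int.
Let psi_psi_int := @integrable_cross_energyl R a k k_gt0 psi psi_int qpsi_int.

Let endtE p : cross_energy (dt t) (dt t) p = cross_energy delta delta p +
  (t * (cross_energy delta psi p + cross_energy psi delta p) +
   t ^+ 2 * cross_energy psi psi p).
Proof. by rewrite /cross_energy /dt; ring. Qed.

Let endt_int :
  (dA \x dA)%E.-integrable setT (fun p => (cross_energy (dt t) (dt t) p)%:E).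
Proof.
apply: eq_integrable (RintegrableD en_int (RintegrableD
  (RintegrableZl t (RintegrableD delta_psi_int psi_delta_int))
  (RintegrableZl (t ^+ 2) psi_psi_int))) => // p _.
by congr EFin; rewrite endtE.
Qed.

Let admissible_dt : admissible_density (@normsq R) (dt t).
Proof.
have [[sd _ d1 _] _] := delta_min; split.
- by apply: smoothDZ => //; exact: smooth_psi.
- move=> z; have [zb|/dt_out ->//] := boolP (inbox z).
  have /andP[h _] := dt_box zb; apply: le_trans h; exact: ltW (divr_gt0 _ _).
- have i := RintegrableD d_int (RintegrableZl t psi_int).
  rewrite -[LHS](fineK (integrable_fin_num measurableT i)); congr EFin.
  have -> : fine (\int[dA]_z (dt t z)%:E)%E = _ :=
    RintegralD measurableT d_int (RintegrableZl t psi_int).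
  rewrite (RintegralZl _ measurableT psi_int).
  have -> : \int[dA]_z delta z = 1 by rewrite /Rintegral d1.
  by have -> : \int[dA]_z psi z = 0 := integral_psi; rewrite mulr0 addr0.
- by split; [exact: endt_int|exact: qdt_int|exact: entdt_int].
Qed.

(** Minimality tested at [dt t]. The two mixed energies contribute [- phi / 2] each, the potential
    contributes the integral of [phi], and the entropy contributes [ln delta * psi], its other
    linear term being a multiple of the integral of [psi], which is [0]. *)
Lemma energy_le : 0 <= t * (- (\int[dA]_z (delta z * phi z)) + (\int[dA]_z phi z) +
    n%:R^-1 * (\int[dA]_z (ln (delta z) * psi z))) +
  t ^+ 2 * ((\int[(dA \x dA)%E]_p cross_energy psi psi p) +
    n%:R^-1 * (m^-1 * (\int[dA]_z (psi z * psi z)))).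
Proof.
have [_ /(_ _ admissible_dt)] := delta_min; rewrite /free_energy mulr1.
have -> : \int[(dA \x dA)%E]_p log_energy_density (dt t) p =
    (\int[(dA \x dA)%E]_p log_energy_density delta p) +
    (t * - (\int[dA]_z (delta z * phi z)) + t ^+ 2 *
     \int[(dA \x dA)%E]_p cross_energy psi psi p).
  transitivity (\int[(dA \x dA)%E]_p (cross_energy delta delta p +
    (t * (cross_energy delta psi p + cross_energy psi delta p) +
     t ^+ 2 * cross_energy psi psi p))).
    by apply: eq_Rintegral => p _; rewrite -endtE.
  have i1 := RintegrableD delta_psi_int psi_delta_int.
  rewrite (RintegralD measurableT en_int (RintegrableD (RintegrableZl t i1)
    (RintegrableZl (t ^+ 2) psi_psi_int))).
  rewrite (RintegralD measurableT (RintegrableZl t i1) (RintegrableZl (t ^+ 2) psi_psi_int)).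
  rewrite (RintegralZl _ measurableT i1) (RintegralZl _ measurableT psi_psi_int).
  rewrite (RintegralD measurableT delta_psi_int psi_delta_int).
  rewrite (@integral_cross_energyl R a k k_gt0 delta d_int qd_int).
  rewrite (@integral_cross_energyr R a k k_gt0 delta d_int qd_int).
  apply: (congr2 +%R erefl); apply: (congr2 +%R _ erefl); apply: (congr1 ( *%R t)).
  by field.
have -> : \int[dA]_z (normsq z * dt t z) =
    (\int[dA]_z (normsq z * delta z)) + t * \int[dA]_z phi z.
  rewrite -integral_normsq_psi -(RintegralZl _ measurableT qpsi_int).
  rewrite -(RintegralD measurableT qd_int (RintegrableZl t qpsi_int)).
  by apply: eq_Rintegral => z _; rewrite /dt; ring.
have -> : \int[dA]_z (dt t z * ln (dt t z)) =
    (\int[dA]_z (delta z * ln (delta z))) + \int[dA]_z ent_diff z.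
  rewrite -(RintegralD measurableT ent_int ent_diff_int).
  by apply: eq_Rintegral => z _; rewrite /ent_diff; ring.
have : \int[dA]_z ent_diff z <= t * (\int[dA]_z (ln (delta z) * psi z)) +
    t ^+ 2 * (m^-1 * \int[dA]_z (psi z * psi z)).
  have i1 := RintegrableD psi_int lnpsi_int.
  have i2 := RintegrableZl m^-1 psi2_int.
  have i3 := RintegrableD (RintegrableZl t i1) (RintegrableZl (t ^+ 2) i2).
  apply: (le_trans (le_Rintegral measurableT ent_diff_int i3 (fun z _ => ent_diff_le z))).
  rewrite (RintegralD measurableT (RintegrableZl t i1) (RintegrableZl (t ^+ 2) i2)).
  rewrite (RintegralZl _ measurableT i1) (RintegralZl _ measurableT i2).
  rewrite (RintegralZl _ measurableT psi2_int) (RintegralD measurableT psi_int lnpsi_int).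
  by have -> : \int[dA]_z psi z = 0 := integral_psi; rewrite add0r.
have n0 : 0 <= n%:R^-1 :> R by rewrite invr_ge0.
move=> /(ler_wpM2l n0).
move: (\int[_]_p _) (\int[_]_p _) (\int[_]_p _) (\int[_]_p _) (\int[_]_p _) (\int[_]_p _)
  (\int[_]_p _) (\int[_]_p _) (n%:R^-1) => x1 x2 x3 x4 x5 x6 x7 x8 y h1 h2.
nra.
Qed.

End perturbation.
(** The inequality [energy_le] holds for all small [t] of either sign, so its linear coefficient
    vanishes. *)
Lemma euler_lagrange : \int[dA]_z (delta z * phi z) =
  (\int[dA]_z phi z) + n%:R^-1 * (\int[dA]_z (ln (delta z) * psi z)).
Proof.
have [_ _ [B0 HB]] := boxed_psi a k.
pose B := `|B0| + 1.
have B_gt0 : 0 < B by rewrite ltr_wpDl.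
have psiB z : `|psi z| <= B.
  by rewrite (le_trans (HB z))// (le_trans (ler_norm _))// lerDl.
have t0 : 0 < m / 2 / B by rewrite !divr_gt0.
have tB (t : R) : `|t| <= m / 2 / B -> `|t| * B <= m / 2 by rewrite -ler_pdivlMr.
have h := linear_coef_eq0 t0 (fun t ht => energy_le psiB (tB t ht)).
lra.
Qed.

End first_variation.

(** * The one-point function of the Ginibre ensemble *)

Section complex_integral.
Import complex.
Local Open Scope complex_scope.
Context d (T : measurableType d) (R : realType) (mu : {measure set T -> \bar R}).
Implicit Types f g : T -> R[i].

(** Complex values are needed because the orthogonality of the monomials concerns the mixed moments
    of z^j zbar^k; real and imaginary parts are integrated separately. *)
Definition cintegrable f :=
  mu.-integrable setT (fun x => (complex.Re (f x))%:E) /\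
  mu.-integrable setT (fun x => (complex.Im (f x))%:E).

Definition cintegral f : R[i] :=
  (\int[mu]_x complex.Re (f x)) +i* (\int[mu]_x complex.Im (f x)).

Lemma eq_cintegral f g : f =1 g -> cintegral f = cintegral g.
Proof. by move=> /funext ->. Qed.

Lemma eq_cintegrable f g : f =1 g -> cintegrable f -> cintegrable g.
Proof. by move=> /funext ->. Qed.

Lemma cintegrable0 : cintegrable (fun=> 0).
Proof. by split; exact: integrable0. Qed.

Lemma cintegral0 : cintegral (fun=> 0) = 0.
Proof. by rewrite /cintegral/= /Rintegral !integral0. Qed.

Lemma cintegrableD f g : cintegrable f -> cintegrable g ->
  cintegrable (fun x => f x + g x).
Proof.
move=> [f1 f2] [g1 g2]; split.
- apply: eq_integrable (RintegrableD f1 g1) => // x _.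
  by case: (f x) (g x) => [? ?] [? ?].
- apply: eq_integrable (RintegrableD f2 g2) => // x _.
  by case: (f x) (g x) => [? ?] [? ?].
Qed.

Lemma cintegralD f g : cintegrable f -> cintegrable g ->
  cintegral (fun x => f x + g x) = cintegral f + cintegral g.
Proof.
move=> [f1 f2] [g1 g2]; rewrite /cintegral /GRing.add/=.
rewrite -(RintegralD measurableT f1 g1) -(RintegralD measurableT f2 g2).
by congr Complex; apply: eq_Rintegral => x _; case: (f x) (g x) => [? ?] [? ?].
Qed.

Lemma cintegrableZ c f : cintegrable f -> cintegrable (fun x => c * f x).
Proof.
case: c => a b [f1 f2]; split.
- apply: eq_integrable (RintegrableB (RintegrableZl a f1) (RintegrableZl b f2)) => // x _.
  by case: (f x).
- apply: eq_integrable (RintegrableD (RintegrableZl a f2) (RintegrableZl b f1)) => // x _.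
  by case: (f x).
Qed.

Lemma cintegralZ c f : cintegrable f ->
  cintegral (fun x => c * f x) = c * cintegral f.
Proof.
case: c => a b [f1 f2]; rewrite /cintegral /GRing.mul/=.
rewrite -(RintegralZl _ measurableT f1) -(RintegralZl _ measurableT f2).
rewrite -(RintegralZl _ measurableT f1) -(RintegralZl _ measurableT f2).
rewrite -(RintegralB measurableT (RintegrableZl a f1) (RintegrableZl b f2)).
rewrite -(RintegralD measurableT (RintegrableZl a f2) (RintegrableZl b f1)).
by congr Complex; apply: eq_Rintegral => x _; case: (f x).
Qed.

Lemma cintegrable_sum (I : Type) (s : seq I) (P : pred I) (f : I -> T -> R[i]) :
  (forall i, cintegrable (f i)) -> cintegrable (fun x => \sum_(i <- s | P i) f i x).
Proof.
move=> fi; elim: s => [|i s IH].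
  by apply: (eq_cintegrable _ cintegrable0) => x; rewrite big_nil.
have [Pi|Pi] := boolP (P i).
- by apply: (eq_cintegrable _ (cintegrableD (fi i) IH)) => x; rewrite big_cons Pi.
- by apply: (eq_cintegrable _ IH) => x; rewrite big_cons (negbTE Pi).
Qed.

Lemma cintegral_sum (I : Type) (s : seq I) (P : pred I) (f : I -> T -> R[i]) :
    (forall i, cintegrable (f i)) ->
  cintegral (fun x => \sum_(i <- s | P i) f i x) = \sum_(i <- s | P i) cintegral (f i).
Proof.
move=> fi; elim: s => [|i s IH].
  rewrite big_nil -[RHS]cintegral0; apply: eq_cintegral => x; exact: big_nil.
rewrite big_cons; case: ifPn => Pi.
- rewrite -IH -cintegralD//; last exact: cintegrable_sum.
  by apply: eq_cintegral => x; rewrite big_cons Pi.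
- by rewrite -IH; apply: eq_cintegral => x; rewrite big_cons (negbTE Pi).
Qed.

End complex_integral.

Section complex_product_integral.
Import complex.
Local Open Scope complex_scope.
Context {R : realType}.

Lemma Rintegral_prod d1 d2 (T1 : measurableType d1) (T2 : measurableType d2)
    (m1 : {sigma_finite_measure set T1 -> \bar R})
    (m2 : {sigma_finite_measure set T2 -> \bar R}) (f : T1 -> R) (g : T2 -> R) :
    m1.-integrable setT (fun x => (f x)%:E) -> m2.-integrable setT (fun x => (g x)%:E) ->
  \int[(m1 \x m2)%E]_p (f p.1 * g p.2) = (\int[m1]_x f x) * (\int[m2]_y g y).
Proof.
move=> fi gi; have i := integrable_prod fi gi.
rewrite {1}/Rintegral -integral12_prod_meas1//.
transitivity (fine (\int[m1]_x (f x * \int[m2]_y g y)%:E)%E).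
  apply: (congr1 fine); apply: eq_integral => x _; rewrite /fubini_F/=.
  have gxi := RintegrableZl (f x) gi.
  rewrite -[LHS](fineK (integrable_fin_num measurableT gxi)); congr EFin.
  exact: (RintegralZl _ measurableT gi).
exact: (RintegralZr _ measurableT fi).
Qed.

Variables (d1 d2 : measure_display) (T1 : measurableType d1) (T2 : measurableType d2).
Variables (m1 : {sigma_finite_measure set T1 -> \bar R}).
Variables (m2 : {sigma_finite_measure set T2 -> \bar R}).
Variables (f : T1 -> R[i]) (g : T2 -> R[i]).
Hypotheses (fi : cintegrable m1 f) (gi : cintegrable m2 g).

Let i11 := integrable_prod fi.1 gi.1.
Let i12 := integrable_prod fi.1 gi.2.
Let i21 := integrable_prod fi.2 gi.1.
Let i22 := integrable_prod fi.2 gi.2.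

Lemma cintegrable_prod : cintegrable (m1 \x m2)%E (fun p => f p.1 * g p.2).
Proof.
split.
- apply: eq_integrable (RintegrableB i11 i22) => // -[x y] _ /=.
  by case: (f x) (g y) => [? ?] [? ?].
- apply: eq_integrable (RintegrableD i12 i21) => // -[x y] _ /=.
  by case: (f x) (g y) => [? ?] [? ?].
Qed.

Lemma cintegral_prod :
  cintegral (m1 \x m2)%E (fun p => f p.1 * g p.2) = cintegral m1 f * cintegral m2 g.
Proof.
have [f1 f2] := fi; have [g1 g2] := gi.
rewrite /cintegral /GRing.mul/=.
rewrite -(Rintegral_prod f1 g1) -(Rintegral_prod f2 g2).
rewrite -(Rintegral_prod f1 g2) -(Rintegral_prod f2 g1).
rewrite -(RintegralB measurableT i11 i22) -(RintegralD measurableT i12 i21).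
by congr Complex; apply: eq_Rintegral => -[x y] _ /=; case: (f x) (g y) => [? ?] [? ?].
Qed.

End complex_product_integral.

Section complex_tuple_integral.
Import complex.
Local Open Scope complex_scope.
Context {R : realType}.

Let measurable_EFin_comp d (T : measurableType d) (f : T -> R) :
  measurable_fun setT f -> measurable_fun setT (fun x => (f x)%:E).
Proof. by move=> mf; apply/measurable_EFinP. Qed.

Definition cmeasurable d (T : measurableType d) (f : T -> R[i]) :=
  measurable_fun setT (fun x => complex.Re (f x)) /\
  measurable_fun setT (fun x => complex.Im (f x)).

Lemma cmeasurable1 d (T : measurableType d) : cmeasurable (fun _ : T => 1 : R[i]).
Proof. by split; exact: measurable_cst. Qed.

Lemma cmeasurableM d (T : measurableType d) (f g : T -> R[i]) :
  cmeasurable f -> cmeasurable g -> cmeasurable (fun x => f x * g x).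
Proof.
move=> [f1 f2] [g1 g2]; split.
- have := measurable_funB (measurable_funM f1 g1) (measurable_funM f2 g2).
  by congr measurable_fun; apply/funext => x /=; case: (f x) (g x) => [? ?] [? ?].
- have := measurable_funD (measurable_funM f1 g2) (measurable_funM f2 g1).
  by congr measurable_fun; apply/funext => x /=; case: (f x) (g x) => [? ?] [? ?].
Qed.

Lemma cmeasurableX d (T : measurableType d) (f : T -> R[i]) n :
  cmeasurable f -> cmeasurable (fun x => f x ^+ n).
Proof.
move=> mf; elim: n => [|n IH]; first exact: cmeasurable1.
have := cmeasurableM mf IH; congr cmeasurable; apply/funext => x.
by rewrite exprS.
Qed.

Lemma cmeasurable_prod d (T : measurableType d) n (f : 'I_n -> T -> R[i]) :
  (forall i, cmeasurable (f i)) -> cmeasurable (fun x => \prod_i f i x).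
Proof.
elim: n f => [|n IH] f mf.
  have := @cmeasurable1 _ T : cmeasurable _; congr cmeasurable; apply/funext => x.
  by rewrite big_ord0.
have := cmeasurableM (mf ord0) (IH (fun i => f (lift ord0 i)) (fun i => mf _)).
by congr cmeasurable; apply/funext => x; rewrite big_ord_recl.
Qed.

Lemma cmeasurable_comp d1 d2 (T1 : measurableType d1) (T2 : measurableType d2)
    (h : T1 -> T2) (f : T2 -> R[i]) :
  measurable_fun setT h -> cmeasurable f -> cmeasurable (fun x => f (h x)).
Proof.
by move=> mh [f1 f2]; split; [exact: (measurableT_comp f1)|exact: (measurableT_comp f2)].
Qed.

Section cons_integral.
Variables (n : nat) (mu : {sigma_finite_measure set (n.-tuple (plane R)) -> \bar R}).
Variable F : n.+1.-tuple (plane R) -> R[i].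
Hypotheses (mF : cmeasurable F)
  (Fi : cintegrable (dA \x mu)%E (fun p => F (cons_point p))).

Lemma cintegrable_cons_measure : cintegrable (cons_measure mu) F.
Proof.
have [F1 F2] := Fi; have [mF1 mF2] := mF; split.
- exact: (integrable_pushforward (@measurable_cons_point R n) (measurable_EFin_comp mF1)).
- exact: (integrable_pushforward (@measurable_cons_point R n) (measurable_EFin_comp mF2)).
Qed.

Lemma cintegral_cons_measure :
  cintegral (cons_measure mu) F = cintegral (dA \x mu)%E (fun p => F (cons_point p)).
Proof.
have [F1 F2] := Fi; have [mF1 mF2] := mF; rewrite /cintegral; congr Complex.
- apply: (congr1 fine).
  exact: (integral_pushforward (@measurable_cons_point R n) (measurable_EFin_comp mF1) F1).
- apply: (congr1 fine).
  exact: (integral_pushforward (@measurable_cons_point R n) (measurable_EFin_comp mF2) F2).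
Qed.

End cons_integral.

Lemma cintegrable_measurable d (T : measurableType d) (mu : {measure set T -> \bar R})
  (f : T -> R[i]) : cintegrable mu f -> cmeasurable f.
Proof.
move=> [f1 f2]; split; [exact: (Rintegrable_measurable f1)|exact: (Rintegrable_measurable f2)].
Qed.

Lemma cintegral_tuple n (f : 'I_n -> plane R -> R[i]) :
    (forall i, cintegrable dA (f i)) ->
  cintegrable (dA_ n) (fun z => \prod_i f i (tnth z i)) /\
  cintegral (dA_ n) (fun z => \prod_i f i (tnth z i)) = \prod_i cintegral dA (f i).
Proof.
elim: n f => [|n IH] f fi.
  split.
    apply: (@eq_cintegrable _ _ _ _ (fun=> 1)) => [z|]; first by rewrite big_ord0.
    split; apply/integrableP; split; try exact: measurable_cst;
      by rewrite integral_dirac//= ?diracT ?mul1e ltry.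
  rewrite big_ord0 (@eq_cintegral _ _ _ _ _ (fun=> 1)); last by move=> z; rewrite big_ord0.
  by rewrite /cintegral /Rintegral !integral_dirac// !diracT !mul1e.
have [Ii IE] := IH (fun i => f (lift ord0 i)) (fun i => fi _).
have E (p : plane R * n.-tuple (plane R)) : \prod_i f i (tnth (cons_point p) i) =
    f ord0 p.1 * \prod_i f (lift ord0 i) (tnth p.2 i).
  by rewrite big_ord_recl; congr (_ * _); apply: eq_bigr => i _; rewrite tnthS.
have pi := cintegrable_prod (fi ord0) Ii.
have mF : cmeasurable (fun z : n.+1.-tuple (plane R) => \prod_i f i (tnth z i)).
  apply: cmeasurable_prod => i.
  apply: (@cmeasurable_comp _ _ _ _ (fun z => tnth z i)); first exact: measurable_tnth.
  exact: cintegrable_measurable (fi i).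
have qi := eq_cintegrable (fun p => esym (E p)) pi.
split; first exact: (cintegrable_cons_measure mF qi).
rewrite [LHS](cintegral_cons_measure mF qi) (eq_cintegral _ E) big_ord_recl -IE.
exact: cintegral_prod.
Qed.

End complex_tuple_integral.

(** * Integrals of derivatives and of Gaussians on the line *)

Section whole_line.
Context {R : realType}.
Local Notation mu := (@lebesgue_measure R).

(** The bound on [F x * x] forces [F] to vanish at both ends, and the integral over a symmetric
    segment is the difference of its end values. *)
Lemma integral_derivative_eq0 (F f : R -> R) C :
    (forall x : R, is_derive x 1 F (f x)) -> continuous f ->
    mu.-integrable setT (fun x => (f x)%:E) -> (forall x : R, `|F x * x| <= C) ->
  \int[mu]_x f x = 0.
Proof.
move=> dF cf fi FC.
have mf : measurable_fun setT f by exact: Rintegrable_measurable fi.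
pose I n : set R := `[- n.+1%:R, n.+1%:R]%classic.
pose f_ n x := (f x * \1_(I n) x)%:E.
have mI n : measurable (I n) by exact: measurable_itv.
have cv : ((\int[mu]_x f_ n x)%E @[n --> \oo] --> (\int[mu]_x (f x)%:E)%E).
  apply: (@dominated_cvg _ _ _ mu setT measurableT f_ _ (fun x => `|f x|%:E)) => //.
  - move=> n; apply/measurable_EFinP; apply: measurable_funM => //.
    exact: (measurable_indic (mI n)).
  - move=> x _; apply: cvg_near_cst; near=> n; rewrite /f_ indicE mem_set ?mulr1//.
    rewrite /I/= in_itv/= -ler_norml.
    apply: (@le_trans _ _ (n%:R)); last by rewrite ler_nat.
    by near: n; exact: nbhs_infty_ger.
  - exact: Rintegrable_norm.
  - move=> n x _; rewrite /f_ lee_fin normrM -[leRHS]mulr1 ler_wpM2l//.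
    by rewrite indicE; case: (_ \in _); rewrite ?normr0 ?normr1.
have E n : (\int[mu]_x f_ n x = (F n.+1%:R - F (- n.+1%:R))%:E)%E.
  have -> : (\int[mu]_x f_ n x = \int[mu]_(x in I n) (f x)%:E)%E.
    rewrite [RHS]integral_mkcond; apply: eq_integral => x _.
    by rewrite /f_ patchE indicE; case: (_ \in _); rewrite ?mulr1 ?mulr0.
  have cF : continuous F by exact: (is_derive_continuous dF).
  rewrite (@continuous_FTC2 R f F) ?EFinB//.
  - by rewrite gtrN.
  - exact: continuous_subspaceT.
  - split; first by move=> x _; case: (dF x).
    + by apply: cvg_at_right_filter; exact: cF.
    + by apply: cvg_at_left_filter; exact: cF.
  - by move=> x _; rewrite derive1E; apply: derive_val.
have C0 : 0 <= C by apply: le_trans (FC 0).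
have Z : (F n.+1%:R - F (- n.+1%:R))%:E @[n --> \oo] --> (0 : R)%:E.
  apply: cvg_EFin; first by near=> n.
  apply/cvgr0Pnorm_le => e e0; near=> n.
  have n0 : 0 < n.+1%:R :> R by [].
  have h1 := FC n.+1%:R; have h2 := FC (- n.+1%:R).
  rewrite !normrM normrN (ger0_norm (ltW n0)) in h1 h2.
  have h3 : 2 * C / e <= n%:R by near: n; exact: nbhs_infty_ger.
  rewrite ler_pdivrMr// in h3.
  have h4 : n%:R <= n.+1%:R :> R by rewrite ler_nat.
  have h5 : n%:R * e <= n.+1%:R * e by rewrite ler_wpM2r ?(ltW e0).
  rewrite /=; apply: (le_trans (ler_normB _ _)).
  rewrite -(ler_pM2r n0) mulrDl; lra.
have {}Z : (\int[mu]_x f_ n x)%E @[n --> \oo] --> (0 : R)%:E.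
  by under eq_cvg do rewrite E; exact: Z.
by rewrite /Rintegral -(cvg_unique (@ereal_hausdorff R) Z cv).
Unshelve. all: end_near. Qed.

Variable N : R.
Hypothesis N_gt0 : 0 < N.

Let sqrtN_gt0 : 0 < Num.sqrt N. Proof. by rewrite sqrtr_gt0. Qed.

Let gaussE (x : R) : gauss_fun (0 + Num.sqrt N * x) = expR (- (N * x ^+ 2)).
Proof. by rewrite /gauss_fun add0r exprMn sqr_sqrtr// ltW. Qed.

Let continuous_gauss : continuous (fun x : R => expR (- (N * x ^+ 2))).
Proof.
exact: (is_derive_continuous (fun x : R => pderive_expR
  (pderiveN (pderiveM (pderive_cst N x) (pderiveX 2 (pderive_id x)))))).
Qed.

Lemma ge0_integral_gauss :
  (\int[mu]_x (expR (- (N * x ^+ 2)))%:E = (Num.sqrt pi / Num.sqrt N)%:E)%E.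
Proof.
have /= := @integral_affine R gauss_fun 0 _ sqrtN_gt0 continuous_gauss_fun gauss_fun_ge0.
rewrite integralT_gauss.
under eq_integral do rewrite gaussE EFinM.
rewrite ge0_integralZl//=; last first.
  by apply/measurable_EFinP; exact: continuous_measurable_fun continuous_gauss.
move=> h; have : ((Num.sqrt N)^-1%:E * (Num.sqrt pi)%:E = (Num.sqrt N)^-1%:E *
  ((Num.sqrt N)%:E * \int[mu]_x (expR (- (N * x ^+ 2)))%:E))%E by rewrite h.
by rewrite muleA -!EFinM mulVf ?gt_eqF// mul1e mulrC.
Qed.

Lemma integrable_gauss : mu.-integrable setT (fun x : R => (expR (- (N * x ^+ 2)))%:E).
Proof.
apply/integrableP; split.
  by apply/measurable_EFinP; exact: continuous_measurable_fun continuous_gauss.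
under eq_integral do rewrite gee0_abs ?lee_fin ?expR_ge0//.
by rewrite ge0_integral_gauss ltry.
Qed.

End whole_line.

(** * Gaussian moments of the monomials in z and zbar *)

Section gaussian_moments.
Context {R : realType}.
Variable N : R.
Hypothesis N_gt0 : 0 < N.
Import complex.
Local Open Scope complex_scope.
Local Notation mu := (@lebesgue_measure R).
Implicit Types (z : plane R) (j k : nat).

Definition affix z : R[i] := z.1 +i* z.2.
Definition affixbar z : R[i] := z.1 -i* z.2.

Lemma affix_affixbar z : affix z * affixbar z = (normsq z)%:C.
Proof.
by rewrite normsqE /affix /affixbar /GRing.mul/=; congr Complex; ring.
Qed.

Definition gauss_monomial j k z : R[i] :=
  affix z ^+ j * affixbar z ^+ k * (expR (- (N * normsq z)))%:C.

Let expRN_le1 (s : R) : 0 <= s -> expR (- s) <= 1.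
Proof. by move=> s0; have := ler_expR (- s) 0; rewrite expR0 oppr_le0 => ->. Qed.

Let N2_gt0 : 0 < N / 2. Proof. by rewrite divr_gt0. Qed.

(** Only half of the exponent is kept; the other half absorbs polynomial factors. *)
Definition gauss_bounded (f : plane R -> R) :=
  exists C, forall z, `|f z| <= C * expR (- (N / 2 * normsq z)).

Let sum_of_squares (c : R[i]) := complex.Re c ^+ 2 + complex.Im c ^+ 2.

Let sum_of_squaresM c d : sum_of_squares (c * d) = sum_of_squares c * sum_of_squares d.
Proof. by case: c d => [? ?] [? ?]; rewrite /sum_of_squares/=; ring. Qed.

Let sum_of_squaresX c n : sum_of_squares (c ^+ n) = sum_of_squares c ^+ n.
Proof.
elim: n => [|n IH]; first by rewrite /sum_of_squares/= expr1n expr0n addr0.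
by rewrite !exprS sum_of_squaresM IH.
Qed.

Let le_sum_of_squares c : `|complex.Re c| <= 1 + sum_of_squares c /\
  `|complex.Im c| <= 1 + sum_of_squares c.
Proof.
case: c => a b; rewrite /sum_of_squares/=.
have h (x : R) : `|x| <= 1 + x ^+ 2.
  have := sqr_ge0 (`|x| - 1); rewrite sqrrB expr1n mulr1 real_normK ?num_real//.
  by have := normr_ge0 x; lra.
by have := h a; have := h b; have := sqr_ge0 a; have := sqr_ge0 b; lra.
Qed.

(** Each component of a complex number is at most 1 plus its squared modulus, here |z|^(2m) with m =
    j + k, an integer power of [normsq z]. The factor e^(-N |z|^2 / 2) then tames it, since a
    Poisson weight is at most 1. *)
Lemma gauss_monomial_bounded j k :
  gauss_bounded (fun z => complex.Re (gauss_monomial j k z)) /\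
  gauss_bounded (fun z => complex.Im (gauss_monomial j k z)).
Proof.
pose m := (j + k)%N; pose C := 1 + m`!%:R * (2 / N) ^+ m : R.
have H z : (1 + normsq z ^+ m) * expR (- (N * normsq z)) <=
    C * expR (- (N / 2 * normsq z)).
  have s0 := normsq_ge0 z; move: (normsq z) s0 => s s0.
  have s20 : 0 <= N / 2 * s by rewrite mulr_ge0// ltW.
  have -> : - (N * s) = - (N / 2 * s) - (N / 2 * s) by field.
  rewrite expRD mulrA ler_wpM2r ?expR_ge0// mulrDl mul1r.
  apply: lerD; first exact: expRN_le1.
  have : erlang m (N / 2 * s) <= 1.
    apply: le_trans (erlang_tail_le1 m s20); rewrite /erlang_tail big_ord_recr/= lerDr.
    by apply: sumr_ge0 => i _; exact: erlang_ge0.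
  rewrite /erlang exprMn.
  have f0 : 0 < m`!%:R :> R by rewrite ltr0n fact_gt0.
  have p0 : 0 < (N / 2) ^+ m by rewrite exprn_gt0.
  have -> : (2 / N) ^+ m = ((N / 2) ^+ m)^-1 by rewrite -exprVn invf_div.
  move=> h.
  by rewrite ler_pdivlMr// [leLHS]mulrC mulrA; move: h; rewrite mulrAC ler_pdivrMr// !mul1r.
have K z : sum_of_squares (affix z ^+ j * affixbar z ^+ k) = normsq z ^+ m.
  rewrite sum_of_squaresM !sum_of_squaresX /m exprD normsqE.
  by rewrite /sum_of_squares/= sqrrN.
by split; exists C => z; apply: le_trans (H z); have := K z;
  rewrite /gauss_monomial; case: (_ * affixbar z ^+ k) => [u v] Kz;
  have [/= h1 h2] := le_sum_of_squares (u +i* v); rewrite Kz in h1 h2;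
  rewrite /= !mulr0 ?subr0 ?add0r ?addr0 normrM (ger0_norm (expR_ge0 _)) ler_wpM2r ?expR_ge0.
Qed.

Lemma gauss_bounded_integrable f : measurable_fun setT f -> gauss_bounded f ->
  dA.-integrable setT (fun z => (f z)%:E).
Proof.
move=> mf [C HC]; apply/(integrable_dA _ measurableT).
have gi := integrable_gauss N2_gt0.
have i := RintegrableZl C (integrable_prod gi gi).
apply: (Rintegrable_le mf _ i) => z; apply: (le_trans (HC z)).
by rewrite normsqE mulrDr opprD expRD.
Qed.

Let boundE (C x y : R) : C * expR (- (N / 2 * normsq (x, y))) =
  C * expR (- (N / 2 * x ^+ 2)) * expR (- (N / 2 * y ^+ 2)).
Proof. by rewrite normsqE mulrDr opprD expRD mulrA. Qed.

Let gauss_le1 (x : R) : expR (- (N / 2 * x ^+ 2)) <= 1.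
Proof. by apply: expRN_le1; rewrite mulr_ge0 ?sqr_ge0 ?(ltW N2_gt0). Qed.

Let bound_le (C x y : R) :
  C * expR (- (N / 2 * normsq (x, y))) <= `|C| * expR (- (N / 2 * x ^+ 2)) /\
  C * expR (- (N / 2 * normsq (x, y))) <= `|C| * expR (- (N / 2 * y ^+ 2)).
Proof.
rewrite boundE; have hx := gauss_le1 x; have hy := gauss_le1 y.
have x0 := expR_ge0 (- (N / 2 * x ^+ 2)); have y0 := expR_ge0 (- (N / 2 * y ^+ 2)).
move: (expR (- (N / 2 * x ^+ 2))) (expR (- (N / 2 * y ^+ 2))) hx hy x0 y0 => u v hu hv u0 v0.
have C0 := normr_ge0 C; have CC := ler_norm C.
have h1 : C * (u * v) <= `|C| * (u * v) by rewrite ler_wpM2r ?mulr_ge0.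
have h2 : `|C| * (u * v) <= `|C| * u by rewrite ler_wpM2l// ler_piMr.
have h3 : `|C| * (u * v) <= `|C| * v by rewrite ler_wpM2l// ler_piMl.
by rewrite -mulrA; split; [exact: (le_trans h1 h2)|exact: (le_trans h1 h3)].
Qed.

Lemma gauss_bounded_sections (f : plane R -> R) : measurable_fun setT f ->
    gauss_bounded f ->
  (forall y : R, mu.-integrable setT (fun x => (f (x, y))%:E)) /\
  (forall x : R, mu.-integrable setT (fun y => (f (x, y))%:E)).
Proof.
move=> mf [C HC]; have i := RintegrableZl `|C| (integrable_gauss N2_gt0).
split=> [y|x].
- apply: (Rintegrable_le _ _ i) => [|x].
    exact: (measurableT_comp mf (measurable_pair2 y)).
  by apply: (le_trans (HC _)); have [] := bound_le C x y.
- apply: (Rintegrable_le _ _ i) => [|y].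
    exact: (measurableT_comp mf (measurable_pair1 x)).
  by apply: (le_trans (HC _)); have [] := bound_le C x y.
Qed.

Let gauss_mul_le (x : R) : expR (- (N / 2 * x ^+ 2)) * `|x| <= 1 + 2 / N.
Proof.
have h := expR_ge1Dx (N / 2 * x ^+ 2).
have e0 := expR_gt0 (- (N / 2 * x ^+ 2)).
have h1 : expR (- (N / 2 * x ^+ 2)) * (N / 2 * x ^+ 2) <= 1.
  have := ler_wpM2l (ltW e0) h; rewrite -expRD addNr expR0 mulrDr mulr1; lra.
have h2 : expR (- (N / 2 * x ^+ 2)) * x ^+ 2 <= 2 / N.
  have -> : 2 / N = (N / 2)^-1 by rewrite invf_div.
  by rewrite -[leRHS]mul1r ler_pdivlMr// -[leLHS]mulrA [_ * (N / 2)]mulrC.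
have h3 : `|x| <= 1 + x ^+ 2.
  have := sqr_ge0 (`|x| - 1); rewrite sqrrB expr1n mulr1 real_normK ?num_real//.
  by have := normr_ge0 x; lra.
have h4 := ler_wpM2l (ltW e0) h3; have h5 := gauss_le1 x.
by apply: (le_trans h4); rewrite mulrDr mulr1 lerD.
Qed.

Section divergence.
Variables (F G : plane R -> R).
Hypotheses (mG : measurable_fun setT G) (bF : gauss_bounded F) (bG : gauss_bounded G).

Let bF_mul : exists C, forall x y : R,
  `|F (x, y) * x| <= C /\ `|F (x, y) * y| <= C.
Proof.
have [C HC] := bF; exists (`|C| * (1 + 2 / N)) => x y.
have [h1 h2] := bound_le C x y; have h := HC (x, y).
rewrite !normrM; split.
- apply: (le_trans (ler_wpM2r (normr_ge0 x) (le_trans h h1))).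
  by apply: (le_trans _ (ler_wpM2l (normr_ge0 C) (gauss_mul_le x))); rewrite [leRHS]mulrA.
- apply: (le_trans (ler_wpM2r (normr_ge0 y) (le_trans h h2))).
  by apply: (le_trans _ (ler_wpM2l (normr_ge0 C) (gauss_mul_le y))); rewrite [leRHS]mulrA.
Qed.

Lemma integral_partial_x_eq0 :
    (forall x y : R, is_derive x 1 (fun x => F (x, y)) (G (x, y))) ->
    (forall y : R, continuous (fun x : R => G (x, y))) ->
  \int[dA]_z G z = 0.
Proof.
move=> dF cG; have [i _] := gauss_bounded_sections mG bG; have [C HC] := bF_mul.
rewrite (Rintegral_dA21 (gauss_bounded_integrable mG bG) i).
transitivity (pi^-1 * \int[mu]_(y in [set: R]) (0 : R)); last first.
  by rewrite /Rintegral integral0 mulr0.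
congr (_ * _); apply: eq_Rintegral => y _.
exact: (integral_derivative_eq0 (fun x => dF x y) (cG y) (i y) (fun x => (HC x y).1)).
Qed.

Lemma integral_partial_y_eq0 :
    (forall x y : R, is_derive y 1 (fun y => F (x, y)) (G (x, y))) ->
    (forall x : R, continuous (fun y : R => G (x, y))) ->
  \int[dA]_z G z = 0.
Proof.
move=> dF cG; have [_ i] := gauss_bounded_sections mG bG; have [C HC] := bF_mul.
rewrite (Rintegral_dA12 (gauss_bounded_integrable mG bG) i).
transitivity (pi^-1 * \int[mu]_(y in [set: R]) (0 : R)); last first.
  by rewrite /Rintegral integral0 mulr0.
congr (_ * _); apply: eq_Rintegral => x _.
exact: (integral_derivative_eq0 (fun y => dF x y) (cG x) (i x) (fun y => (HC x y).2)).
Qed.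

End divergence.

(** Continuity is asked along horizontal and vertical lines, the form in which the integration of a
    partial derivative consumes it. *)
Record tempered (f : plane R -> R[i]) : Prop := Tempered {
  tempered_measurable : cmeasurable f;
  tempered_bounded : gauss_bounded (fun z => complex.Re (f z)) /\
    gauss_bounded (fun z => complex.Im (f z));
  tempered_continuous_x : forall y : R,
    continuous (fun x : R => complex.Re (f (x, y))) /\
    continuous (fun x : R => complex.Im (f (x, y)));
  tempered_continuous_y : forall x : R,
    continuous (fun y : R => complex.Re (f (x, y))) /\
    continuous (fun y : R => complex.Im (f (x, y))) }.

Lemma tempered_integrable f : tempered f -> cintegrable dA f.
Proof.
by move=> [[m1 m2] [b1 b2] _ _]; split; apply: gauss_bounded_integrable.
Qed.

Let gauss_boundedD f g : gauss_bounded f -> gauss_bounded g ->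
  gauss_bounded (fun z => f z + g z).
Proof.
move=> [C HC] [D HD]; exists (C + D) => z.
by apply: (le_trans (ler_normD _ _)); rewrite mulrDl lerD.
Qed.

Let gauss_boundedZ a f : gauss_bounded f -> gauss_bounded (fun z => a * f z).
Proof.
by move=> [C HC]; exists (`|a| * C) => z; rewrite normrM -[leRHS]mulrA ler_wpM2l.
Qed.

Lemma temperedD f g : tempered f -> tempered g -> tempered (fun z => f z + g z).
Proof.
move=> [[fm1 fm2] [fb1 fb2] fx fy] [[gm1 gm2] [gb1 gb2] gx gy].
have ReE : (fun z => complex.Re (f z + g z)) =
    (fun z => complex.Re (f z) + complex.Re (g z)).
  by apply/funext => z; case: (f z) (g z) => [? ?] [? ?].
have ImE : (fun z => complex.Im (f z + g z)) =
    (fun z => complex.Im (f z) + complex.Im (g z)).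
  by apply/funext => z; case: (f z) (g z) => [? ?] [? ?].
have Re z := congr1 (@^~ z) ReE; have Im z := congr1 (@^~ z) ImE.
split.
- by split; [rewrite ReE|rewrite ImE]; apply: measurable_funD.
- by split; [rewrite ReE|rewrite ImE]; apply: gauss_boundedD.
- move=> y; have [f1 f2] := fx y; have [g1 g2] := gx y.
  split; [under eq_fun do rewrite Re|under eq_fun do rewrite Im] => x.
    exact: (cvgD (f1 x) (g1 x)).
  exact: (cvgD (f2 x) (g2 x)).
- move=> x; have [f1 f2] := fy x; have [g1 g2] := gy x.
  split; [under eq_fun do rewrite Re|under eq_fun do rewrite Im] => y.
    exact: (cvgD (f1 y) (g1 y)).
  exact: (cvgD (f2 y) (g2 y)).
Qed.

Lemma temperedZ c f : tempered f -> tempered (fun z => c * f z).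
Proof.
case: c => a b [[fm1 fm2] [fb1 fb2] fx fy].
have ReE : (fun z => complex.Re ((a +i* b) * f z)) =
    (fun z => a * complex.Re (f z) + (- b) * complex.Im (f z)).
  by apply/funext => z; case: (f z) => u v /=; rewrite mulNr.
have ImE : (fun z => complex.Im ((a +i* b) * f z)) =
    (fun z => a * complex.Im (f z) + b * complex.Re (f z)).
  by apply/funext => z; case: (f z).
have Re z := congr1 (@^~ z) ReE; have Im z := congr1 (@^~ z) ImE.
split.
- by split; [rewrite ReE|rewrite ImE]; apply: measurable_funD; apply: measurable_funM.
- by split; [rewrite ReE|rewrite ImE]; apply: gauss_boundedD; apply: gauss_boundedZ.
- move=> y; have [f1 f2] := fx y.
  split; [under eq_fun do rewrite Re|under eq_fun do rewrite Im] => x.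
    exact: (cvgD (cvgM (@cvg_cst _ _ _ _ _) (f1 x)) (cvgM (@cvg_cst _ _ _ _ _) (f2 x))).
  exact: (cvgD (cvgM (@cvg_cst _ _ _ _ _) (f2 x)) (cvgM (@cvg_cst _ _ _ _ _) (f1 x))).
- move=> x; have [f1 f2] := fy x.
  split; [under eq_fun do rewrite Re|under eq_fun do rewrite Im] => y.
    exact: (cvgD (cvgM (@cvg_cst _ _ _ _ _) (f1 y)) (cvgM (@cvg_cst _ _ _ _ _) (f2 y))).
  exact: (cvgD (cvgM (@cvg_cst _ _ _ _ _) (f2 y)) (cvgM (@cvg_cst _ _ _ _ _) (f1 y))).
Qed.

Definition is_cderive (f : R -> R[i]) (x : R) (l : R[i]) :=
  is_derive x 1 (fun x => complex.Re (f x)) (complex.Re l) /\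
  is_derive x 1 (fun x => complex.Im (f x)) (complex.Im l).

Let is_cderive_eq f x l l' : is_cderive f x l -> l = l' -> is_cderive f x l'.
Proof. by move=> ? <-. Qed.

Let is_cderiveM f g x l l' : is_cderive f x l -> is_cderive g x l' ->
  is_cderive (fun x => f x * g x) x (f x * l' + l * g x).
Proof.
move=> [f1 f2] [g1 g2]; split.
- have -> : (fun x => complex.Re (f x * g x)) = fun x => complex.Re (f x) * complex.Re (g x)
      + - (complex.Im (f x) * complex.Im (g x)).
    by apply/funext => t; case: (f t) (g t) => [? ?] [? ?].
  apply: (is_derive_eq (pderiveD (pderiveM f1 g1) (pderiveN (pderiveM f2 g2)))).
  by case: (f x) (g x) l l' {f1 f2 g1 g2} => [? ?] [? ?] [? ?] [? ?] /=; ring.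
- have -> : (fun x => complex.Im (f x * g x)) = fun x => complex.Re (f x) * complex.Im (g x)
      + complex.Im (f x) * complex.Re (g x).
    by apply/funext => t; case: (f t) (g t) => [? ?] [? ?].
  apply: (is_derive_eq (pderiveD (pderiveM f1 g2) (pderiveM f2 g1))).
  by case: (f x) (g x) l l' {f1 f2 g1 g2} => [? ?] [? ?] [? ?] [? ?] /=; ring.
Qed.

Let is_cderiveX f x l n : is_cderive f x l ->
  is_cderive (fun x => f x ^+ n) x (n%:R * f x ^+ n.-1 * l).
Proof.
move=> df; elim: n => [|n IH].
  by rewrite mulr0n !mul0r; split; exact: pderive_cst.
have := is_cderiveM df IH; under eq_fun do rewrite -exprS.
move=> h; apply: (is_cderive_eq h); rewrite [RHS]mulrAC.
case: n {IH h} => [|n]; first by rewrite /= !expr0; ring.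
by rewrite /= exprS; ring.
Qed.

Let is_cderive_monomial f g (h : R -> R) x u v c j k :
    is_cderive f x u -> is_cderive g x v -> is_derive x 1 h (c * h x) ->
  is_cderive (fun x => f x ^+ j * g x ^+ k * (h x)%:C) x
   (j%:R * u * (f x ^+ j.-1 * g x ^+ k * (h x)%:C) +
    k%:R * v * (f x ^+ j * g x ^+ k.-1 * (h x)%:C) +
    c%:C * (f x ^+ j * g x ^+ k * (h x)%:C)).
Proof.
move=> df dg dh.
have dh' : is_cderive (fun x => (h x)%:C) x (c%:C * (h x)%:C).
  by split; [rewrite /= mul0r subr0|rewrite /= !(mul0r,mulr0) addr0; exact: pderive_cst].
apply: (is_cderive_eq (is_cderiveM (is_cderiveM (is_cderiveX j df) (is_cderiveX k dg)) dh')).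
ring.
Qed.

Let expR_normsq_x (x y : R) : is_derive x 1 (fun x => expR (- (N * normsq (x, y))))
  ((- (2 * N * x)) * expR (- (N * normsq (x, y)))).
Proof.
have -> : (fun x : R => expR (- (N * normsq (x, y)))) =
  fun x => expR (- (N * (x ^+ 2 + y ^+ 2))) by apply/funext => t; rewrite normsqE.
apply: (is_derive_eq (pderive_expR (pderiveN (pderiveM (pderive_cst N x)
  (pderiveD (pderiveX 2 (pderive_id x)) (pderive_cst (y ^+ 2) x)))))).
by rewrite normsqE/=; ring.
Qed.

Let expR_normsq_y (x y : R) : is_derive y 1 (fun y => expR (- (N * normsq (x, y))))
  ((- (2 * N * y)) * expR (- (N * normsq (x, y)))).
Proof.
have -> : (fun y : R => expR (- (N * normsq (x, y)))) =
  fun y => expR (- (N * (x ^+ 2 + y ^+ 2))) by apply/funext => t; rewrite normsqE.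
apply: (is_derive_eq (pderive_expR (pderiveN (pderiveM (pderive_cst N y)
  (pderiveD (pderive_cst (x ^+ 2) y) (pderiveX 2 (pderive_id y))))))).
by rewrite normsqE/=; ring.
Qed.

Local Notation ii := (Complex (0 : R) 1).

(** The partial derivatives of a Gaussian monomial, again as combinations of such monomials: the
    factors x and y that come from the exponential are (z + zbar) / 2 and (z - zbar) / (2 i). The
    truncated predecessor is harmless, its coefficient being [0]. *)
Let monomial_dx j k z : R[i] :=
  j%:R * gauss_monomial j.-1 k z + k%:R * gauss_monomial j k.-1 z +
  (- N)%:C * (gauss_monomial j.+1 k z + gauss_monomial j k.+1 z).

Let monomial_dy j k z : R[i] :=
  j%:R * ii * gauss_monomial j.-1 k z + (- k%:R * ii) * gauss_monomial j k.-1 z +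
  N%:C * ii * (gauss_monomial j.+1 k z + (- 1) * gauss_monomial j k.+1 z).

Let is_cderive_x j k (x y : R) :
  is_cderive (fun x => gauss_monomial j k (x, y)) x (monomial_dx j k (x, y)).
Proof.
have d1 : is_cderive (fun x => affix (x, y)) x 1.
  by split; [exact: pderive_id|exact: pderive_cst].
have d2 : is_cderive (fun x => affixbar (x, y)) x 1.
  by split; [exact: pderive_id|exact: (pderive_cst (- y) x)].
apply: (is_cderive_eq (is_cderive_monomial j k d1 d2 (expR_normsq_x x y))).
have -> : (- (2 * N * x))%:C = (- N)%:C * (affix (x, y) + affixbar (x, y)) :> R[i].
  by apply/eqP; rewrite eq_complex; apply/andP; split; apply/eqP => /=; ring.
rewrite /monomial_dx /gauss_monomial !exprS; ring.
Qed.

Let is_cderive_y j k (x y : R) :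
  is_cderive (fun y => gauss_monomial j k (x, y)) y (monomial_dy j k (x, y)).
Proof.
have d1 : is_cderive (fun y => affix (x, y)) y ii.
  by split; [exact: pderive_cst|exact: pderive_id].
have d2 : is_cderive (fun y => affixbar (x, y)) y (- ii).
  split; first by rewrite /= oppr0; exact: pderive_cst.
  by apply: pderiveN; exact: pderive_id.
apply: (is_cderive_eq (is_cderive_monomial j k d1 d2 (expR_normsq_y x y))).
have -> : (- (2 * N * y))%:C = N%:C * ii * (affix (x, y) - affixbar (x, y)) :> R[i].
  by apply/eqP; rewrite eq_complex; apply/andP; split; apply/eqP => /=; ring.
rewrite /monomial_dy /gauss_monomial !exprS; ring.
Qed.

Lemma tempered_gauss_monomial j k : tempered (gauss_monomial j k).
Proof.
have mZ : cmeasurable affix by split; [exact: measurable_fst|exact: measurable_snd].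
have mZb : cmeasurable affixbar.
  split; first exact: measurable_fst.
  exact: (measurableT_comp (@oppr_measurable R setT) measurable_snd).
split.
- apply: cmeasurableM; first by apply: cmeasurableM; exact: cmeasurableX.
  split; last exact: measurable_cst.
  apply: (measurableT_comp (@measurable_expR R)).
  apply: (measurableT_comp (@oppr_measurable R setT)); apply: measurable_funM => //.
- exact: gauss_monomial_bounded.
- by move=> y; split; apply: is_derive_continuous => x; have [] := is_cderive_x j k x y;
    [move=> h _; exact: h|move=> _ h; exact: h].
- by move=> x; split; apply: is_derive_continuous => y; have [] := is_cderive_y j k x y;
    [move=> h _; exact: h|move=> _ h; exact: h].
Qed.

Let M j k := cintegral dA (gauss_monomial j k).

Let tmd_x j k : tempered (monomial_dx j k).
Proof.
by do ?[apply: temperedD|apply: temperedZ|exact: tempered_gauss_monomial].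
Qed.

Let tmd_y j k : tempered (monomial_dy j k).
Proof.
by do ?[apply: temperedD|apply: temperedZ|exact: tempered_gauss_monomial].
Qed.

Let int_mono j k : cintegrable dA (gauss_monomial j k).
Proof. exact/tempered_integrable/tempered_gauss_monomial. Qed.

Let combination a b c d f1 f2 f3 f4 : cintegrable dA f1 -> cintegrable dA f2 ->
    cintegrable dA f3 -> cintegrable dA f4 ->
  cintegral dA (fun z => a * f1 z + b * f2 z + c * (f3 z + d * f4 z)) =
  a * cintegral dA f1 + b * cintegral dA f2 + c * (cintegral dA f3 + d * cintegral dA f4).
Proof.
move=> i1 i2 i3 i4; have i5 := cintegrableZ d i4; have i6 := cintegrableD i3 i5.
have i7 := cintegrableZ a i1; have i8 := cintegrableZ b i2.
rewrite (cintegralD (cintegrableD i7 i8) (cintegrableZ c i6)) (cintegralD i7 i8).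
by rewrite !cintegralZ// (cintegralD i3 i5) cintegralZ.
Qed.

Let moment_dx j k : j%:R * M j.-1 k + k%:R * M j k.-1 - N%:C * (M j.+1 k + M j k.+1) = 0.
Proof.
have [mG [bG1 bG2] cGx _] := tmd_x j k; have [mG1 mG2] := mG.
have [_ [bF1 bF2] _ _] := tempered_gauss_monomial j k.
have : cintegral dA (monomial_dx j k) = 0.
  have h1 := integral_partial_x_eq0 mG1 bF1 bG1 (fun x y => (is_cderive_x j k x y).1)
    (fun y => (cGx y).1).
  have h2 := integral_partial_x_eq0 mG2 bF2 bG2 (fun x y => (is_cderive_x j k x y).2)
    (fun y => (cGx y).2).
  by rewrite /cintegral h1 h2.
have -> : monomial_dx j k = fun z => j%:R * gauss_monomial j.-1 k z +
    k%:R * gauss_monomial j k.-1 z +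
    (- N%:C) * (gauss_monomial j.+1 k z + 1 * gauss_monomial j k.+1 z).
  by apply/funext => z; rewrite /monomial_dx mul1r rmorphN.
rewrite combination// mul1r /M => <-; ring.
Qed.

Let moment_dy j k : j%:R * M j.-1 k - k%:R * M j k.-1 + N%:C * (M j.+1 k - M j k.+1) = 0.
Proof.
have [mG [bG1 bG2] _ cGy] := tmd_y j k; have [mG1 mG2] := mG.
have [_ [bF1 bF2] _ _] := tempered_gauss_monomial j k.
have : cintegral dA (monomial_dy j k) = 0.
  have h1 := integral_partial_y_eq0 mG1 bF1 bG1 (fun x y => (is_cderive_y j k x y).1)
    (fun y => (cGy y).1).
  have h2 := integral_partial_y_eq0 mG2 bF2 bG2 (fun x y => (is_cderive_y j k x y).2)
    (fun y => (cGy y).2).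
  by rewrite /cintegral h1 h2.
rewrite combination// => h; rewrite /M.
have i0 : ii != 0 by rewrite eq_complex/= eqxx oner_eq0.
by apply: (mulfI i0); rewrite mulr0 -h; ring.
Qed.

Let NC_neq0 : (N%:C : R[i]) != 0.
Proof. by rewrite eq_complex/= eqxx andbT gt_eqF. Qed.

(** Adding i times the y-identity to the x-identity integrates the Wirtinger derivative in zbar,
    namely k z^j zbar^(k-1) - N z^(j+1) zbar^k times the Gaussian. The derivative in z gives
    [moment_recr]. *)
Let moment_recl j k : N%:C * M j.+1 k = k%:R * M j k.-1.
Proof.
have h : (2 : R[i]) != 0 by rewrite pnatr_eq0.
apply/(mulfI h)/eqP; rewrite -subr_eq0; apply/eqP.
transitivity ((j%:R * M j.-1 k - k%:R * M j k.-1 + N%:C * (M j.+1 k - M j k.+1)) -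
  (j%:R * M j.-1 k + k%:R * M j k.-1 - N%:C * (M j.+1 k + M j k.+1))); first by ring.
by rewrite moment_dx moment_dy subrr.
Qed.

Let moment_recr j k : N%:C * M j k.+1 = j%:R * M j.-1 k.
Proof.
have h : (2 : R[i]) != 0 by rewrite pnatr_eq0.
apply/(mulfI h)/eqP; rewrite -subr_eq0; apply/eqP.
transitivity (- ((j%:R * M j.-1 k - k%:R * M j k.-1 + N%:C * (M j.+1 k - M j k.+1)) +
  (j%:R * M j.-1 k + k%:R * M j k.-1 - N%:C * (M j.+1 k + M j k.+1)))); first by ring.
by rewrite moment_dx moment_dy addr0 oppr0.
Qed.

Let M00 : M 0 0 = (N^-1)%:C.
Proof.
have gi := integrable_gauss N_gt0.
have gE : \int[mu]_x expR (- (N * x ^+ 2)) = Num.sqrt pi / Num.sqrt N.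
  by rewrite /Rintegral (ge0_integral_gauss N_gt0).
have [[r1 _] [r2 _] _ _] := tempered_gauss_monomial 0 0.
have E z : gauss_monomial 0 0 z = (expR (- (N * normsq z)))%:C.
  by rewrite /gauss_monomial !expr0 !mul1r.
rewrite /M (eq_cintegral _ E) /cintegral/=; congr Complex; last first.
  by rewrite /Rintegral integral0.
have [_ i2] := gauss_bounded_sections r1 r2.
have j1 : dA.-integrable setT (fun z => (expR (- (N * normsq z)))%:E).
  by apply: eq_integrable (gauss_bounded_integrable r1 r2) => // z _; rewrite E.
have j2 (x : R) : mu.-integrable setT (fun y : R => (expR (- (N * normsq (x, y))))%:E).
  by apply: eq_integrable (i2 x) => // y _; rewrite E.
rewrite (Rintegral_dA12 j1 j2).
transitivity (pi^-1 * \int[mu]_x ((\int[mu]_y expR (- (N * y ^+ 2))) *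
    expR (- (N * x ^+ 2)))).
  apply: (congr1 ( *%R _)); apply: eq_Rintegral => x _.
  rewrite [RHS]mulrC -(RintegralZl _ measurableT gi); apply: eq_Rintegral => y _.
  by rewrite normsqE mulrDr opprD expRD.
rewrite (RintegralZl _ measurableT gi) gE.
have p0 : Num.sqrt pi * Num.sqrt pi = pi :> R by rewrite -expr2 sqr_sqrtr// pi_ge0.
have N0 : Num.sqrt N * Num.sqrt N = N by rewrite -expr2 sqr_sqrtr// ltW.
by rewrite mulf_div p0 N0 mulrA mulVf ?mul1r// gt_eqF// pi_gt0.
Qed.

(** The recursions lower both exponents together. Off the diagonal one exponent reaches [0] first,
    and the coefficient there is [0]; on the diagonal the factors accumulate to j! / N^j times the
    mass of the Gaussian. *)
Lemma gauss_moment j k :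
  cintegral dA (gauss_monomial j k) = if j == k then (j`!%:R / N ^+ j.+1)%:C else 0.
Proof.
rewrite -/(M j k); elim: j k => [|j IH] [|k].
- by rewrite M00 eqxx fact0 mul1r expr1.
- by apply: (mulfI NC_neq0); rewrite moment_recr/= mul0r mulr0.
- by apply: (mulfI NC_neq0); rewrite moment_recl/= mul0r mulr0.
- apply: (mulfI NC_neq0); rewrite moment_recl/= IH eqSS.
  case: eqP => [->|_]; last by rewrite !mulr0.
  rewrite -(rmorph_nat (real_complex R)) -!rmorphM; congr real_complex_def.
  by rewrite factS natrM !exprS; field; rewrite expf_neq0 gt_eqF.
Qed.

End gaussian_moments.

(** * The squared Vandermonde determinant and the Gibbs weight *)

Section vandermonde.
Context {R : realType}.
Import complex.
Local Open Scope complex_scope.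
Implicit Types (n : nat).

Lemma affixB (z w : plane R) : affix (z - w) = affix z - affix w.
Proof. by []. Qed.

Lemma affixbarB (z w : plane R) : affixbar (z - w) = affixbar z - affixbar w.
Proof. by rewrite /affixbar /= opprD. Qed.

Definition vandermonde_sqr n (z : n.-tuple (plane R)) : R :=
  \prod_(i < n) \prod_(j < n | (i < j)%N) normsq (tnth z j - tnth z i).

(** The squared modulus is the Vandermonde determinant in the z's times the one in their conjugates;
    each is expanded by Leibniz's formula. *)
Lemma vandermonde_sqrE n (z : n.-tuple (plane R)) : (vandermonde_sqr z)%:C =
  \sum_(s : 'S_n) \sum_(t : 'S_n) (-1) ^+ s * (-1) ^+ t *
    \prod_l (affix (tnth z l) ^+ s l * affixbar (tnth z l) ^+ t l).
Proof.
pose V (f : plane R -> R[i]) := Vandermonde n (\row_j f (tnth z j)).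
have E f : \det (V f) = \sum_(s : 'S_n) (-1) ^+ s * \prod_l f (tnth z l) ^+ s l.
  rewrite -det_tr /determinant; apply: eq_bigr => s _; congr (_ * _).
  by apply: eq_bigr => l _; rewrite !mxE.
transitivity (\det (V (@affix R)) * \det (V (@affixbar R))).
  rewrite !det_Vandermonde -big_split/= rmorph_prod; apply: eq_bigr => i _.
  rewrite -big_split/= rmorph_prod; apply: eq_bigr => j _.
  by rewrite !mxE -affixB -affixbarB affix_affixbar.
rewrite !E big_distrl/=; apply: eq_bigr => s _; rewrite big_distrr/=.
by apply: eq_bigr => t _; rewrite big_split/= mulrACA.
Qed.

Lemma measurable_vandermonde_sqr n : measurable_fun setT (@vandermonde_sqr n).
Proof.
have mp (I : Type) (s : seq I) (P : pred I) (F : I -> n.-tuple (plane R) -> R) :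
    (forall i, measurable_fun setT (F i)) ->
    measurable_fun setT (fun z => \prod_(i <- s | P i) F i z).
  move=> mF; elim: s => [|i s IH].
    by under eq_fun do rewrite big_nil; exact: measurable_cst.
  under eq_fun do rewrite big_cons.
  by case: (P i); [exact: measurable_funM|exact: IH].
apply: (mp) => i; apply: (mp) => j.
apply: (measurableT_comp (@measurable_normsq R)).
have mt l := @measurable_tnth _ (plane R) n l.
by apply/measurable_fun_pairP; split; apply: measurable_funB;
  by [exact: (measurableT_comp measurable_fst (mt _)) |
      exact: (measurableT_comp measurable_snd (mt _))].
Qed.

Lemma normsq_eq0 (z : plane R) : (normsq z == 0) = (z == 0).
Proof.
apply/eqP/eqP => [|->]; last by rewrite normsqE/= expr0n addr0.
rewrite normsqE; case: z => x y /= /eqP; rewrite paddr_eq0 ?sqr_ge0//.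
by rewrite !sqrf_eq0 => /andP[/eqP -> /eqP ->].
Qed.

Lemma vandermonde_sqr_eq0 n (z : n.-tuple (plane R)) :
  vandermonde_sqr z = 0 <-> exists i j : 'I_n, i != j /\ tnth z i = tnth z j.
Proof.
split.
- move=> /eqP; rewrite /vandermonde_sqr prodf_seq_eq0 => /hasP[i _] /andP[_].
  rewrite prodf_seq_eq0 => /hasP[j _] /andP[ij].
  rewrite normsq_eq0 subr_eq0 => /eqP e; exists i, j; split => //.
  by rewrite neq_ltn ij.
- have lt_case (i j : 'I_n) : (i < j)%N -> tnth z i = tnth z j -> vandermonde_sqr z = 0.
    move=> ij e; rewrite /vandermonde_sqr (bigD1 i)//= (bigD1 j)//=.
    by rewrite e subrr (_ : normsq _ = 0) ?mul0r//; apply/eqP; rewrite normsq_eq0.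
  move=> [i [j []]]; rewrite neq_ltn => /orP[ij|ji] e; first exact: lt_case e.
  by apply: lt_case ji _.
Qed.

Let seq_consE x (s : seq (plane R)) :
  [set z | z \in x :: s] = [set x] `|` [set z | z \in s].
Proof.
apply/seteqP; split => z /=; rewrite inE; first by move=> /orP[/eqP|]; [left|right].
by case=> [->|->]; rewrite ?eqxx ?orbT.
Qed.

Let measurable_seq (s : seq (plane R)) : measurable [set z | z \in s].
Proof.
elim: s => [|y s IH]; first by rewrite (_ : [set _ | _] = set0)//; apply/seteqP; split.
by rewrite seq_consE; apply: measurableU => //; exact: measurable_plane_set1.
Qed.

Let dA_seq (s : seq (plane R)) : dA [set z | z \in s] = 0%E.
Proof.
elim: s => [|x s IH].
  by rewrite (_ : [set _ | _] = set0) ?measure0//; apply/seteqP; split.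
rewrite seq_consE measureU0//; [exact: dA_set1|exact: measurable_plane_set1].
Qed.

(** By Fubini: if the last [n] points are distinct, a coincidence forces the first point into a
    finite, hence null, set; the remaining configurations are null by induction. *)
Lemma dA_coincidence n : dA_ n [set z | vandermonde_sqr z = 0] = 0%E.
Proof.
have mK m : measurable [set z : m.-tuple (plane R) | vandermonde_sqr z = 0].
  rewrite -[X in measurable X]setTI.
  exact: (measurable_vandermonde_sqr measurableT (measurable_set1 (0 : R))).
elim: n => [|n IH].
  rewrite (_ : [set _ | _] = set0) ?measure0//; apply/seteqP; split=> // z.
  by move=> /= /vandermonde_sqr_eq0[[]].
rewrite /= /cons_measure /pushforward.
set A := _ @^-1` _.
have mA : measurable A.
  by rewrite -[A]setTI; exact: (@measurable_cons_point R n _ _ (mK _)).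
pose f p : \bar R := (\1_A p)%:E.
have mf : measurable_fun setT f by apply/measurable_EFinP; exact: measurable_indic.
have f0 p : (0 <= f p)%E by rewrite lee_fin.
have <- : (\int[(dA \x dA_ n)%E]_p f p)%E = (dA \x dA_ n)%E A.
  by rewrite integral_indic// setIT.
rewrite fubini_tonelli2// (@ae_eq_integral _ _ _ _ _ (cst 0%E))//.
- exact: integral0.
- exact: measurable_fun_fubini_tonelli_G.
exists [set z | vandermonde_sqr z = 0]; split; [exact: mK|exact: IH|].
move=> t /= Ht; apply: contrapT => Kt.
apply: Ht => _; rewrite /fubini_G.
have mAt : measurable (ysection A t) by exact: measurable_ysection.
transitivity (\int[dA]_p (\1_(ysection A t) p)%:E)%E.
  apply: eq_integral => p _; congr EFin; rewrite !indicE; congr (nat_of_bool _)%:R.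
  by apply/idP/idP; rewrite !inE /ysection/= inE.
rewrite integral_indic// setIT; apply/eqP; rewrite eq_le measure_ge0 andbT -(dA_seq t).
apply: le_measure; rewrite ?inE// => p; rewrite /ysection/= inE /A/=.
move=> /vandermonde_sqr_eq0[i [j []]].
have t0 : tnth (cons_point (p, t)) ord0 = p by [].
case: (unliftP ord0 i) => [i'|] ->; case: (unliftP ord0 j) => [j'|] -> //.
- rewrite !tnthS => ij e; exfalso; apply: Kt.
  by apply/vandermonde_sqr_eq0; exists i', j'.
- by rewrite tnthS t0 => _ <-; exact: mem_tnth.
- by rewrite tnthS t0 => _ ->; exact: mem_tnth.
Qed.

End vandermonde.

Section gibbs.
Context {R : realType}.
Import complex.
Local Open Scope complex_scope.
Variable n : nat.
Hypothesis n_gt0 : (0 < n)%N.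
Local Notation N := (n%:R : R).
Local Notation Q := (@normsq R).
Local Notation gauss p := (expR (- (N * normsq p))).
Implicit Types (z : n.-tuple (plane R)) (B : 'I_n -> set (plane R)) (S : set (plane R)).

Let N_gt0 : 0 < N. Proof. by rewrite ltr0n. Qed.

(** The energy runs over ordered pairs, so each distance enters twice and at beta = 1 appears
    squared. Distinct points are required for [ln] to be inverted by [expR]. *)
Lemma expR_hamiltonian z : vandermonde_sqr z != 0 ->
  expR (- 1 * hamiltonian Q z) = vandermonde_sqr z * \prod_l gauss (tnth z l).
Proof.
move=> Vz; pose c i j := cabs (tnth z i - tnth z j).
have c2 i j : c i j * c j i = normsq (tnth z j - tnth z i).
  have cC : c i j = c j i.
    rewrite /c /cabs; congr Num.sqrt; rewrite -[in LHS]sqrrN -[X in _ + X = _]sqrrN.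
    by rewrite /= !opprB.
  by rewrite cC -expr2.
have c_gt0 i j : j != i -> 0 < c i j.
  move=> ij; rewrite lt_neqAle sqrtr_ge0 andbT eq_sym; apply: contraNneq Vz => c0.
  apply/eqP/vandermonde_sqr_eq0; exists j, i; split => //.
  by apply/eqP; rewrite -subr_eq0 -normsq_eq0 -c2 c0 mul0r.
rewrite /hamiltonian mulN1r opprD expRD mulr_sumr -[X in expR (- _) * expR X]sumrN.
rewrite expR_sum; congr (_ * _).
rewrite -sumrN expR_sum.
transitivity (\prod_(i < n) \prod_(j < n | j != i) c i j).
  apply: eq_bigr => i _; rewrite -sumrN expR_sum; apply: eq_bigr => j ij.
  by rewrite -/(c i j) lnV ?posrE ?c_gt0// opprK lnK// posrE c_gt0.
transitivity ((\prod_(i < n) \prod_(j < n | (i < j)%N) c i j) *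
    \prod_(i < n) \prod_(j < n | (j < i)%N) c i j).
  rewrite -big_split/=; apply: eq_bigr => i _.
  rewrite (bigID (fun j : 'I_n => (i < j)%N))/=; congr (_ * _); apply: eq_bigl => j.
    by apply: andb_idl => ij; rewrite -val_eqE neq_ltn ij orbT.
  by rewrite -leqNgt [RHS]ltn_neqAle -val_eqE.
rewrite [X in _ * X](exchange_big_dep predT)//= -big_split/=.
by apply: eq_bigr => i _; rewrite -big_split/=; apply: eq_bigr => j _; rewrite c2.
Qed.

Definition moment S j k : R[i] :=
  cintegral dA (fun p => gauss_monomial N j k p * (\1_S p)%:C).

Let integrable_moment S j k : measurable S ->
  cintegrable dA (fun p => gauss_monomial N j k p * (\1_S p)%:C).
Proof.
move=> mS; have [i1 i2] := tempered_integrable N_gt0 (tempered_gauss_monomial N_gt0 j k).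
split; [apply: eq_integrable (Rintegrable_indicM mS i1)|
  apply: eq_integrable (Rintegrable_indicM mS i2)] => // p _.
- by congr EFin; case: (gauss_monomial N j k p) => u v /=; rewrite mulr0 subr0.
- by congr EFin; case: (gauss_monomial N j k p) => u v /=; rewrite mulr0 add0r.
Qed.

Lemma momentT j k : moment setT j k = if j == k then (j`!%:R / N ^+ j.+1)%:C else 0.
Proof.
rewrite -(gauss_moment N_gt0); apply: eq_cintegral => p.
by rewrite indicE in_setT mulr1.
Qed.

Definition box B : set (n.-tuple (plane R)) := [set z | forall l, B l (tnth z l)].

Let indic_box B z : \1_(box B) z = \prod_l \1_(B l) (tnth z l) :> R.
Proof.
rewrite indicE; case: (boolP (z \in box B)) => [/set_mem zB|zB].
  by rewrite big1// => l _; rewrite indicE mem_set//; exact: zB.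
have [l Bl] : exists l, ~ B l (tnth z l).
  by apply/existsNP => h; move: zB; rewrite mem_set.
by rewrite (bigD1 l)//= indicE memNset// mul0r.
Qed.

Lemma measurable_box B : (forall l, measurable (B l)) -> measurable (box B).
Proof.
move=> mB; have -> : box B = \bigcap_(l in [set: 'I_n]) [set z | B l (tnth z l)].
  by apply/seteqP; split => [z zB l _|z zB l]; [exact: zB|exact: zB].
apply: fin_bigcap_measurable => // l _.
by rewrite -[X in measurable X]setTI; exact: (measurable_tnth l measurableT (mB l)).
Qed.

(** After the double expansion every term is a product over the particles, and so is the indicator
    of a product set; each integral therefore factors into one-particle moments. *)
Lemma gibbs_weight_box B : (forall l, measurable (B l)) ->
  gibbs_weight Q 1 (box B) =
  (complex.Re (\sum_(s : 'S_n) \sum_(t : 'S_n) (-1) ^+ s * (-1) ^+ t *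
     \prod_l moment (B l) (s l) (t l)))%:E.
Proof.
move=> mB; pose F s t l p : R[i] := gauss_monomial N s t p * (\1_(B l) p)%:C.
have iF s t l : cintegrable dA (F s t l) by exact: integrable_moment.
pose g z : R[i] := \sum_(s : 'S_n) \sum_(t : 'S_n) (-1) ^+ s * (-1) ^+ t *
  \prod_l F (s l) (t l) l (tnth z l).
have T (s t : 'S_n) := cintegral_tuple (fun l => iF (s l) (t l) l).
have iP (s t : 'S_n) := (T s t).1; have EP (s t : 'S_n) := (T s t).2.
have gi : cintegrable (dA_ n) g.
  apply: cintegrable_sum => s; apply: cintegrable_sum => t; apply: cintegrableZ.
  exact: iP.
have gI : cintegral (dA_ n) g = \sum_(s : 'S_n) \sum_(t : 'S_n) (-1) ^+ s * (-1) ^+ t *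
    \prod_l moment (B l) (s l) (t l).
  rewrite cintegral_sum => [|s]; last first.
    by apply: cintegrable_sum => t; apply: cintegrableZ; exact: iP.
  apply: eq_bigr => s _; rewrite cintegral_sum => [|t]; last first.
    by apply: cintegrableZ; exact: iP.
  by apply: eq_bigr => t _; rewrite cintegralZ ?EP//; exact: iP.
have gE z : g z =
    (vandermonde_sqr z * (\prod_l gauss (tnth z l)) * \1_(box B) z)%:C.
  have CM (x y : R) : (x * y)%:C = x%:C * y%:C by rewrite rmorphM.
  have Cprod (h : 'I_n -> R) : (\prod_l h l)%:C = \prod_l (h l)%:C by rewrite rmorph_prod.
  rewrite !CM vandermonde_sqrE indic_box !Cprod -mulrA -big_split/=.
  rewrite mulr_suml; apply: eq_bigr => s _; rewrite mulr_suml; apply: eq_bigr => t _.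
  rewrite -[RHS]mulrA -big_split/=; congr (_ * _); apply: eq_bigr => l _.
  by rewrite /F /gauss_monomial -!mulrA.
have [gi1 _] := gi.
have mg := Rintegrable_measurable gi1.
have mbox := measurable_box mB.
transitivity (\int[dA_ n]_z (complex.Re (g z))%:E)%E; last first.
  by rewrite -gI -[LHS](fineK (integrable_fin_num measurableT gi1)).
rewrite /gibbs_weight integral_mkcond; apply: ae_eq_integral => //.
- apply/(measurable_restrictT _ mbox); apply: measurable_funTS; apply/measurable_EFinP.
  apply: (measurableT_comp (@measurable_expR R)).
  by apply: measurable_funM => //; exact: measurable_hamiltonian.
- exact/measurable_EFinP.
(* The Gibbs density and its polynomial form can differ only at coincidences, where the logarithm
   takes a default value. *)
exists [set z | vandermonde_sqr z = 0]; split; [|exact: dA_coincidence|].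
  rewrite -[X in measurable X]setTI.
  exact: (measurable_vandermonde_sqr measurableT (measurable_set1 (0 : R))).
move=> z /= Hz; apply: contrapT => Vz; apply: Hz => _.
rewrite gE/= patchE indicE; case: ifPn => _; last by rewrite mulr0.
by rewrite mulr1 expR_hamiltonian//; apply/eqP.
Qed.

End gibbs.

(** * Area of a disc and averages over small discs *)

Section disc.
Context {R : realType}.
Local Notation mu := (@lebesgue_measure R).

Definition disc (p : plane R) (e : R) : set (plane R) := [set z | cabs (z - p) < e].

Lemma measurable_disc p e : measurable (disc p e).
Proof.
have mf : measurable_fun setT (fun z : plane R => cabs (z - p)).
  apply: (measurableT_comp (@measurable_cabs R)).
  by apply/measurable_fun_pairP; split; apply: measurable_funB;
    [exact: measurable_fst|exact: measurable_cst|exact: measurable_snd|exact: measurable_cst].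
rewrite (_ : disc p e = setT `&` (fun z => cabs (z - p)) @^-1` `]-oo, e[%classic).
  exact: (mf measurableT _ (measurable_itv _)).
by rewrite setTI; apply/seteqP; split => z; rewrite /disc /= in_itv.
Qed.

Let pi2_gt0 : 0 < pi / 2 :> R. Proof. by rewrite divr_gt0 ?pi_gt0. Qed.

Let is_derive_sin_cos (x : R) : is_derive x 1 (fun t => 2^-1 * (t + sin t * cos t)) (cos x ^+ 2).
Proof.
apply: (is_derive_eq (pderiveM (pderive_cst 2^-1 x) (pderiveD (pderive_id x)
  (pderiveM (is_derive_sin x) (is_derive_cos x))))).
have := cos2Dsin2 x; move: (cos x) (sin x) => c s h.
have -> : s * - s = c ^+ 2 - 1 by rewrite -h; ring.
by field.
Qed.

(** The square root of a negative number is [0], so the integral lives on [[-1, 1]]; the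
    substitution x = sin t turns it into that of cos^2. *)
Let integral_half_disc : (\int[mu]_x (Num.sqrt (1 - x ^+ 2))%:E = (pi / 2)%:E)%E.
Proof.
have csqrt : continuous (fun x : R => Num.sqrt (1 - x ^+ 2)).
  move=> x; apply: (@continuous_comp _ _ _ (fun x : R => 1 - x ^+ 2) Num.sqrt).
    apply: (is_derive_continuous (fun x : R => pderiveD (pderive_cst 1 x)
      (pderiveN (pderiveX 2 (pderive_id x))))).
  exact: sqrt_continuous.
have dsin : (sin : R -> R)^`()%classic = cos.
  by apply/funext => x; rewrite derive1E; apply: derive_val; exact: is_derive_sin.
have csin : continuous (@sin R) by exact: continuous_sin.
have ccos : continuous (@cos R) by exact: continuous_cos.
transitivity (\int[mu]_(x in `[sin (- (pi / 2)), sin (pi / 2)]) (Num.sqrt (1 - x ^+ 2))%:E)%E.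
  rewrite [RHS]integral_mkcond; apply: eq_integral => x _.
  rewrite patchE sinN sin_pihalf; case: ifPn => // /negP xn; congr EFin.
  apply: ler0_sqrtr; rewrite subr_le0 leNgt; apply/negP => x1; apply: xn.
  rewrite inE/= in_itv/= -ler_norml -(@ler_pXn2r _ 2)// ?nnegrE//.
  by rewrite expr1n real_normK ?num_real// ltW.
rewrite (@integration_by_substitution_increasing R sin (fun x => Num.sqrt (1 - x ^+ 2))
  (- (pi / 2)) (pi / 2)); first last.
- exact: continuous_subspaceT.
- split; first by move=> x _; case: (is_derive_sin x).
    by apply: cvg_at_right_filter; exact: csin.
  by apply: cvg_at_left_filter; exact: csin.
- by rewrite dsin; apply: cvgP; apply: cvg_at_left_filter; exact: ccos.
- by rewrite dsin; apply: cvgP; apply: cvg_at_right_filter; exact: ccos.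
- by rewrite dsin => x _; exact: ccos.
- by move=> x y hx hy; rewrite ltr_sin.
- by have := pi2_gt0; lra.
transitivity (\int[mu]_(x in `[(- (pi / 2))%R, (pi / 2)%R]) (cos x ^+ 2)%:E)%E.
  apply: eq_integral => x; rewrite inE/= => /[dup] xi; rewrite in_itv/= => /andP[x1 x2].
  transitivity (Num.sqrt (1 - sin x ^+ 2) * cos x)%:E; first by rewrite dsin.
  by rewrite -cos2sin2 sqrtr_sqr ger0_norm ?expr2//; apply: cos_ge0_pihalf; rewrite x1.
rewrite (@continuous_FTC2 R _ (fun t => 2^-1 * (t + sin t * cos t))).
- rewrite cosN cos_pihalf !mulr0 !addr0 -EFinB; congr EFin; by field.
- by rewrite gtrN.
- apply: continuous_subspaceT => x.
  exact: (is_derive_continuous (fun x : R => pderiveX 2 (is_derive_cos x))).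
- have c := is_derive_continuous is_derive_sin_cos.
  split; first by move=> x _; case: (is_derive_sin_cos x).
    by apply: cvg_at_right_filter; exact: c.
  by apply: cvg_at_left_filter; exact: c.
- by move=> x _; rewrite derive1E; apply: derive_val; exact: is_derive_sin_cos.
Qed.

(** With this normalisation of [dA], the factor [eps ^- 2] in [one_point] turns integrals over discs
    into averages. *)
Lemma dA_disc p e : 0 < e -> dA (disc p e) = (e ^+ 2)%:E.
Proof.
move=> e0; have mD := measurable_disc p e.
have -> : dA (disc p e) = (\int[dA]_z (\1_(disc p e) z)%:E)%E.
  by rewrite integral_indic// setIT.
rewrite ge0_integral_dA12//; last first.
  by apply/measurable_EFinP; exact: measurable_indic.
(* Half the length of the vertical chord at abscissa [x]; it is [0] when the line misses the
   disc. *)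
pose t (x : R) : R := Num.sqrt (e ^+ 2 - (x - p.1) ^+ 2).
have E x : (\int[mu]_y (\1_(disc p e) (x, y))%:E = (2 * t x)%:E)%E.
  transitivity (\int[mu]_y (\1_(`]p.2 - t x, p.2 + t x[%classic) y)%:E)%E.
    apply: eq_integral => y _; rewrite !indicE; congr (nat_of_bool _)%:R%:E.
    apply/idP/idP; rewrite !inE /disc /cabs /= in_itv/= -ltr_distl.
    - move=> h; rewrite -(sqrtr_sqr (y - p.2)) ltr_sqrt; last first.
        rewrite subr_gt0; apply: le_lt_trans (_ : (x - p.1) ^+ 2 + (y - p.2) ^+ 2 < _).
          by rewrite lerDl sqr_ge0.
        rewrite -(@ltr_sqrt _ _ (e ^+ 2)) ?exprn_gt0//.
        by rewrite sqrtr_sqr (gtr0_norm e0).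
      rewrite ltrBrDl -(@ltr_sqrt _ _ (e ^+ 2)) ?exprn_gt0//.
      by rewrite sqrtr_sqr (gtr0_norm e0).
    - move=> h; have tp : 0 < t x by apply: le_lt_trans h.
      have : (y - p.2) ^+ 2 < t x ^+ 2.
        by rewrite -(real_normK (num_real _)) ltr_pXn2r ?nnegrE// ltW.
      have rp : 0 < e ^+ 2 - (x - p.1) ^+ 2 by rewrite -sqrtr_gt0.
      rewrite sqr_sqrtr ?(ltW rp)//.
      rewrite ltrBrDl => h3.
      by rewrite -[ltRHS](gtr0_norm e0) -sqrtr_sqr ltr_sqrt ?exprn_gt0.
  transitivity (mu (`]p.2 - t x, p.2 + t x[%classic : set R)).
    by rewrite integral_indic// setIT.
  rewrite lebesgue_measure_itv/= lte_fin.
  have t0 : 0 <= t x by exact: sqrtr_ge0.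
  case: ifPn => [_|]; first by rewrite -EFinB; congr EFin; ring.
  by rewrite -leNgt => h; congr EFin; lra.
transitivity ((pi^-1)%:E * \int[mu]_x (2 * t x)%:E)%E.
  by congr (_ * _)%E; apply: eq_integral => x _; exact: E.
have ct : continuous (fun x : R => 2 * t x).
  move=> x; apply: cvgM; first exact: cvg_cst.
  apply: (@continuous_comp _ _ _ (fun x : R => e ^+ 2 - (x - p.1) ^+ 2) Num.sqrt).
    apply: (is_derive_continuous (fun x : R => pderiveD (pderive_cst (e ^+ 2) x)
      (pderiveN (pderiveX 2 (pderiveD (pderive_id x) (pderive_cst (- p.1) x)))))).
  exact: sqrt_continuous.
have t0 x : 0 <= 2 * t x by rewrite mulr_ge0// sqrtr_ge0.
rewrite (integral_affine p.1 e0 ct t0).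
transitivity ((pi^-1)%:E * ((2 * e ^+ 2)%:E * \int[mu]_x (Num.sqrt (1 - x ^+ 2))%:E))%E.
  congr (_ * _)%E; rewrite -ge0_integralZl//=.
  - apply: eq_integral => x _; rewrite -EFinM; congr EFin; rewrite /t.
    have -> : e ^+ 2 - (p.1 + e * x - p.1) ^+ 2 = e ^+ 2 * (1 - x ^+ 2) by ring.
    by rewrite sqrtrM ?sqr_ge0// sqrtr_sqr (gtr0_norm e0); ring.
  - apply/measurable_EFinP; apply: continuous_measurable_fun => x.
    apply: (@continuous_comp _ _ _ (fun x : R => 1 - x ^+ 2) Num.sqrt).
      apply: (is_derive_continuous (fun x : R => pderiveD (pderive_cst 1 x)
        (pderiveN (pderiveX 2 (pderive_id x))))).
    exact: sqrt_continuous.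
  - by rewrite lee_fin mulr_ge0// sqr_ge0.
rewrite integral_half_disc -!EFinM; congr EFin.
by move: (pi_gt0 R); move: pi => q q0; field; rewrite gt_eqF.
Qed.

Lemma disc_average (f : plane R -> R) p : {for p, continuous f} ->
    dA.-integrable setT (fun z => (f z)%:E) ->
  e ^- 2 * (\int[dA]_z (f z * \1_(disc p e) z)) @[e --> 0^'+] --> f p.
Proof.
move=> cf fi; apply/cvgrPdist_le => /= r r0.
have /nbhs_ballP[d /= d0 hd] : \forall z \near p, `|f p - f z| <= r.
  by move/cvgrPdist_le : cf; exact.
near=> e.
have e0 : 0 < e by near: e; exact: nbhs_right_gt.
have ed : e <= d by near: e; exact: nbhs_right_le.
have mD := measurable_disc p e.
have near_p z : disc p e z -> `|f z - f p| <= r.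
  move=> pz; rewrite distrC; apply: hd; have h := lt_le_trans pz ed.
  have c0 (u v : R) : `|u| <= Num.sqrt (u ^+ 2 + v ^+ 2).
    by rewrite -sqrtr_sqr ler_sqrt ?addr_ge0 ?sqr_ge0// lerDl sqr_ge0.
  split; rewrite /ball/= distrC; apply: le_lt_trans h; rewrite /cabs.
    exact: c0.
  by rewrite [X in Num.sqrt X]addrC; exact: c0.
have [iI IE] := Rintegral_indic mD (dA_disc p e0).
have ifI := Rintegrable_indicM mD fi.
have b z : (f p - r) * \1_(disc p e) z <= f z * \1_(disc p e) z <= (f p + r) * \1_(disc p e) z.
  rewrite indicE; case: (boolP (z \in disc p e)) => [/set_mem/near_p|_].
    by rewrite !mulr1 ler_norml => /andP[? ?]; apply/andP; split; lra.
  by rewrite !mulr0 lexx.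
have h1 := le_Rintegral measurableT (RintegrableZl (f p - r) iI) ifI
  (fun z _ => (andP (b z)).1).
have h2 := le_Rintegral measurableT ifI (RintegrableZl (f p + r) iI)
  (fun z _ => (andP (b z)).2).
rewrite (RintegralZl _ measurableT iI) IE in h1.
rewrite (RintegralZl _ measurableT iI) IE in h2.
have e2 : 0 < e ^+ 2 by rewrite exprn_gt0.
rewrite mulrC ler_distlC; apply/andP; split.
- by rewrite ler_pdivlMr.
- by rewrite ler_pdivrMr.
Unshelve. all: end_near. Qed.

End disc.

(** * The one-point function by orthogonality *)

Section ginibre.
Context {R : realType}.
Import complex.
Local Open Scope complex_scope.
Variable m : nat.
Local Notation n := m.+1.
Local Notation N := (n%:R : R).
Local Notation Q := (@normsq R).
Local Notation gauss p := (expR (- (N * normsq p))).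
Implicit Types (S : set (plane R)) (p : plane R).

Let N_gt0 : 0 < N. Proof. by rewrite ltr0n. Qed.

Definition radial_moment S k : R :=
  \int[dA]_p (normsq p ^+ k * gauss p * \1_S p).

(** The squared norm of z^k for the weight e^(-N |z|^2) dA. *)
Let h k : R := k`!%:R / N ^+ k.+1.

Let h_gt0 k : 0 < h k.
Proof. by rewrite divr_gt0 ?exprn_gt0// ltr0n fact_gt0. Qed.

Let CM (x y : R) : (x * y)%:C = x%:C * y%:C :> R[i].
Proof. by rewrite rmorphM. Qed.

Let CX (x : R) k : (x ^+ k)%:C = x%:C ^+ k :> R[i].
Proof. by rewrite rmorphXn. Qed.

Let moment_diag S k : moment n S k k = (radial_moment S k)%:C.
Proof.
have E q : gauss_monomial N k k q * (\1_S q)%:C = (normsq q ^+ k * gauss q * \1_S q)%:C :> R[i].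
  by rewrite !CM /gauss_monomial -exprMn affix_affixbar CX.
rewrite /moment (eq_cintegral _ E) /cintegral /radial_moment/=; congr Complex.
by rewrite /Rintegral integral0.
Qed.

Let radial_momentT k : radial_moment setT k = h k.
Proof.
by have := moment_diag setT k; rewrite momentT// eqxx => /(congr1 (@complex.Re R))/= <-.
Qed.

(** Every coordinate except [i] ranges over the whole plane, so orthogonality forces the two
    permutations to agree away from [i], hence everywhere. The diagonal terms have sign 1, and
    dividing by the full product of norms isolates the factor at [s i]. *)
Lemma gibbs_weight_one S i : measurable S ->
  gibbs_weight Q 1 [set z : n.-tuple (plane R) | S (tnth z i)] =
  ((\sum_(s : 'S_n) radial_moment S (s i) / h (s i)) * \prod_k h (val (k : 'I_n)))%:E.
Proof.
move=> mS; pose B l : set (plane R) := if l == i then S else setT.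
have -> : [set z : n.-tuple (plane R) | S (tnth z i)] = box B.
  apply/seteqP; split => z /= Sz; first by move=> l; rewrite /B; case: eqP => [->|].
  by have := Sz i; rewrite /B eqxx.
rewrite gibbs_weight_box//; last by move=> l; rewrite /B; case: ifP.
congr EFin; set T := (X in complex.Re X).
suff -> : T = ((\sum_(s : 'S_n) radial_moment S (s i) / h (s i)) *
  \prod_k h (val (k : 'I_n)))%:C by [].
rewrite CM {}/T rmorph_sum mulr_suml; apply: eq_bigr => s _.
rewrite (bigD1 s)//= [X in _ + X]big1 ?addr0.
- rewrite -signr_addb addbb expr0 mul1r -CM.
  have -> : \prod_k h (val (k : 'I_n)) = \prod_k h (s k).
    by rewrite (reindex_inj (@perm_inj _ s)).
  rewrite (bigD1 i)//= /B eqxx moment_diag.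
  under eq_bigr => l li do rewrite (negbTE li) moment_diag radial_momentT.
  have -> : \prod_(l < n | l != i) (h (s l))%:C = (\prod_(l < n | l != i) h (s l))%:C :> R[i].
    by rewrite rmorph_prod.
  rewrite -[LHS]CM.
  have -> : radial_moment S (s i) / h (s i) * \prod_(k < n) h (s k) =
      radial_moment S (s i) * \prod_(l < n | l != i) h (s l); last by [].
  by rewrite (bigD1 i)//= mulrA divfK// gt_eqF.
- move=> t ts.
  suff [l [li lst]] : exists l, l != i /\ s l != t l.
    rewrite (bigD1 l)//= /B (negbTE li) momentT//.
    by rewrite (_ : (s l == t l :> nat) = false) ?mul0r ?mulr0//; exact/negbTE.
  apply: contrapT => hst.
  have agree l : l != i -> s l = t l.
    by move=> li; apply/eqP/negP => /negP lst; apply: hst; exists l.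
  move/eqP: ts; apply; apply/permP => l; have [->|/agree//] := eqVneq l i.
  pose l' := (s^-1)%g (t i); have sl' : s l' = t i by rewrite permKV.
  have [l'i|/agree] := eqVneq l' i; first by rewrite -sl' l'i.
  rewrite sl' => /perm_inj il'; by rewrite -sl' -il'.
Qed.

Lemma coulomb_gas_one S i : measurable S ->
  coulomb_gas Q 1 n [set z | S (tnth z i)] =
  ((\sum_(s : 'S_n) radial_moment S (s i) / h (s i)) / #|{perm 'I_n}|%:R)%:E.
Proof.
move=> mS; have P0 : 0 < \prod_k h (val (k : 'I_n)) by apply: prodr_gt0.
have c0 : 0 < #|{perm 'I_n}|%:R :> R.
  by rewrite ltr0n; apply/card_gt0P; exists 1%g.
(* The partition function is n! times the product of the norms, finite and positive; this rules out
   the Dirac branch of the normalisation. *)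
have W1 : gibbs_weight Q 1 [set: n.-tuple (plane R)] =
    (#|{perm 'I_n}|%:R * \prod_k h (val (k : 'I_n)))%:E.
  have -> : [set: n.-tuple (plane R)] = [set z | setT (tnth z ord0)] by [].
  rewrite gibbs_weight_one//; congr (_ * _)%:E.
  rewrite (eq_bigr (fun=> 1)) ?sumr_const// => s _.
  by rewrite radial_momentT divff// gt_eqF.
transitivity ((let ev := gibbs_weight Q 1 [set: n.-tuple (plane R)] in
    if (ev == 0%E) || (ev == +oo%E) then \d_(nseq_tuple n (0 : plane R)) : set _ -> \bar R
    else fun U => (gibbs_weight Q 1 U * ((fine ev)^-1)%:E)%E) [set z | S (tnth z i)]).
  by [].
rewrite /= W1 ifF; last first.
  by rewrite orbF eqe gt_eqF// mulr_gt0.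
rewrite gibbs_weight_one// -EFinM; congr EFin => /=.
by rewrite invfM mulrACA divff ?mulr1// gt_eqF.
Qed.

(** By linearity the expected count is a sum of one-particle probabilities. For each fixed
    permutation, reindexing the sum over particles gives the same sum over [k], so averaging over
    permutations changes nothing. *)
Lemma expectation_nparticles p e : 0 < e ->
  fine ('E_(coulomb_gas Q 1 n) [fun z => (nparticles p e z)%:R])%E =
  \sum_(k < n) radial_moment (disc p e) k / h k.
Proof.
move=> e0; have mD := measurable_disc p e.
pose A i := [set z : n.-tuple (plane R) | disc p e (tnth z i)].
have mA i : measurable (A i).
  by rewrite -[A i]setTI; exact: (measurable_tnth i measurableT mD).
have E z : (nparticles p e z)%:R = \sum_(i < n) \1_(A i) z :> R.
  rewrite /nparticles -sum1_card big_mkcond natr_sum; apply: eq_bigr => i _.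
  rewrite indicE; case: ifPn => h1.
    by rewrite mem_set.
  by rewrite memNset// => h2; move: h1; rewrite inE /= h2.
have c0 : 0 < #|{perm 'I_n}|%:R :> R.
  by rewrite ltr0n; apply/card_gt0P; exists 1%g.
rewrite unlock.
transitivity (fine (\sum_(i < n) coulomb_gas Q 1 n (A i))%E).
  apply: (congr1 fine).
  transitivity (\int[coulomb_gas Q 1 n]_z (\sum_(i < n) (\1_(A i) z)%:E))%E.
    by apply: eq_integral => z _; rewrite E sumEFin.
  rewrite ge0_integral_sum//.
  - by apply: eq_bigr => i _; rewrite integral_indic// setIT.
  - by move=> i; apply/measurable_EFinP; exact: measurable_indic.
under eq_bigr do rewrite coulomb_gas_one//.
rewrite sumEFin/= -mulr_suml exchange_big/=.
rewrite (eq_bigr (fun=> \sum_(k < n) radial_moment (disc p e) k / h k)); last first.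
  by move=> s _; rewrite [RHS](reindex_inj (@perm_inj _ s)).
by rewrite sumr_const -[X in X / _]mulr_natr mulfK// gt_eqF.
Qed.

(** Disc averages of a continuous integrand converge to its value at [p], and |p|^(2k) e^(-N |p|^2)
    / h k is [N] times the Poisson weight of [k] at mean N |p|^2. *)
Lemma one_point_ginibre p :
  one_point Q 1 n p = N * erlang_tail m (N * normsq p).
Proof.
rewrite /one_point; apply/cvg_lim => //.
have cvg_k (k : 'I_n) : e ^- 2 * radial_moment (disc p e) k / h k @[e --> 0^'+] -->
    normsq p ^+ k * gauss p / h k.
  apply: cvgM; last exact: cvg_cst.
  apply: (@disc_average R (fun z => normsq z ^+ k * gauss z)).
  - pose F s : R := s ^+ k * expR (- (N * s)).
    have cF : continuous F.
      exact: (is_derive_continuous (fun s : R => pderiveM (pderiveX k (pderive_id s))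
        (pderive_expR (pderiveN (pderiveM (pderive_cst N s) (pderive_id s)))))).
    apply: (@continuous_comp _ _ _ (@normsq R) F); last exact: cF.
    have -> : @normsq R = fun z => z.1 * z.1 + z.2 * z.2.
      by apply/funext => z; rewrite normsqE !expr2.
    by apply: cvgD; apply: cvgM; [exact: cvg_fst|exact: cvg_fst|exact: cvg_snd|exact: cvg_snd].
  - have [i1 _] := tempered_integrable N_gt0 (tempered_gauss_monomial N_gt0 k k).
    apply: eq_integrable i1 => // z _; congr EFin.
    by rewrite /gauss_monomial -exprMn affix_affixbar -CX -CM.
have -> : N * erlang_tail m (N * normsq p) = \sum_(k < n) normsq p ^+ k * gauss p / h k.
  rewrite /erlang_tail mulr_sumr; apply: eq_bigr => k _.
  rewrite /erlang /h exprMn exprS; field.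
  apply/and3P; split; apply: lt0r_neq0; first exact: exprn_gt0.
    by rewrite nat1r.
  by rewrite ltr0n fact_gt0.
have S : \sum_(k < n) (e ^- 2 * radial_moment (disc p e) k / h k) @[e --> 0^'+] -->
    \sum_(k < n) normsq p ^+ k * gauss p / h k.
  apply: cvg_big => //; first exact: add_continuous.
apply: cvg_trans S; apply: near_eq_cvg; near=> e.
have e0 : 0 < e by near: e; exact: nbhs_right_gt.
rewrite expectation_nparticles// mulr_sumr; by apply: eq_bigr => k _; rewrite mulrA.
Unshelve. all: end_near. Qed.

End ginibre.

(** * Distance of the two densities near the edge *)

Section logarithm_of_ginibre_density.
Context {R : realType}.
Variables (a k : R) (m : nat).
Hypothesis k_gt0 : 0 < k.
Local Notation N := (m.+2%:R : R).
Local Notation q s := (erlang_tail m.+1 s).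
Local Notation w s := (erlang m.+1 s).
Local Notation phi := (phi a k).
Local Notation psi := (psi a k).
Local Notation inbox := (inbox a k).
Implicit Types (s : R) (z : plane R).

(** In s = N |z|^2 this is minus 1/N times d dbar of ln rho, so that E = rho - 1 + [tail_defect].
    Here N = m + 2, so that the weight [erlang m.+1] and its derivative are expressed by [erlang m]
    and [erlang m.+1]. *)
Definition tail_defect s : R := (N - s) * (w s / q s) + s * (w s / q s) ^+ 2.

Let dN s : is_derive s 1 (fun s => N * s) N.
Proof.
by apply: (is_derive_eq (pderiveM (pderive_cst N s) (pderive_id s))); ring.
Qed.

Let dq s : is_derive s 1 (fun s => q (N * s)) (N * - w (N * s)).
Proof. exact: (pderive_comp (dN s) (is_derive_erlang_tail m.+1 (N * s))). Qed.

Let dw s : is_derive s 1 (fun s => w (N * s)) (N * (erlang m (N * s) - w (N * s))).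
Proof. exact: (pderive_comp (dN s) (is_derive_erlangS m (N * s))). Qed.

Let dw0 s : is_derive s 1 (fun s => erlang m (N * s)) (N * 'D_1 (@erlang R m) (N * s)).
Proof.
have d := derivableP (@derivable_erlang R m (N * s)).
exact: (@pderive_comp R (erlang m) (fun s => N * s) s _ N (dN s) d).
Qed.

Let q_gt0 s : 0 <= s -> 0 < q (N * s).
Proof. by move=> s0; rewrite erlang_tail_gt0// mulr_ge0. Qed.

Let F s := ln (q (N * s)).
Let F1 s := (N * - w (N * s)) * (q (N * s))^-1.
Let F2 s := N ^+ 2 * (- (erlang m (N * s) + - w (N * s)) * (q (N * s))^-1 +
  - (w (N * s) * (q (N * s))^-1) ^+ 2).

Let mq : measurable_fun setT (fun s => q (N * s)).
Proof. by apply: continuous_measurable_fun; exact: is_derive_continuous dq. Qed.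

Let mw : measurable_fun setT (fun s => w (N * s)).
Proof. by apply: continuous_measurable_fun; exact: is_derive_continuous dw. Qed.

Let mw0 : measurable_fun setT (fun s => erlang m (N * s)).
Proof. by apply: continuous_measurable_fun; exact: is_derive_continuous dw0. Qed.

Let mqV : measurable_fun setT (fun s => (q (N * s))^-1).
Proof. exact: (measurableT_comp measurable_invr mq). Qed.

Let mopp (f : R -> R) : measurable_fun setT f -> measurable_fun setT (fun s => - f s).
Proof. exact: (measurableT_comp (@oppr_measurable R setT)). Qed.

Lemma integral_ln_tail_psi :
  \int[dA]_z (ln (q (N * normsq z)) * psi z) =
  \int[dA]_z (- N * (tail_defect (N * normsq z) * phi z)).
Proof.
have mF : measurable_fun setT F by exact: (measurableT_comp (@measurable_ln R) mq).
have mF1 : measurable_fun setT F1.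
  by apply: measurable_funM => //; apply: measurable_funM => //; exact: mopp.
have mF2 : measurable_fun setT F2.
  apply: measurable_funM => //; apply: measurable_funD.
    apply: measurable_funM => //; apply: mopp; apply: measurable_funD => //; exact: mopp.
  by apply: mopp; apply: measurable_funX; exact: measurable_funM.
have dF s : 0 <= s -> is_derive s 1 F (F1 s).
  by move=> s0; exact: (pderive_ln (dq s) (q_gt0 s0)).
have dF1 s : 0 <= s -> is_derive s 1 F1 (F2 s).
  move=> s0; have qn : q (N * s) != 0 by rewrite gt_eqF ?q_gt0.
  apply: (is_derive_eq (pderiveM (pderiveM (pderive_cst N s) (pderiveN (dw s)))
    (pderiveV (dq s) qn))).
  by rewrite /F2; field; rewrite qn.
have cF2 s : 0 <= s -> {for s, continuous F2}.
  move=> s0; have qn : q (N * s) != 0 by rewrite gt_eqF ?q_gt0.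
  exact: (is_derive_cvg (pderiveM (pderive_cst (N ^+ 2) s) (pderiveD (pderiveM
    (pderiveN (pderiveD (dw0 s) (pderiveN (dw s)))) (pderiveV (dq s) qn))
    (pderiveN (pderiveX 2 (pderiveM (dw s) (pderiveV (dq s) qn))))))).
have h := @laplacian_by_parts R a k k_gt0 F F1 F2 0 mF mF1 mF2 dF dF1 cF2.
have sE z : sqdist z 0 = normsq z by rewrite normsqE /sqdist !subr0.
transitivity (\int[dA]_z (F (sqdist z 0) * psi z)).
  by apply: eq_Rintegral => z _; rewrite sE.
rewrite h; apply: eq_Rintegral => z _; rewrite sE [RHS]mulrA; apply: (congr1 (fun x => x * phi z)).
have z0 := normsq_ge0 z; have qn : q (N * normsq z) != 0 by rewrite gt_eqF ?q_gt0.
rewrite /F1 /F2 /tail_defect.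
(* The relation s [erlang m s] = (m + 1) [erlang m.+1 s] eliminates the lower weight; with m + 1 = N
   - 1 the terms assemble into the factor N - s. *)
have wE : N * normsq z * erlang m (N * normsq z) = m.+1%:R * w (N * normsq z).
  have f0 : m`!%:R != 0 :> R by rewrite pnatr_eq0 -lt0n fact_gt0.
  by rewrite /erlang factS natrM exprS; field; rewrite f0 nat1r pnatr_eq0.
have NE : N = m.+1%:R + 1 by rewrite natr1.
move: (erlang m _) (w _) (q _) qn wE => w0 w1 q0 qn wE.
transitivity (- N * (N * normsq z * w0 / q0 - N * normsq z * w1 / q0 +
  N * normsq z * (w1 / q0) ^+ 2 + w1 / q0)); first by field.
rewrite wE [in m.+1%:R * _](_ : m.+1%:R = N - 1); last by rewrite NE addrK.
by field.
Qed.

Lemma measurable_tail_defect : measurable_fun setT (fun s => tail_defect (N * s)).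
Proof.
have mwq : measurable_fun setT (fun s => w (N * s) / q (N * s)) by exact: measurable_funM.
have ms : measurable_fun setT (fun s => N * s) by exact: measurable_funM.
apply: measurable_funD; apply: measurable_funM => //.
  by apply: measurable_funB.
exact: measurable_funX.
Qed.

Lemma measurable_tail : measurable_fun setT (fun s => q (N * s)).
Proof. exact: mq. Qed.

End logarithm_of_ginibre_density.

(** * A lower bound on the uniform distance *)

Section gap.
Context {R : realType}.
Variables (m : nat) (delta : plane R -> R) (c M : R).
Local Notation n := m.+2.
Local Notation N := (n%:R : R).
Hypothesis n_ge : (64 <= n)%N.
Hypothesis delta_min : is_thermal_equilibrium (@normsq R) 1 n delta.
Hypothesis bump2M : forall x : R, `|bump2 x| <= M.
Hypothesis c_gt0 : 0 < c.
Local Notation c0 := (expR (- 19) : R).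
Hypothesis c_le : c <= c0 / 2.
Local Notation rho z := (erlang_tail m.+1 (N * normsq z)).
Hypothesis near_rho : forall z, `|rho z - delta z| <= c.

Let r : R := Num.sqrt N.
(** The centre satisfies N a^2 = (r - 5/4)^2, close to N - 5r/2, the middle of the annulus. The
    half-width 1 / (8 r) moves N |z|^2 by about r / 4, so for [r >= 8] the whole box stays
    inside. *)
Let a : R := 1 - 5 / 4 / r.
Let k : R := 8 * r.
Local Notation phi := (phi a k).
Local Notation psi := (psi a k).
Local Notation box := (inbox a k).
Local Notation defect z := (tail_defect m (N * normsq z)).

Let rr : r ^+ 2 = N. Proof. by rewrite sqr_sqrtr. Qed.

Let r8 : 8 <= r.
Proof.
rewrite -(@ler_pXn2r _ 2)// ?nnegrE ?sqrtr_ge0// rr.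
have -> : (8 : R) ^+ 2 = 64%:R by ring.
by rewrite ler_nat.
Qed.

Let r_gt0 : 0 < r. Proof. by have := r8; lra. Qed.

Let k_gt0 : 0 < k. Proof. by rewrite mulr_gt0. Qed.

Let c0_gt0 : 0 < c0. Proof. exact: expR_gt0. Qed.

Let c0_le1 : c0 <= 1.
Proof. by have := ler_expR (- 19 : R) 0; rewrite expR0 => ->; lra. Qed.

Let box_edge z : box z -> N - 3 * r <= N * normsq z <= N - 2 * r.
Proof.
move=> /andP[]; rewrite /k /a; set x := z.1; set y := z.2 => hx hy.
have hr := r8; have hr0 := r_gt0; have rn : r != 0 by rewrite gt_eqF.
have e : 8 * r * (x - (1 - 5 / 4 / r)) = 8 * (r * x) - 8 * r + 10 by field.
rewrite e in hx; have := hx; rewrite ler_norml => /andP[h1 h2].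
have : `|8 * (r * y)| <= 1 by rewrite mulrA.
rewrite ler_norml => /andP[h3 h4].
rewrite normsqE -rr.
have -> : r ^+ 2 * (x ^+ 2 + y ^+ 2) = (r * x) ^+ 2 + (r * y) ^+ 2 by ring.
move: (r * x) (r * y) h1 h2 h3 h4 => X Y h1 h2 h3 h4.
apply/andP; split; nra.
Qed.

Let edge z : box z -> [/\ c0 <= rho z, c0 <= rho z - 1 + defect z & `|defect z| <= 2 * N].
Proof.
move=> /box_edge sN; have hr := r8; have r0 := r_gt0.
have NE : N = m.+2%:R by [].
have h1 := erlang_edge_ge NE r8 rr sN.
have h2 := erlang_tail_edge_ge NE r8 rr sN.
have h3 := erlang_edge_defect NE r8 rr sN.
have s0 : 0 <= N * normsq z by rewrite mulr_ge0// normsq_ge0.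
have w0 := erlang_ge0 m.+1 s0.
have q0 := erlang_tail_gt0 m.+1 s0.
split; [exact: le_trans h2|by rewrite addrA|].
rewrite /tail_defect; move: sN => /andP[_ sN].
move: (erlang m.+1 _) (erlang_tail m.+1 _) h2 w0 q0 => w q h2 w0 q0.
have wq0 : 0 <= w / q by rewrite divr_ge0// ltW.
have wq1 : w / q <= 1.
  rewrite ler_pdivrMr// mul1r; apply: le_trans h2; rewrite ler_peMl//; lra.
have N0 : 0 <= N by [].
move: (w / q) (N * normsq z) s0 sN wq0 wq1 => u s s0 sN u0 u1.
have u2 : u ^+ 2 <= 1 by rewrite expr_le1.
have u20 : 0 <= u ^+ 2 by rewrite sqr_ge0.
have sN' : s <= N by lra.
have p1 : 0 <= (N - s) * u by rewrite mulr_ge0// subr_ge0.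
have p2 : (N - s) * u <= N by apply: (@le_trans _ _ (N - s)); [rewrite ler_piMr// subr_ge0|lra].
have p3 : 0 <= s * u ^+ 2 by rewrite mulr_ge0.
have p4 : s * u ^+ 2 <= N by apply: (@le_trans _ _ s); [rewrite ler_piMr|].
by rewrite ger0_norm; lra.
Qed.

Let rho_le1 z : rho z <= 1.
Proof. by apply: erlang_tail_le1; rewrite mulr_ge0// normsq_ge0. Qed.

Let delta_box z : box z -> c0 / 2 <= delta z <= 2.
Proof.
move=> /edge[h _ _]; have := near_rho z; rewrite ler_norml => /andP[h1 h2].
have := rho_le1 z; have hc := c_le; have hc0 := c0_le1; move=> h3.
by apply/andP; split; lra.
Qed.

Let c02 : 0 < c0 / 2. Proof. by rewrite divr_gt0. Qed.

Let EL := euler_lagrange k_gt0 delta_min c02 delta_box.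

Let mrho : measurable_fun setT (fun z : plane R => rho z).
Proof. exact: (measurableT_comp (measurable_tail m) (@measurable_normsq R)). Qed.

Let mdefect : measurable_fun setT (fun z : plane R => defect z).
Proof. exact: (measurableT_comp (measurable_tail_defect m) (@measurable_normsq R)). Qed.

Let mdelta : measurable_fun setT delta.
Proof. exact: thermal_measurable delta_min. Qed.

Let int_deltaphi : dA.-integrable setT (fun z => (delta z * phi z)%:E).
Proof.
apply: (boxed_integrable k_gt0 (boxedM mdelta _ (boxed_phi a k))).
exists 2 => z /delta_box/andP[h1 h2]; rewrite ger0_norm//; have := c02; lra.
Qed.

Let int_phi : dA.-integrable setT (fun z => (phi z)%:E).
Proof. exact: (boxed_integrable k_gt0 (boxed_phi a k)). Qed.

Let int_defectphi : dA.-integrable setT (fun z => (defect z * phi z)%:E).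
Proof.
apply: (boxed_integrable k_gt0 (boxedM mdefect _ (boxed_phi a k))).
by exists (2 * N) => z /edge[].
Qed.

Let rho_box z : box z -> c0 / 2 <= rho z <= 2.
Proof.
move=> /edge[h _ _]; have := rho_le1 z; have := c0_gt0 => p0 p1.
by apply/andP; split; lra.
Qed.

Let int_lndelta : dA.-integrable setT (fun z => (ln (delta z) * psi z)%:E).
Proof.
exact: (boxed_integrable k_gt0 (boxedM (measurableT_comp (@measurable_ln R) mdelta)
  (bounded_on_box_ln c02 delta_box) (boxed_psi a k))).
Qed.

Let int_lnrho : dA.-integrable setT (fun z => (ln (rho z) * psi z)%:E).
Proof.
exact: (boxed_integrable k_gt0 (boxedM (measurableT_comp (@measurable_ln R) mrho)
  (bounded_on_box_ln c02 rho_box) (boxed_psi a k))).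
Qed.

Let ind (l : R) z : R := \1_[set z | inbox a l z] z.

Let int_ind l : 0 < l -> dA.-integrable setT (fun z => (ind l z)%:E) /\
  \int[dA]_z ind l z = 4 / (pi * l ^+ 2).
Proof. by move=> l0; apply: Rintegral_indic; [exact: measurable_inbox|exact: dA_inbox]. Qed.

(** Both densities are at least [c0 / 2] on the box, where [ln] has Lipschitz constant [2 / c0]. *)
Let ln_close z : box z -> `|ln (delta z) - ln (rho z)| <= 2 * c / c0.
Proof.
move=> zb; have /andP[d0 _] := delta_box zb; have /andP[q0 _] := rho_box zb.
have hp := c02; have hp0 := c0_gt0.
have dp := lt_le_trans hp d0; have qp := lt_le_trans hp q0.
have := near_rho z; rewrite ler_norml => /andP[h1 h2].
have cl (u v : R) : c0 / 2 <= u -> c0 / 2 <= v -> u - v <= c -> ln u - ln v <= 2 * c / c0.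
  move=> u0 v0 uv; have up := lt_le_trans hp u0; have vp := lt_le_trans hp v0.
  rewrite -ln_div ?posrE//.
  have -> : u / v = 1 + (u - v) / v by field; rewrite gt_eqF.
  have p1 : 0 < 1 + (u - v) / v.
    by rewrite (_ : 1 + (u - v) / v = u / v) ?divr_gt0//; field; rewrite gt_eqF.
  apply: (@le_trans _ _ ((u - v) / v)); first by apply: le_ln1Dx; lra.
  rewrite ler_pdivrMr//; apply: (le_trans uv).
  have e : 2 * c / c0 * (c0 / 2) = c by field; rewrite gt_eqF.
  rewrite -[leLHS]e ler_wpM2l// divr_ge0 ?(ltW hp0)// mulr_ge0// ltW//; exact: c_gt0.
rewrite ler_norml; apply/andP; split.
  by rewrite -opprB lerN2; apply: cl; lra.
by apply: cl; lra.
Qed.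

(** On the box delta - 1 + defect is at least E - c >= c0 / 2. On the concentric box of half the
    size [phi] is at least e^-8, and the area of that box is 1 / (64 pi N). *)
Let lower : c0 / 2 * (expR (- 8) / (64 * pi * N)) <=
  \int[dA]_z (delta z * phi z) - (\int[dA]_z phi z) + \int[dA]_z (defect z * phi z).
Proof.
have k2 : 0 < 2 * k by rewrite mulr_gt0.
have [i1 e1] := int_ind k2.
have -> : c0 / 2 * (expR (- 8) / (64 * pi * N)) =
    \int[dA]_z (c0 / 2 * expR (- 8) * ind (2 * k) z).
  rewrite (RintegralZl _ measurableT i1) e1 -rr /k.
  have := pi_gt0 R; have := r_gt0; move: pi (expR _) (expR _) => p u v r0 p0.
  by field; rewrite !gt_eqF.
rewrite -(RintegralB measurableT int_deltaphi int_phi).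
have i2 := RintegrableB int_deltaphi int_phi.
rewrite -(RintegralD measurableT i2 int_defectphi).
apply: (le_Rintegral measurableT (RintegrableZl _ i1) (RintegrableD i2 int_defectphi)).
move=> z _; have [zb|zb] := boolP (box z); last first.
  rewrite (phi_eq0 zb) !mulr0 subrr addr0 /ind indicE memNset ?mulr0//=.
  move=> /andP[h1 h2]; move/negP: zb; apply; apply/andP; split.
    by move: h1; rewrite -mulrA normrM ger0_norm//; have := normr_ge0 (k * (z.1 - a)); lra.
  by move: h2; rewrite -mulrA normrM ger0_norm//; have := normr_ge0 (k * z.2); lra.
have [_ h2 _] := edge zb; have p0 := phi_ge0 a k z.
have hc := c_le; have := near_rho z; rewrite ler_norml => /andP[n1 n2].
apply: (@le_trans _ _ (c0 / 2 * phi z)).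
  rewrite -mulrA ler_wpM2l ?(ltW c02)// /ind indicE.
  case: (boolP (z \in _)) => [/set_mem /andP[b1 b2]|_]; last by rewrite mulr0.
  have half (u : R) : `|2 * k * u| <= 1 -> `|k * u| <= 2^-1.
    by rewrite -mulrA normrM ger0_norm//; lra.
  have := bump0_half (half _ b1); have := bump0_half (half _ b2) => g1 g2.
  rewrite mulr1 /phi (_ : - 8 = - 4 + - 4) ?expRD; last by ring.
  by apply: ler_pM => //; exact: expR_ge0.
have -> : delta z * phi z - phi z + defect z * phi z = (delta z - 1 + defect z) * phi z by ring.
by rewrite ler_wpM2r//; lra.
Qed.

(** Subtracting the identity for ln rho from the Euler-Lagrange equation leaves 1/N times the
    integral of (ln delta - ln rho) psi. The bound k^2 M / 2 on [psi] meets the area 4 / (pi k^2) of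
    the box, and [k] cancels. *)
Let upper : \int[dA]_z (delta z * phi z) - (\int[dA]_z phi z) +
  \int[dA]_z (defect z * phi z) <= 4 * c * M / (c0 * pi * N).
Proof.
have N0 : N != 0 by rewrite pnatr_eq0.
have L := integral_ln_tail_psi a m k_gt0.
rewrite (RintegralZl _ measurableT int_defectphi) in L.
have -> : \int[dA]_z (delta z * phi z) - (\int[dA]_z phi z) +
    \int[dA]_z (defect z * phi z) =
    N^-1 * ((\int[dA]_z (ln (delta z) * psi z)) - (\int[dA]_z (ln (rho z) * psi z))).
  by rewrite EL L; field.
rewrite -(RintegralB measurableT int_lndelta int_lnrho).
have [i1 e1] := int_ind k_gt0.
pose K := 2 * c / c0 * (k ^+ 2 / 2 * M).
have -> : 4 * c * M / (c0 * pi * N) = N^-1 * \int[dA]_z (K * ind k z).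
  rewrite (RintegralZl _ measurableT i1) e1 /K /k.
  have := pi_gt0 R; have := r_gt0; have := c0_gt0.
  move: N0; move: (m.+2%:R) pi (expR _) => N' p u n0 u0 r0 p0.
  by field; rewrite n0 !gt_eqF.
rewrite ler_wpM2l ?invr_ge0//.
apply: (le_Rintegral measurableT (RintegrableB int_lndelta int_lnrho) (RintegrableZl _ i1)).
move=> z _; have [zb|zb] := boolP (box z); last first.
  by rewrite (psi_eq0 zb) !mulr0 subrr /ind indicE memNset ?mulr0//=; exact/negP.
rewrite /ind indicE mem_set// mulr1 -mulrBl; apply: (le_trans (ler_norm _)).
by rewrite normrM /K; apply: ler_pM => //; [exact: ln_close|exact: psi_le].
Qed.

(** Both bounds carry the same factor 1 / (pi N); clearing it leaves a lower bound on [c] that does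
    not depend on the number of particles. *)
Lemma density_gap : c0 ^+ 2 * expR (- 8) <= 512 * c * M.
Proof.
have h := le_trans lower upper.
have p0 := pi_gt0 R; have hc := c0_gt0; have N0 : 0 < N by rewrite ltr0n.
have K0 : 0 < 128 * c0 * pi * N by rewrite !mulr_gt0.
have := ler_wpM2l (ltW K0) h.
rewrite (_ : 128 * c0 * pi * N * (c0 / 2 * (expR (- 8) / (64 * pi * N))) = c0 ^+ 2 * expR (- 8)).
  rewrite (_ : 128 * c0 * pi * N * (4 * c * M / (c0 * pi * N)) = 512 * c * M)//.
  by move: p0 hc N0; move: pi (expR _) (m.+2%:R) => p u N' *; field; rewrite !gt_eqF.
by move: p0 hc N0; move: pi (expR (- 19)) (m.+2%:R) => p u N' *; field; rewrite !gt_eqF.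
Qed.

End gap.

Theorem theorem6p1 (R : realType) :
  exists2 c : R, 0 < c &
    forall delta : nat -> plane R -> R,
      (forall n, (0 < n)%N -> is_thermal_equilibrium (@normsq R) 1 n (delta n)) ->
      (c%:E <= limn_einf (fun n => (n%:R^-1)%:E * sup_norm (fun p =>
        one_point (@normsq R) 1 n p - n%:R * delta n p)%R))%E.
Proof.
have [M0 HM0] := @bump2_bounded R; pose M := `|M0| + 1.
have M_gt0 : 0 < M by rewrite ltr_wpDl.
have HM (x : R) : `|bump2 x| <= M.
  by apply: (le_trans (HM0 x)); rewrite (le_trans (ler_norm _))// lerDl.
pose c0 : R := expR (- 19); have c0_gt0 : 0 < c0 by exact: expR_gt0.
have e8 : 0 < expR (- 8) :> R by exact: expR_gt0.
(* The first entry keeps delta positive on the box. The second makes [512 * c * M] at most half of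
   the left side of [density_gap], which is contradictory because that side is positive. *)
pose c := Num.min (c0 / 2) (c0 ^+ 2 * expR (- 8) / (1024 * M)).
have K_gt0 : 0 < 1024 * M by apply: mulr_gt0; [rewrite ltr0n|exact: M_gt0].
have L_gt0 : 0 < c0 ^+ 2 * expR (- 8) by rewrite mulr_gt0 ?exprn_gt0.
have c_gt0 : 0 < c by rewrite lt_min divr_gt0// divr_gt0.
exists c => // delta delta_min.
rewrite limn_einf_lim; apply: lime_ge; first exact: is_cvg_einfs.
near=> n0; apply: le_ereal_inf_tmp => _ [n /= n0n <-].
have n64 : (64 <= n)%N by apply: leq_trans n0n; near: n0; exact: nbhs_infty_ge.
(* If the term were below [c], dividing the pointwise difference by [n] would put rho and delta
   within [c] of each other everywhere, as [density_gap] supposes. *)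
rewrite leNgt; apply/negP.
have n_gt0 : 0 < n%:R :> R by rewrite ltr0n (leq_trans _ n64).
rewrite lte_pdivrMl// => S.
case: n n0n n64 n_gt0 S => [|[|m]] // _ n64 n_gt0 S.
have near_rho z : `|erlang_tail m.+1 (m.+2%:R * normsq z) - delta m.+2 z| <= c.
  have : (`|one_point (@normsq R) 1 m.+2 z - m.+2%:R * delta m.+2 z|%:E < (m.+2%:R * c)%:E)%E.
    by apply: le_lt_trans S; apply: ereal_sup_ubound; exists z.
  rewrite one_point_ginibre -mulrBr lte_fin normrM (gtr0_norm n_gt0) ltr_pM2l// => h.
  exact: ltW.
have cc : c <= c0 / 2 by rewrite ge_min lexx.
have := density_gap n64 (delta_min m.+2 isT) HM c_gt0 cc near_rho.
have : c <= c0 ^+ 2 * expR (- 8) / (1024 * M) by rewrite ge_min lexx orbT.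
rewrite ler_pdivlMr// => h1 h2; rewrite -/c0 in h2; lra.
Unshelve. all: end_near. Qed.
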